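(* Let $s\in(0,1)$ and let $u$ be a solution of $(-\Delta)^{s/2}u=u-u^3$ in $\mathbb{R}^2$ which is a minimizer of $\mathcal E$ in $\mathbb{R}^2$. Then $u$ is one-dimensional, i.e. there exist $\bar u:\mathbb{R}\to\mathbb{R}$ and $\bar\omega\in S^{1}$ with $u(x)=\bar u(\bar\omega\cdot x)$ for all $x\in\mathbb{R}^2$.
   Context: Here $(-\Delta)^{s/2}u(x):=\int_{\mathbb{R}^n}\frac{u(x)-u(x+y)}{|y|^{n+s}}\,dy$ (normalization constant dropped), with $n=2$. For a domain $\Omega\subset\mathbb{R}^n$, $\mathcal E(u,\Omega):=\mathcal E^{\rm Dir}(u,\Omega)+\int_\Omega(1-u^2(x))^2\,dx$, where $\mathcal E^{\rm Dir}(u,\Omega):=C_{n,s}\iint_{\mathbb{R}^{2n}\setminus(\mathbb{R}^n\setminus\Omega)^2}\frac{|u(x)-u(y)|^2}{|x-y|^{n+s}}\,dx\,dy$ for an appropriate constant $C_{n,s}>0$. A solution $u$ is a minimizer of $\mathcal E$ in $\mathbb{R}^n$ if $\mathcal E(u,B)\le\mathcal E(u+\varphi,B)$ for every ball $B\subset\mathbb{R}^n$ and every $\varphi\in C^\infty_0(B)$. *)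

(* Defs.v *)
From HB Require Import structures.
From mathcomp Require Import all_boot all_order all_algebra.
From mathcomp Require Import all_classical all_reals all_analysis.
Set Implicit Arguments. Unset Strict Implicit. Unset Printing Implicit Defensive.
Import Order.TTheory GRing.Theory Num.Theory.
Import numFieldNormedType.Exports.
Local Open Scope classical_set_scope.
Local Open Scope ring_scope.

Definition dot2 {R : realType} (a b : R * R) : R := a.1 * b.1 + a.2 * b.2.
Definition norm2 {R : realType} (a : R * R) : R := Num.sqrt (dot2 a a).

Definition leb2 {R : realType} := ((@lebesgue_measure R) \x (@lebesgue_measure R))%E.

Definition eball {R : realType} (c : R * R) (r : R) : set (R * R) :=
  [set x | norm2 (x - c) < r].

Fixpoint iterD {R : realType} (vs : seq (R * R)) (f : R * R -> R) : R * R -> R :=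
  match vs with
  | [::] => f
  | v :: vs' => fun x => 'D_v (iterD vs' f) x
  end.
Definition smooth {R : realType} (f : R * R -> R) : Prop :=
  forall (vs : seq (R * R)) (x : R * R), differentiable (iterD vs f) x.

Definition Cinf_c {R : realType} (B : set (R * R)) (phi : R * R -> R) : Prop :=
  smooth phi /\ compact (closure [set x | phi x != 0]) /\
  closure [set x | phi x != 0] `<=` B.

(* (-Delta)^{s/2} u (x) = int (u(x) - u(x+y)) / |y|^{2+s} dy, holding with
   the integral absolutely convergent *)
Definition frac_kernel_int {R : realType} (s : R) (u : R * R -> R) (x : R * R) :=
  fun y : R * R => (u x - u (x + y)) / (norm2 y `^ (2 + s)).

Definition solves_eq {R : realType} (s : R) (u : R * R -> R) : Prop :=
  forall x : R * R,
    leb2.-integrable setT (EFin \o frac_kernel_int s u x) /\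
    Rintegral leb2 setT (frac_kernel_int s u x) = u x - u x ^+ 3.

(* Energy; constant C_{2,s} = 1, consistent with the normalization of the equation *)
Definition Edir {R : realType} (s : R) (u : R * R -> R) (O : set (R * R)) : \bar R :=
  (\int[leb2 \x leb2]_(z in ~` ((~` O) `*` (~` O)))
     ((u z.1 - u z.2) ^+ 2 / (norm2 (z.1 - z.2) `^ (2 + s)))%:E)%E.

Definition Energy {R : realType} (s : R) (u : R * R -> R) (O : set (R * R)) : \bar R :=
  (Edir s u O + \int[leb2]_(x in O) ((1 - u x ^+ 2) ^+ 2)%:E)%E.

Definition is_minimizer {R : realType} (s : R) (u : R * R -> R) : Prop :=
  forall (c : R * R) (r : R), 0 < r ->
  forall phi : R * R -> R, Cinf_c (eball c r) phi ->
    (Energy s u (eball c r) <= Energy s (fun x => (u x + phi x)%R) (eball c r))%E.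

(* Main.v *)
(* The competitors are obtained by sliding [u] by a fixed vector [h] inside a huge ball, with
   a logarithmic cutoff.  The energy of [u] in a ball of radius [r] is [O(r^2)] (test the equation
   satisfied by [u ^ 2]), and the plane has zero logarithmic capacity for such a growth, so the
   slides [u+] and [u-] by [h] and [-h] satisfy [E u+ + E u- <= 2 E u + o(1)]; minimality of [u]
   against [u-] gives [E u+ <= E u + o(1)].  On the other hand the energy is submodular:
   [E (max u u+) + E (min u u+) + 2 G <= E u + E u+], where [G] is the double integral of
   [(u - u+)^+ (x) (u+ - u)^+ (y) / |x - y| ^ (2 + s)].  Hence [G = o(1)], and in the limit
   [u - u (. + h)] does not change sign, for every [h].  The vectors [h] with [u <= u (. + h)] thus
   form a closed set [P] with [P] and [- P] covering the plane; by connectedness the closed group of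
   periods [P] inter [- P] has arbitrarily small nonzero elements, hence contains a line.

   Finiteness of the energies and the boundedness [|u| <= 1] are not assumed: they come from a
   maximum principle for the equation, through Baire's theorem for the continuity of [u]. *)
Require Import Defs.
From HB Require Import structures.
From mathcomp Require Import all_boot all_order all_algebra.
From mathcomp Require Import all_classical all_reals all_analysis.
From mathcomp Require Import measurable_realfun ring lra.
Set Implicit Arguments. Unset Strict Implicit. Unset Printing Implicit Defensive.
Import Order.TTheory GRing.Theory Num.Theory.
Import numFieldNormedType.Exports.
Local Open Scope classical_set_scope.
Local Open Scope ring_scope.

(** * Lebesgue integrals in the plane *)

(** Two obstacles shape the technical part. The equation holds at every point with an absolutely
    convergent integral, but [u] is only measurable; so the equation is used one-sidedly, tested
    against nonnegative functions, where Tonelli's theorem asks for no integrability. And minimality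
    speaks only of smooth perturbations, while slides, maxima and minima of [u] are merely
    continuous; their differences from [u] have to be approximated by smooth functions in the energy
    norm. The smallness is quantitative. With outer radius [2 ^+ n] the cutoff has slope of order
    [1 / (n |x|)]. Its square, against an energy growing like [r ^+ 2], gives about [n] dyadic
    annuli of size [1 / n ^+ 2] each, hence [O(1 / n)]. Such a quadratic error is reached by adding
    the energies of two opposite slides. All slides move points along one direction [(1, k)], so
    that the change of variables is a one-variable substitution on every line of that direction;
    vertical translations are recovered afterwards by a limit. *)

Section sigma_finite_product.
Local Open Scope ereal_scope.
Context d1 d2 (T1 : measurableType d1) (T2 : measurableType d2) (R : realType).
Variable m1 : {sigma_finite_measure set T1 -> \bar R}.
Variable m2 : {sigma_finite_measure set T2 -> \bar R}.

Definition prodm := (m1 \x m2).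

HB.instance Definition _ := Measure.on prodm.

Let prodm_sigma_finite : sigma_finite setT prodm.
Proof.
have /sigma_finiteP[F [TF ndF Foo]] := sigma_finiteT m1.
have /sigma_finiteP[G [TG ndG Goo]] := sigma_finiteT m2.
exists (fun n => F n `*` G n).
  rewrite -setXTT TF TG predeqE => -[x y]; split.
    move=> [/= [n _ Fnx] [k _ Gky]]; exists (maxn n k) => //; split.
    - by move: x Fnx; exact/subsetPset/ndF/leq_maxl.
    - by move: y Gky; exact/subsetPset/ndG/leq_maxr.
  by move=> [n _ []/= ? ?]; split; exists n.
move=> k; have [? ?] := Foo k; have [? ?] := Goo k.
split; first exact: measurableX.
by rewrite /prodm product_measure1E// lte_mul_pinfty// ge0_fin_numE.
Qed.

HB.instance Definition _ :=
  Measure_isSigmaFinite.Build _ _ _ prodm prodm_sigma_finite.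

End sigma_finite_product.


Section density_pushforward.
Local Open Scope ereal_scope.
Context d1 d2 (T1 : measurableType d1) (T2 : measurableType d2) (R : realType).
Variables (m : {measure set T1 -> \bar R}) (w : T1 -> R) (F : T1 -> T2).
Hypotheses (mw : measurable_fun setT w) (w0 : forall x, (0 <= w x)%R)
  (mF : measurable_fun setT F).

(** The image under [F] of the measure of density [w]. Being a measure, it is determined by its
    values on intervals, which is all that a substitution formula then has to check. *)
Definition dpush (A : set T2) : \bar R := \int[m]_x ((\1_A (F x))%R * w x)%:E.

Let measurable_dpush A : measurable A ->
  measurable_fun setT (fun x => (\1_A (F x) * w x)%:E).
Proof.
move=> mA; apply/measurable_EFinP; apply: measurable_funM => //.
by apply: measurableT_comp => //; exact: measurable_indic.
Qed.

Let dpush0 : dpush set0 = 0.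
Proof.
by rewrite /dpush integral0_eq// => x _; rewrite indic0 mul0r.
Qed.

Let dpush_ge0 A : 0 <= dpush A.
Proof. by apply: integral_ge0 => x _; rewrite lee_fin mulr_ge0. Qed.

Let dpush_sigma_additive : semi_sigma_additive dpush.
Proof.
move=> A mA tA mUA.
rewrite [X in _ --> X](_ : _ = \sum_(n <oo) dpush (A n)); last first.
  rewrite /dpush -integral_nneseries//; last 2 first.
  - by move=> n; exact: measurable_dpush.
  - by move=> n x _; rewrite lee_fin mulr_ge0.
  apply: eq_integral => x _.
  under eq_eseriesr do rewrite EFinM muleC.
  rewrite nneseriesZl//.
  rewrite [LHS]EFinM [LHS]muleC; congr (_ * _).
  have [[k _ kx]|nx] := pselect ((\bigcup_n A n) (F x)).
    rewrite (@nneseriesD1 _ _ k xpredT)//.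
    rewrite !indicE !mem_set//; last by exists k.
    rewrite eseries0 ?adde0// => i _ ik; rewrite indicE memNset//.
    move=> Ai; move/trivIsetP : tA => /(_ _ _ Logic.I Logic.I ik)/seteqP[+ _].
    by move/(_ (F x)); apply.
  rewrite indicE memNset// eseries0// => i _ _; rewrite indicE memNset//.
  by move=> Ai; apply: nx; exists i.
by apply/cvg_closeP; split; [exact: is_cvg_nneseries|rewrite closeE].
Qed.

HB.instance Definition _ := isMeasure.Build _ _ _ dpush
  dpush0 dpush_ge0 dpush_sigma_additive.

Import HBNNSimple.

Lemma integral_dpush (f : T2 -> \bar R) :
  measurable_fun setT f -> (forall x, 0 <= f x) ->
  \int[dpush]_x f x = \int[m]_x (f (F x) * (w x)%:E).
Proof.
move=> mf f0.
pose f_ := nnsfun_approx measurableT mf.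
have mfF n : measurable_fun setT (fun x => (f_ n (F x) * w x)%:E).
  by apply/measurable_EFinP; apply: measurable_funM => //; exact: measurableT_comp.
transitivity (lim (\int[dpush]_x (f_ n x)%:E @[n --> \oo])).
  rewrite -monotone_convergence//=.
  - apply: eq_integral => ? /[!inE] xD; apply/esym/cvg_lim => //=.
    exact: cvg_nnsfun_approx.
  - by move=> n; exact/measurable_EFinP/measurable_funTS.
  - by move=> n ? _; rewrite lee_fin.
  - by move=> ? _ ? ? mn; rewrite lee_fin; exact/lefP/nd_nnsfun_approx.
transitivity (lim (\int[m]_x (f_ n (F x) * w x)%:E @[n --> \oo])); last first.
  rewrite -monotone_convergence//=.
  - apply: eq_integral => x _; apply/cvg_lim => //.
    under eq_cvg do rewrite EFinM.
    by apply: cvgeZr => //; apply: cvg_nnsfun_approx.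
  - by move=> n ? _; rewrite lee_fin mulr_ge0.
  - move=> x _ a b ab; rewrite lee_fin ler_wpM2r//.
    exact/lefP/nd_nnsfun_approx.
apply: congr_lim; apply/funext => n /=.
under [LHS]eq_integral do rewrite fimfunE -fsumEFin//.
rewrite [LHS]ge0_integral_fsum//; last 2 first.
  - by move=> r; exact/measurable_EFinP/measurableT_comp.
  - by move=> k x _; rewrite EFinM nnfun_muleindic_ge0.
under [RHS]eq_integral.
  move=> x xD; rewrite fimfunE EFinM -fsumEFin// ge0_mule_fsuml; last first.
    by move=> r; rewrite EFinM nnfun_muleindic_ge0.
  over.
rewrite [RHS]ge0_integral_fsum//; last 2 first.
  - move=> r; apply: emeasurable_funM; last exact/measurable_EFinP.
    apply/measurable_EFinP; apply: measurable_funM => //.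
    by apply: measurableT_comp => //; exact: measurable_indic.
  - move=> k x _; rewrite EFinM mule_ge0// ?lee_fin//.
    by rewrite -lee_fin EFinM nnfun_muleindic_ge0.
apply: eq_fsbigr => r _.
rewrite integralZl_indic_nnsfun// integral_indic// setIT /= {1}/dpush.
under [RHS]eq_integral do rewrite EFinM -muleA.
have [r0|/preimage_nnfun0 ->] := leP 0%R r; last first.
  by under [RHS]eq_integral do rewrite indic0 mul0e mule0; rewrite integral0
     integral0_eq ?mule0// => x _; rewrite indic0 mul0r.
rewrite ge0_integralZl//.
- by apply: measurable_dpush.
- by move=> x _; rewrite mule_ge0// lee_fin.
Qed.

End density_pushforward.

Section lam.
Context {R : realType}.
Notation mu := (@lebesgue_measure R).
(** The measure [leb2] packaged as sigma-finite, so that Tonelli's theorem applies to it and, by the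
    same construction, to pairs of points of the plane. *)
Definition lam : {sigma_finite_measure set (measurableTypeR R * measurableTypeR R)%type -> \bar R} := prodm mu mu.
Definition lam2 : {sigma_finite_measure set ((measurableTypeR R * measurableTypeR R)%type * (measurableTypeR R * measurableTypeR R)%type)%type -> \bar R}
   := prodm lam lam.
Lemma EdirE s (u : R*R->R) O : Edir s u O = (\int[lam2]_(z in ~` (~` O `*` ~` O))
    ((u z.1 - u z.2) ^+ 2 / norm2 (z.1 - z.2) `^ (2 + s))%:E)%E.
Proof. reflexivity. Qed.
End lam.

Section substitution.
Context {R : realType}.
Notation mu := (@lebesgue_measure R).

(* The image under F of the density F' agrees with Lebesgue measure on intervals. *)
Lemma ge0_substitution (F F' : R -> R) (G : R -> \bar R) :
  (forall x : R, is_derive x 1 F (F' x)) -> continuous F' -> (forall x, 0 <= F' x) ->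
  {mono F : x y / x <= y} -> (forall y, exists x, F x = y) ->
  measurable_fun setT G -> (forall x, (0 <= G x)%E) ->
  (\int[mu]_x G x = \int[mu]_x (G (F x) * (F' x)%:E))%E.
Proof.
move=> dF cF' F'0 mF sF mG G0.
have cF : continuous F.
  move=> x; apply/differentiable_continuous/derivable1_diffP.
  by apply: ex_derive; exact: dF.
have mF' : measurable_fun setT F' by exact: continuous_measurable_fun.
have meF : measurable_fun setT F by exact: continuous_measurable_fun.
rewrite -(@integral_dpush _ _ (measurableTypeR R) (measurableTypeR R) R mu F' F mF' F'0 meF G mG G0).
apply: eq_measure_integral => A mA _.
apply: lebesgue_measure_unique mA => _ [[a b] _ <-] /=.
rewrite /dpush lebesgue_measure_itv/= lte_fin.
have [x Fx] := sF a; have [y Fy] := sF b.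
have ltF := leW_mono mF.
case: ifPn => [ab|]; last first.
  rewrite -leNgt => ba; rewrite integral0_eq// => z _.
  rewrite indicE memNset ?mul0r// => /=; rewrite in_itv/= => /andP[az zb].
  by have := lt_le_trans az zb; rewrite ltNge ba.
have xy : x < y by rewrite -ltF Fx Fy.
transitivity (\int[mu]_(z in `]x, y]) (F' z)%:E)%E; last first.
  rewrite integral_mkcond; apply: eq_integral => z _; rewrite patchE indicE -Fx -Fy.
  rewrite (_ : (F z \in _) = (z \in `]x, y]%classic)); first by case: ifP => _; rewrite ?mul1r ?mul0r.
  by apply/idP/idP; rewrite !inE /= !in_itv/= ltF mF.
rewrite integral_itv_obnd_cbnd; last exact/measurable_EFinP/measurable_funTS.
rewrite (@continuous_FTC2 _ F' F)// ?Fx ?Fy//.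
- exact: continuous_subspaceT.
- split => //.
  + by apply: cvg_at_right_filter; exact: cF.
  + by apply: cvg_at_left_filter; exact: cF.
- by move=> z _; rewrite derive1E; apply: derive_val.
Qed.

Lemma ge0_integral_shift (a : R) (G : R -> \bar R) :
  measurable_fun setT G -> (forall x, (0 <= G x)%E) ->
  (\int[mu]_x G (x + a)%R = \int[mu]_x G x)%E.
Proof.
move=> mG G0.
rewrite [RHS](@ge0_substitution (fun x => x + a) (fun=> 1))//.
- by apply: eq_integral => x _; rewrite mule1.
- by move=> x; apply: is_derive_eq; rewrite addr0.
- by move=> x; exact: cvg_cst.
- by move=> x y; rewrite lerD2r.
- by move=> y; exists (y - a); rewrite subrK.
Qed.

End substitution.

Section lam_theory.
Context {R : realType}.
Notation mu := (@lebesgue_measure R).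
Implicit Types f : R * R -> \bar R.

Lemma lam_tonelli f : measurable_fun setT f -> (forall x, (0 <= f x)%E) ->
  (\int[lam]_x f x = \int[mu]_a \int[mu]_b f (a, b))%E.
Proof. exact: (fubini_tonelli1 (m1 := mu) (m2 := mu)). Qed.

Lemma lam_tonelliC f : measurable_fun setT f -> (forall x, (0 <= f x)%E) ->
  (\int[lam]_x f x = \int[mu]_b \int[mu]_a f (a, b))%E.
Proof. exact: (fubini_tonelli2 (m1 := mu) (m2 := mu)). Qed.

Lemma lam2_tonelli (f : (R * R) * (R * R) -> \bar R) :
  measurable_fun setT f -> (forall x, (0 <= f x)%E) ->
  (\int[lam2]_x f x = \int[lam]_a \int[lam]_b f (a, b))%E.
Proof. exact: (fubini_tonelli1 (m1 := lam) (m2 := lam)). Qed.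

Lemma lam2_tonelliC (f : (R * R) * (R * R) -> \bar R) :
  measurable_fun setT f -> (forall x, (0 <= f x)%E) ->
  (\int[lam2]_x f x = \int[lam]_b \int[lam]_a f (a, b))%E.
Proof. exact: (fubini_tonelli2 (m1 := lam) (m2 := lam)). Qed.

Lemma measurable_slice d1 d2 d3 (T1 : measurableType d1) (T2 : measurableType d2)
  (T3 : measurableType d3) (f : T1 * T2 -> T3) a :
  measurable_fun setT f -> measurable_fun setT (fun b => f (a, b)).
Proof. by move=> mf; apply: measurableT_comp mf _; exact: measurable_fun_pair. Qed.

Lemma measurable_sliceC d1 d2 d3 (T1 : measurableType d1) (T2 : measurableType d2)
  (T3 : measurableType d3) (f : T1 * T2 -> T3) b :
  measurable_fun setT f -> measurable_fun setT (fun a => f (a, b)).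
Proof. by move=> mf; apply: measurableT_comp mf _; exact: measurable_fun_pair. Qed.

Lemma measurable_addp d (T : measurableType d) (f g : T -> R * R) :
  measurable_fun setT f -> measurable_fun setT g ->
  measurable_fun setT (fun x => f x + g x).
Proof.
move=> mf mg; apply: measurable_fun_pair; apply: measurable_funD.
- by apply: measurableT_comp mf; exact: measurable_fst.
- by apply: measurableT_comp mg; exact: measurable_fst.
- by apply: measurableT_comp mf; exact: measurable_snd.
- by apply: measurableT_comp mg; exact: measurable_snd.
Qed.

Lemma measurable_oppp d (T : measurableType d) (f : T -> R * R) :
  measurable_fun setT f -> measurable_fun setT (fun x => - f x).
Proof.
move=> mf; apply: measurable_fun_pair; apply: measurable_funN.
- by apply: measurableT_comp mf; exact: measurable_fst.
- by apply: measurableT_comp mf; exact: measurable_snd.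
Qed.

Lemma measurable_subp d (T : measurableType d) (f g : T -> R * R) :
  measurable_fun setT f -> measurable_fun setT g ->
  measurable_fun setT (fun x => f x - g x).
Proof. by move=> mf mg; apply: measurable_addp mf (measurable_oppp mg). Qed.

Lemma measurable_norm2 d (T : measurableType d) (f : T -> R * R) :
  measurable_fun setT f -> measurable_fun setT (fun x => norm2 (f x)).
Proof.
move=> mf; have ms : measurable_fun setT (@Num.sqrt R).
  by apply: continuous_measurable_fun; exact: sqrt_continuous.
apply: (measurableT_comp ms (g := fun x => dot2 (f x) (f x))).
have m1 : measurable_fun setT (fun x => (f x).1).
  by apply: measurableT_comp mf; exact: measurable_fst.
have m2 : measurable_fun setT (fun x => (f x).2).
  by apply: measurableT_comp mf; exact: measurable_snd.
by apply: measurable_funD; exact: measurable_funM.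
Qed.

Lemma lam_shift (a : R * R) f : measurable_fun setT f -> (forall x, (0 <= f x)%E) ->
  (\int[lam]_x f (x + a)%R = \int[lam]_x f x)%E.
Proof.
move=> mf f0; rewrite !lam_tonelli//; last first.
  by apply: measurableT_comp mf _; apply: measurable_addp.
under eq_integral => x _.
  rewrite /=(_ : (\int[mu]_b _ = \int[mu]_b f ((x : R) + a.1, b)%R)%E); last first.
    rewrite -(ge0_integral_shift a.2 (G := fun b => f ((x : R) + a.1, b)%R))//.
    exact: measurable_slice.
  over.
apply: (ge0_integral_shift a.1 (G := fun x => \int[mu]_b f (x, b))%E).
- exact: (@measurable_fun_fubini_tonelli_F _ _ _ _ _ mu).
- by move=> x; exact: integral_ge0.
Qed.

End lam_theory.

(** * The Euclidean norm of the plane and continuity with respect to it *)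

Section norm2_theory.
Context {R : realType}.
Implicit Types a b z : R * R.

Lemma dot2_ge0 a : 0 <= dot2 a a.
Proof. by rewrite addr_ge0// -expr2 sqr_ge0. Qed.

Lemma norm2_ge0 a : 0 <= norm2 a. Proof. exact: sqrtr_ge0. Qed.

Lemma sqr_norm2 a : norm2 a ^+ 2 = dot2 a a.
Proof. by rewrite sqr_sqrtr// dot2_ge0. Qed.

Lemma norm2N a : norm2 (- a) = norm2 a.
Proof. by rewrite /norm2 /dot2 /= !mulrNN. Qed.

Lemma norm2BC a b : norm2 (a - b) = norm2 (b - a).
Proof. by rewrite -norm2N opprB. Qed.

Lemma norm2_eq0 a : (norm2 a == 0) = (a == 0).
Proof.
case: a => x y; rewrite sqrtr_eq0; apply/idP/eqP => [|[-> ->]]; last first.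
  by rewrite /dot2 /= !mul0r addr0.
rewrite /dot2/= -!expr2 => h; have := sqr_ge0 x; have := sqr_ge0 y => y0 x0.
have /eqP : x ^+ 2 = 0 by lra.
have /eqP : y ^+ 2 = 0 by lra.
by rewrite !sqrf_eq0 => /eqP -> /eqP ->.
Qed.

Lemma norm2_0 : norm2 (0 : R * R) = 0.
Proof. by apply/eqP; rewrite norm2_eq0. Qed.

Lemma norm2_gt0 a : (0 < norm2 a) = (a != 0).
Proof. by rewrite lt0r norm2_eq0 norm2_ge0 andbT. Qed.

Lemma norm2_le_sqr a (r : R) : 0 <= r -> (norm2 a <= r) = (dot2 a a <= r ^+ 2).
Proof. by move=> r0; rewrite -sqr_norm2 ler_sqr// nnegrE norm2_ge0. Qed.

Lemma le_norm2D a b : norm2 (a + b) <= norm2 a + norm2 b.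
Proof.
have h : dot2 a b <= norm2 a * norm2 b.
  have [h|/ltW h] := leP (dot2 a b) 0.
    by rewrite (le_trans h)// mulr_ge0// norm2_ge0.
  rewrite -ler_sqr ?nnegrE//; last by rewrite mulr_ge0 ?norm2_ge0.
  rewrite exprMn !sqr_norm2 /dot2.
  have := sqr_ge0 (a.1 * b.2 - a.2 * b.1); nra.
rewrite norm2_le_sqr ?addr_ge0 ?norm2_ge0// sqrrD !sqr_norm2.
by move: h; rewrite /dot2 /=; nra.
Qed.

Lemma le_norm2_fst a : `|a.1| <= norm2 a.
Proof.
rewrite -ler_sqr ?nnegrE ?norm2_ge0// sqr_norm2 real_normK ?num_real//.
by rewrite /dot2 -!expr2 lerDl sqr_ge0.
Qed.

Lemma le_norm2_snd a : `|a.2| <= norm2 a.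
Proof.
rewrite -ler_sqr ?nnegrE ?norm2_ge0// sqr_norm2 real_normK ?num_real//.
by rewrite /dot2 -!expr2 lerDr sqr_ge0.
Qed.

Lemma norm2_le a : norm2 a <= `|a.1| + `|a.2|.
Proof.
rewrite norm2_le_sqr ?addr_ge0// sqrrD !real_normK ?num_real// /dot2.
by have := mulr_ge0 (normr_ge0 a.1) (normr_ge0 a.2); lra.
Qed.

Lemma norm2_scale (c : R) a : norm2 (c * a.1, c * a.2) = `|c| * norm2 a.
Proof.
apply/eqP; rewrite -(@eqrXn2 _ 2)// ?mulr_ge0 ?norm2_ge0//.
rewrite sqr_norm2 exprMn sqr_norm2 real_normK ?num_real// /dot2/=.
by apply/eqP; ring.
Qed.

Lemma norm2_dist a b c : norm2 (a - c) <= norm2 (a - b) + norm2 (b - c).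
Proof. by rewrite (_ : a - c = (a - b) + (b - c)) ?le_norm2D// addrA subrK. Qed.

Lemma ball_norm2 x e a : norm2 (a - x) < e -> ball x e a.
Proof.
move=> h; split; rewrite /ball /= distrC.
  by apply: le_lt_trans h; exact: (le_norm2_fst (a - x)).
by apply: le_lt_trans h; exact: (le_norm2_snd (a - x)).
Qed.

Lemma ball_norm2_le x e a : ball x e a -> norm2 (a - x) < e + e.
Proof.
case; rewrite /ball /= => h1 h2.
rewrite (le_lt_trans (norm2_le _))// ltrD//=; by rewrite distrC.
Qed.

End norm2_theory.

(** Continuity in the Euclidean norm, in the form in which moduli of continuity are used. The
    topology of [R * R] is that of the sup norm; [cont2P] shows that the two notions agree. *)
Definition cont2 {R : realType} (f : R * R -> R) (x : R * R) :=
  forall e, 0 < e -> exists2 d, 0 < d & forall y, norm2 (y - x) < d -> `|f y - f x| < e.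

Section cont2_theory.
Context {R : realType}.
Implicit Types (f : R * R -> R) (O : set (R * R)).

Lemma cont2P f x : cont2 f x <-> {for x, continuous f}.
Proof.
split=> [cf|/cvgrPdist_lt cf].
  apply/cvgrPdist_lt => e e0; have [d d0 dx] := cf _ e0.
  have d20 : 0 < d / 2 by rewrite divr_gt0.
  apply: filterS (nbhsx_ballx x (d / 2) d20) => y /ball_norm2_le.
  by rewrite -splitr => /dx; rewrite distrC.
move=> e e0; have [d /= d0 dx] := (nbhs_ballP _ _).1 (cf e e0); exists d => // y /ball_norm2 /dx.
by rewrite distrC.
Qed.

(** The sigma-algebra of the plane is a product one, so an open set has to be written as a countable
    union of rectangles: the rational squares that it contains. *)
Lemma open_measurable2 O : open O -> measurable O.
Proof.
move=> oO.
pose box (t : rat * rat * rat) : set (R * R) :=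
  ball (ratr t.1.1 : R) (ratr t.2) `*` ball (ratr t.1.2 : R) (ratr t.2).
pose F t := if `[< box t `<=` O >] then box t else set0.
rewrite (_ : O = \bigcup_t F t).
  apply: countable_bigcupT_measurable => //.
  move=> t; rewrite /F; case: ifP => // _.
  by apply: measurableX; exact: measurable_ball.
apply/seteqP; split=> [x Ox|x [t _]]; last first.
  by rewrite /F; case: asboolP => // h /h.
have [e /= e0 he] := (nbhs_ballP x O).1 (open_nbhs_nbhs (conj oO Ox)).
have [r] := @rat_in_itvoo R (0) (e / 2) ltac:(by rewrite divr_gt0).
rewrite in_itv/= => /andP[r0 re].
have near1 (a : R) : exists q : rat, `|ratr q - a| < ratr r.
  have [q] := @rat_in_itvoo R (a - ratr r) (a + ratr r) ltac:(lra).
  by rewrite in_itv/= => /andP[h1 h2]; exists q; rewrite ltr_distl; apply/andP; split; lra.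
have [q1 h1] := near1 x.1; have [q2 h2] := near1 x.2.
exists ((q1, q2), r) => //; rewrite /F.
have xb : box ((q1, q2), r) x by split.
case: asboolP => // -[]; move=> y [/= y1 y2]; apply: he; split; rewrite /ball /=.
  rewrite (le_lt_trans (ler_distD (ratr q1) _ _))// [e]splitr ltrD//.
    by rewrite distrC (lt_trans h1).
  by rewrite (lt_trans y1).
rewrite (le_lt_trans (ler_distD (ratr q2) _ _))// [e]splitr ltrD//.
  by rewrite distrC (lt_trans h2).
by rewrite (lt_trans y2).
Qed.

Lemma continuous_measurable2 f : continuous f -> measurable_fun setT f.
Proof.
move=> cf; apply: (measurability _ (RGenOpens.measurableE R)).
move=> _ [_ [a [b ->] <-]]; rewrite setTI; apply: open_measurable2.
by apply: open_comp => [x _|]; [exact: cf|exact: interval_open].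
Qed.

Lemma cont2_measurable f : (forall x, cont2 f x) -> measurable_fun setT f.
Proof. by move=> cf; apply: continuous_measurable2 => x; apply/cont2P. Qed.

End cont2_theory.

(** Restrictions of the domain are written as factors [chi] under integrals over the whole space, so
    that domains never change and measurability is a matter of syntax. *)
Notation chi b := ((nat_of_bool b%R)%:R).

(** * Measurability and integrals of nonnegative functions *)

Section measurability.
Context {R : realType} d (T : measurableType d).
Implicit Types (f g : T -> R) (b : T -> bool).

Lemma measurable_boolR b :
  measurable_fun setT b -> measurable_fun setT (fun x => (b x)%:R : R).
Proof.
move=> mb; have h : measurable_fun setT (fun x : bool => x%:R : R) by [].
exact: (measurableT_comp h mb).
Qed.

Lemma measurable_maxf f g : measurable_fun setT f -> measurable_fun setT g ->
  measurable_fun setT (fun x => Num.max (f x) (g x)).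
Proof. exact: measurable_maxr. Qed.

Lemma measurable_minf f g : measurable_fun setT f -> measurable_fun setT g ->
  measurable_fun setT (fun x => Num.min (f x) (g x)).
Proof. exact: measurable_minr. Qed.

Lemma measurable_normf f : measurable_fun setT f -> measurable_fun setT (fun x => `|f x|).
Proof. by move=> mf; apply: measurableT_comp mf; exact: normr_measurable. Qed.

Lemma measurable_powRf f (q : R) : measurable_fun setT f ->
  measurable_fun setT (fun x => f x `^ q).
Proof. by move=> mf; exact: (measurableT_comp (measurable_powR q) mf). Qed.

Lemma measurable_cst2 (a : R * R) : measurable_fun setT (fun _ : T => a).
Proof. exact: measurable_cst. Qed.

Lemma measurable_id2 : measurable_fun setT (fun a : R * R => a).
Proof. exact: measurable_id. Qed.

Lemma measurable_invf f : measurable_fun setT f -> (forall x, 0 <= f x) ->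
  measurable_fun setT (fun x => (f x)^-1).
Proof.
move=> mf f0; rewrite (_ : (fun x => _) = (fun x => f x `^ (-1))).
  exact: measurable_powRf.
by apply/funext => x; rewrite powR_inv1.
Qed.

End measurability.

(** Recursion on the shape of the function. Leaves are closed by hypotheses of the context, which is
    why facts such as [measurable_ker1] are put there before a call. *)
Ltac mfun :=
  lazymatch goal with
  | |- measurable_fun _ (fun _ => (_ < _)) => apply: measurable_fun_ltr; mfun
  | |- measurable_fun _ (fun _ => (_ <= _)) => apply: measurable_fun_ler; mfun
  | |- measurable_fun _ (fun _ => (nat_of_bool _)%:R) => apply: measurable_boolR; mfun
  | |- measurable_fun _ (fun x => (_ + _)%E) => apply: emeasurable_funD; mfun
  | |- measurable_fun _ (fun x => (_ * _)%E) => apply: emeasurable_funM; mfun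
  | |- measurable_fun _ (fun x => (_ * _)) => apply: measurable_funM; mfun
  | |- measurable_fun _ (fun _ => _%:E) => apply/measurable_EFinP; mfun
  | |- measurable_fun _ (EFin \o _) => apply/measurable_EFinP; mfun
  | |- measurable_fun _ (fun x => (EFin \o _) x) => apply/measurable_EFinP; mfun
  | |- measurable_fun _ (fun x => (_ - _)) =>
     first [apply: measurable_funB; mfun | apply: measurable_subp; mfun]
  | |- measurable_fun _ (fun x => (_ + _)) =>
     first [apply: measurable_funD; mfun | apply: measurable_addp; mfun]
  | |- measurable_fun _ (fun x => (- _)) =>
     first [apply: measurable_funN; mfun | apply: measurable_oppp; mfun]
  | |- measurable_fun _ (fun x => (_ ^+ _)) => apply: measurable_funX; mfun
  | |- measurable_fun _ (fun x => Num.max _ _) => apply: measurable_maxf; mfun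
  | |- measurable_fun _ (fun x => Num.min _ _) => apply: measurable_minf; mfun
  | |- measurable_fun _ (fun x => `|_|) => apply: measurable_normf; mfun
  | |- measurable_fun _ (+%R ?a) =>
     first [exact: (measurable_addp (measurable_cst2 a) measurable_id2)
           |exact: (measurable_funD (measurable_cst a) measurable_id)]
  | |- measurable_fun _ norm2 => apply: (measurable_norm2 (f := id)); exact: measurable_id
  | |- measurable_fun _ (fun x => norm2 _) => apply: measurable_norm2; mfun
  | |- measurable_fun _ (fun x => _ `^ _) => apply: measurable_powRf; mfun
  | |- measurable_fun _ (fun x => (_, _)) => apply: measurable_fun_pair; mfun
  | |- measurable_fun _ (fun x => x) => first [exact: measurable_id2 | exact: measurable_id]
  | |- measurable_fun _ (fun x => x.1) => exact: measurable_fst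
  | |- measurable_fun _ (fun x => x.2) => exact: measurable_snd
  | |- measurable_fun _ fst => exact: measurable_fst
  | |- measurable_fun _ snd => exact: measurable_snd
  | |- measurable_fun _ (fun x => (_).1) => apply: (measurableT_comp measurable_fst); mfun
  | |- measurable_fun _ (fun x => (_).2) => apply: (measurableT_comp measurable_snd); mfun
  | H : measurable_fun setT ?u |- measurable_fun _ ?u => exact: H
  | H : measurable_fun setT ?u |- measurable_fun _ (fun x => ?u (@?g x)) =>
      apply: (measurableT_comp H (g := g)); mfun
  | |- measurable_fun _ (fun x => ?c) => try first [exact: measurable_cst2 | exact: measurable_cst]
  | _ => idtac
  end.


Section ge0_integrals.
Context {R : realType} d (T : measurableType d) (m : {measure set T -> \bar R}).
Local Open Scope ereal_scope.
Implicit Types f g h : T -> R.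

Lemma ge0_le_int f g : measurable_fun setT f -> measurable_fun setT g ->
  (forall x, 0 <= f x)%R -> (forall x, f x <= g x)%R ->
  \int[m]_x (f x)%:E <= \int[m]_x (g x)%:E.
Proof.
move=> mf mg f0 fg; apply: ge0_le_integral => //; try mfun.
- by move=> x _; rewrite lee_fin.
- by move=> x _; rewrite lee_fin.
Qed.

Lemma ge0_intD f g : measurable_fun setT f -> measurable_fun setT g ->
  (forall x, 0 <= f x)%R -> (forall x, 0 <= g x)%R ->
  \int[m]_x (f x + g x)%:E = \int[m]_x (f x)%:E + \int[m]_x (g x)%:E.
Proof.
move=> mf mg f0 g0; rewrite -ge0_integralD//; try mfun.
- by move=> x _; rewrite lee_fin.
- by move=> x _; rewrite lee_fin.
Qed.

Lemma ge0_intZ (c : R) f : measurable_fun setT f -> (0 <= c)%R -> (forall x, 0 <= f x)%R ->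
  \int[m]_x (c * f x)%:E = c%:E * \int[m]_x (f x)%:E.
Proof.
move=> mf c0 f0; rewrite -ge0_integralZl//; try mfun.
by move=> x _; rewrite lee_fin.
Qed.

Lemma int_ge0 f : (forall x, 0 <= f x)%R -> 0 <= \int[m]_x (f x)%:E.
Proof. by move=> f0; apply: integral_ge0 => x _; rewrite lee_fin. Qed.

Lemma ge0_integrable f : measurable_fun setT f -> (forall x, 0 <= f x)%R ->
  \int[m]_x (f x)%:E < +oo -> m.-integrable setT (EFin \o f).
Proof.
move=> mf f0 foo; apply/integrableP; split; first by mfun.
by under eq_integral => x _ do rewrite /= ger0_norm//.
Qed.

(* Moves the negative part of an integrable function to the other side, so that
   only integrals of nonnegative functions occur. *)
Lemma integrable_split f g h (c : R) : m.-integrable setT (EFin \o f) ->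
  \int[m]_x (f x)%:E = c%:E ->
  measurable_fun setT g -> measurable_fun setT h ->
  (forall x, 0 <= g x)%R -> (forall x, 0 <= h x)%R ->
  (forall x, h x <= f x + g x)%R ->
  \int[m]_x (h x)%:E <= c%:E + \int[m]_x (g x)%:E.
Proof.
move=> intf fc mg mh g0 h0 hfg.
have mf : measurable_fun setT f by case/integrableP : intf => /measurable_EFinP.
have [goo|] := ltP (\int[m]_x (g x)%:E) +oo; last first.
  by rewrite leye_eq => /eqP ->; rewrite addey// leey.
have intg : m.-integrable setT (EFin \o g) by exact: ge0_integrable.
rewrite -fc -integralD//=; under [leRHS]eq_integral do rewrite -EFinD.
apply: ge0_le_int => //; mfun.
Qed.

End ge0_integrals.

(** * The fractional kernel *)

Section dyadic.
Context {R : realType}.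
Local Open Scope ereal_scope.

Lemma lam_box (a b r r' : R) : (a <= b)%R -> (r <= r')%R ->
  lam (`[a, b] `*` `[r, r']) = ((b - a) * (r' - r))%:E.
Proof.
move=> ab rr; rewrite /lam [LHS]product_measure1E//.
rewrite /= !lebesgue_measure_itv/= !lte_fin EFinM; congr (_ * _).
  by case: ltP => h; [rewrite EFinB|rewrite (_ : a = b) ?subrr//; apply/eqP; rewrite eq_le ab].
by case: ltP => h; [rewrite EFinB|rewrite (_ : r = r') ?subrr//; apply/eqP; rewrite eq_le rr].
Qed.

Lemma lam_indic (B : set (R * R)) : measurable B ->
  \int[lam]_z (\1_B z)%:E = lam B.
Proof.
move=> mB; transitivity (lam (B `&` setT)); last by rewrite setIT.
exact: (integral_indic lam measurableT mB).
Qed.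

(** Replaces polar coordinates: [f] lies below the sum over [k] of [hgt k] times the indicator of
    the square of half-side [rad k], whose integrals [4 * hgt k * rad k ^+ 2] are dominated by a
    geometric series. *)
Lemma dyadic_bound (f : R * R -> R) (rad hgt : nat -> R) (A rho : R) :
  measurable_fun setT f -> (forall z, 0 <= f z)%R ->
  (forall k, 0 <= rad k)%R -> (forall k, 0 <= hgt k)%R ->
  (forall z, f z = 0%R \/ exists k, norm2 z <= rad k /\ f z <= hgt k)%R ->
  (forall k, hgt k * rad k ^+ 2 <= A * rho ^+ k)%R -> (0 <= A)%R -> (0 < rho < 1)%R ->
  \int[lam]_z (f z)%:E <= (4 * A / (1 - rho))%:E.
Proof.
move=> mf f0 rad0 hgt0 fk hA A0 /andP[rho0 rho1].
pose B k : set (R * R) := [set` `[- rad k, rad k]%R] `*` [set` `[- rad k, rad k]%R].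
have mB k : measurable (B k) by exact: measurableX.
pose g k z := (hgt k * \1_(B k) z)%:E.
have g0 k z : 0 <= g k z by rewrite lee_fin mulr_ge0.
have mg k : measurable_fun setT (g k).
  by apply/measurable_EFinP; apply: measurable_funM => //; exact: measurable_indic.
have m1 k : measurable_fun setT (fun z : R * R => (\1_(B k) z : R)%:E).
  by apply/measurable_EFinP; exact: measurable_indic.
have ig k : \int[lam]_z g k z = (hgt k * (4 * rad k ^+ 2))%:E.
  rewrite /g; under eq_integral do rewrite EFinM.
  rewrite ge0_integralZl//; [|exact: m1|by rewrite lee_fin].
  have hr : (- rad k <= rad k)%R by have := rad0 k; lra.
  rewrite lam_indic// lam_box//.
  by rewrite EFinM; congr (_ * _%:E); rewrite opprK; ring.
apply: (@le_trans _ _ (\int[lam]_z (\sum_(k <oo) g k z))).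
  apply: ge0_le_integral => //.
  - by move=> z _; rewrite lee_fin.
  - exact/measurable_EFinP.
  - by apply: (@ge0_emeasurable_sum _ _ _ setT g xpredT) => // k x _ _; exact: g0.
  - move=> z _; case: (fk z) => [->|[k [zk fz]]]; first exact: nneseries_ge0.
    rewrite (@nneseriesD1 _ _ k xpredT)// -[leLHS]adde0 leeD//; last exact: nneseries_ge0.
    rewrite lee_fin indicE mem_set ?mulr1//; split; rewrite /= in_itv/= -ler_norml.
      exact: le_trans (le_norm2_fst _) zk.
    exact: le_trans (le_norm2_snd _) zk.
rewrite integral_nneseries//; under eq_eseriesr do rewrite ig.
apply: lime_le; first by apply: is_cvg_nneseries => k _ _; rewrite lee_fin !mulr_ge0// sqr_ge0.
near=> n; rewrite sumEFin lee_fin.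
apply: (@le_trans _ _ (\sum_(0 <= k < n) 4 * A * rho ^+ k)%R).
  apply: ler_sum => k _; have := hA k; lra.
apply: geometric_le_lim => //; first by rewrite mulr_ge0.
by rewrite gtr0_norm.
Unshelve. all: by end_near.
Qed.

End dyadic.

Section kernel.
Context {R : realType} (s : R) (s01 : 0 < s < 1).

(** The conventions for powers and inverses at [0] give [ker 0 = 0], so the diagonal drops out of
    the pointwise inequalities below. *)
Definition ker (z : R * R) : R := (norm2 z `^ (2 + s))^-1.

Let s0 : 0 < s. Proof. by case/andP : s01. Qed.
Let s1 : s < 1. Proof. by case/andP : s01. Qed.

Lemma ker_ge0 z : 0 <= ker z. Proof. by rewrite invr_ge0 powR_ge0. Qed.

Lemma kerN z : ker (- z) = ker z. Proof. by rewrite /ker norm2N. Qed.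

Lemma ker0 : ker 0 = 0.
Proof. by rewrite /ker norm2_0 powR0 ?invr0// gt_eqF// addr_gt0. Qed.

Lemma measurable_ker d (T : measurableType d) (f : T -> R * R) :
  measurable_fun setT f -> measurable_fun setT (fun x => ker (f x)).
Proof.
move=> mf; apply: measurable_invf => [|x]; last exact: powR_ge0.
by mfun.
Qed.

Lemma measurable_ker1 : measurable_fun setT ker.
Proof. by apply: measurable_ker; exact: measurable_id. Qed.

Lemma powR_expR (a x : R) : 0 < a -> a `^ x = expR (x * ln a).
Proof. by move=> a0; rewrite /powR gt_eqF. Qed.

Lemma lnXR (x : R) n : 0 < x -> ln (x ^+ n) = n%:R * ln x.
Proof. by move=> x0; rewrite lnXn// mulr_natl. Qed.

Lemma ker_le z (r : R) : 0 < r -> r <= norm2 z -> ker z <= r `^ (- (2 + s)).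
Proof.
move=> r0 rz; rewrite powRN lef_pV2 ?posrE ?powR_gt0//; last exact: lt_le_trans rz.
by rewrite ge0_ler_powR// ?nnegrE ?norm2_ge0 ?(ltW r0)// addr_ge0// ltW.
Qed.

Lemma ker_ge z (r : R) : z != 0 -> norm2 z <= r -> r `^ (- (2 + s)) <= ker z.
Proof.
move=> z0 zr; have nz : 0 < norm2 z by rewrite norm2_gt0.
rewrite powRN lef_pV2 ?posrE ?powR_gt0//; last exact: lt_le_trans zr.
by rewrite ge0_ler_powR// ?nnegrE ?norm2_ge0 ?(le_trans _ zr) ?norm2_ge0// addr_ge0// ltW.
Qed.

Lemma norm2_ker z : z != 0 -> norm2 z * ker z = norm2 z `^ (- (1 + s)).
Proof.
move=> z0; have nz : 0 < norm2 z by rewrite norm2_gt0.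
rewrite /ker -powRN -{1}(powRr1 (ltW nz)) -powRD ?(gt_eqF nz) ?implybT//.
by congr (_ `^ _); ring.
Qed.

(** Constants of [ker_near], [ker_far] and [ker_low]. Near the origin, annulus [k] has outer radius
    [2^-1 ^+ k * r] and half of it as inner radius, where [norm2 z * ker z] is largest: hence the
    factor 2 to the power [1 + s] and the ratio 2 to the power [s - 1]. At infinity the outer radius
    is twice the inner one, hence [16 = 4 * 2 ^+ 2]. The lower bound keeps a single square of area
    [r ^+ 2], on which the norm lies between [r] and [3 * r]. *)
Definition near_cst : R := 4 * (2 `^ (1 + s)) / (1 - 2 `^ (s - 1)).
Definition far_cst : R := 16 / (1 - 2 `^ (- s)).
Definition low_cst : R := 3 `^ (- (2 + s)).

Let two_lt1 x : x < 0 -> 0 < (2 : R) `^ x < 1.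
Proof.
move=> x0; rewrite powR_gt0//= powR_expR// -[ltRHS]expR0 ltr_expR pmulr_llt0// ln_gt0//; lra.
Qed.

Lemma near_cst_gt0 : 0 < near_cst.
Proof.
have /andP[_ h] := @two_lt1 (s - 1) ltac:(have := s1; lra).
by rewrite divr_gt0 ?mulr_gt0 ?powR_gt0// subr_gt0.
Qed.

Lemma far_cst_gt0 : 0 < far_cst.
Proof.
have /andP[_ h] := @two_lt1 (- s) ltac:(have := s0; lra).
by rewrite divr_gt0// subr_gt0.
Qed.

Lemma low_cst_gt0 : 0 < low_cst. Proof. exact: powR_gt0. Qed.

Lemma dyadic_below (a r : R) : 0 < a -> a < r ->
  exists k, 2^-1 ^+ k.+1 * r <= a /\ a <= 2^-1 ^+ k * r.
Proof.
move=> a0 ar; have r0 : 0 < r by exact: lt_trans ar.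
have ex : exists k, 2^-1 ^+ k * r <= a.
  have [k hk] : exists k, 2^-1 ^+ k < a / r.
    have := cvg_expr (z := 2^-1 : R) ltac:(by rewrite gtr0_norm; lra).
    move=> /cvgrPdist_lt /(_ (a / r) ltac:(by rewrite divr_gt0))[k _ /(_ k (leqnn k))] /= h.
    by exists k; move: h; rewrite sub0r normrN ger0_norm.
  by exists k; rewrite -ler_pdivlMr// ltW.
case: (ex_minnP ex) => -[|k] kP kmin.
  by move: kP; rewrite expr0 mul1r leNgt ar.
exists k; split=> //; rewrite leNgt; apply/negP => h.
by have := kmin k (ltW h); rewrite ltnn.
Qed.

Lemma dyadic_above (a r : R) : 0 < r -> r <= a ->
  exists k, 2 ^+ k * r <= a /\ a <= 2 ^+ k.+1 * r.
Proof.
move=> r0 ra; have ex : exists k, a <= 2 ^+ k.+1 * r.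
  have [k hk] : exists k, 2^-1 ^+ k < r / a.
    have := cvg_expr (z := 2^-1 : R) ltac:(by rewrite gtr0_norm; lra).
    move=> /cvgrPdist_lt /(_ (r / a) ltac:(by rewrite divr_gt0// (lt_le_trans r0)))
      [k _ /(_ k (leqnn k))] /= h.
    by exists k; move: h; rewrite sub0r normrN ger0_norm.
  exists k; rewrite exprVn ltr_pdivlMr ?(lt_le_trans r0)// in hk.
  rewrite mulrC ltr_pdivrMr// in hk; rewrite exprS.
  have : 0 < 2 ^+ k :> R by [].
  by nra.
case: (ex_minnP ex) => -[|k] kP kmin.
  by exists 0%N; rewrite expr0 mul1r.
exists k.+1; split=> //; rewrite leNgt; apply/negP => h.
by have := kmin k (ltW h); rewrite ltnn.
Qed.

Lemma ker_near r : 0 < r ->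
  (\int[lam]_z (chi (norm2 z < r) * (norm2 z * ker z))%:E
     <= (near_cst * r `^ (1 - s))%:E)%E.
Proof.
move=> r0.
rewrite (_ : near_cst * _ = 4 * (2 `^ (1 + s) * r `^ (1 - s)) / (1 - 2 `^ (s - 1))); last first.
  by rewrite /near_cst; ring.
apply: (@dyadic_bound _ _ (fun k => 2^-1 ^+ k * r)
   (fun k => (2^-1 ^+ k.+1 * r) `^ (- (1 + s)))).
- by have mk := measurable_ker1; mfun.
- by move=> z; rewrite !mulr_ge0// ?norm2_ge0 ?ker_ge0.
- by move=> k; rewrite mulr_ge0// ltW.
- by move=> k; exact: powR_ge0.
- move=> z; have [->|z0] := eqVneq z 0; first by left; rewrite ker0 !mulr0.
  have [zr|_] := ltP; last by left; rewrite mul0r.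
  have nz : 0 < norm2 z by rewrite norm2_gt0.
  have [k [k1 k2]] := dyadic_below nz zr; right; exists k; split=> //.
  rewrite mul1r norm2_ker// !powRN lef_pV2 ?posrE ?powR_gt0//; last by rewrite mulr_gt0.
  by rewrite ge0_ler_powR// ?nnegrE ?norm2_ge0// ?addr_ge0 ?mulr_ge0// ltW.
- move=> k.
  have h0 n : 0 < 2^-1 ^+ n * r by rewrite mulr_gt0.
  rewrite le_eqVlt; apply/orP; left; apply/eqP; apply: ln_inj;
    rewrite ?posrE ?mulr_gt0 ?exprn_gt0 ?powR_gt0//.
  rewrite !(lnM, ln_powR, lnXR) ?posrE ?mulr_gt0 ?exprn_gt0 ?powR_gt0// lnV ?posrE//.
  by rewrite -natr1; ring.
- by rewrite mulr_ge0// powR_ge0.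
- by apply: two_lt1; have := s1; lra.
Qed.

Lemma ker_far r : 0 < r ->
  (\int[lam]_z (chi (r <= norm2 z) * ker z)%:E <= (far_cst * r `^ (- s))%:E)%E.
Proof.
move=> r0.
rewrite (_ : far_cst * _ = 4 * (4 * r `^ (- s)) / (1 - 2 `^ (- s))); last first.
  by rewrite /far_cst; field; have /andP[_ h] := @two_lt1 (- s) ltac:(have := s0; lra); lra.
apply: (@dyadic_bound _ _ (fun k => 2 ^+ k.+1 * r) (fun k => (2 ^+ k * r) `^ (- (2 + s)))).
- by have mk := measurable_ker1; mfun.
- by move=> z; rewrite !mulr_ge0// ker_ge0.
- by move=> k; rewrite mulr_ge0// ltW.
- by move=> k; exact: powR_ge0.
- move=> z; have [rz|_] := leP r; last by left; rewrite mul0r.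
  have [k [k1 k2]] := dyadic_above r0 rz; right; exists k; split=> //.
  by rewrite mul1r ker_le// mulr_gt0.
- move=> k.
  have h0 n : 0 < 2 ^+ n * r by rewrite mulr_gt0.
  rewrite (_ : (2 ^+ k.+1 * r) ^+ 2 = 4 * (2 ^+ k * r) ^+ 2); last by rewrite [2 ^+ k.+1]exprS; ring.
  rewrite mulrCA -[leRHS]mulrA ler_pM2l//.
  rewrite le_eqVlt; apply/orP; left; apply/eqP; apply: ln_inj;
    rewrite ?posrE ?mulr_gt0 ?exprn_gt0 ?powR_gt0//.
  rewrite !(lnM, ln_powR, lnXR) ?posrE ?mulr_gt0 ?exprn_gt0 ?powR_gt0//.
  by ring.
- by rewrite mulr_ge0// powR_ge0.
- by apply: two_lt1; have := s0; lra.
Qed.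

Lemma ker_low r : 0 < r ->
  ((low_cst * r `^ (- s))%:E <= \int[lam]_z (chi (r <= norm2 z) * ker z)%:E)%E.
Proof.
move=> r0.
pose B : set (R * R) := [set` `[r, 2 * r]] `*` [set` `[0, r]].
have mB : measurable B by exact: measurableX.
have mk := measurable_ker1.
have mI : measurable_fun setT (fun z : R * R => \1_B z : R) by exact: measurable_indic.
apply: (@le_trans _ _ (\int[lam]_z ((3 * r) `^ (- (2 + s)) * \1_B z)%:E)%E).
  rewrite ge0_intZ ?powR_ge0// lam_indic// lam_box; [|lra|lra].
  rewrite -EFinM lee_fin subr0 (_ : (2 * r - r) * r = r ^+ 2); last by ring.
  rewrite -!powR_mulrn ?powR_ge0 ?(ltW r0)// powRM ?(ltW r0)// -mulrA /low_cst.
  rewrite ler_pM2l ?powR_gt0// -powRD ?(gt_eqF r0) ?implybT//.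
  by rewrite le_eqVlt; apply/orP; left; apply/eqP; congr (_ `^ _); ring.
apply: ge0_le_int => //; try mfun.
  by move=> z; rewrite mulr_ge0// powR_ge0.
move=> z; rewrite indicE; case: (boolP (z \in B)) => [|_]; last first.
  by rewrite mulr0 mulr_ge0// ker_ge0.
rewrite inE => -[/=]; rewrite !in_itv/= => /andP[z1 z1'] /andP[z2 z2'].
have rz : r <= norm2 z.
  by rewrite (le_trans z1)// (le_trans (ler_norm _))// le_norm2_fst.
rewrite rz mulr1 mul1r; apply: ker_ge.
  by rewrite -norm2_gt0 (lt_le_trans r0).
rewrite (le_trans (norm2_le _))// !ger0_norm//; first lra.
exact: le_trans (ltW r0) z1.
Qed.

End kernel.

Section cont2_extra.
Context {R : realType}.
Implicit Types (f g : R * R -> R) (x y : R * R).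

Lemma cont2_lip (L : R) f x : (forall y, `|f y - f x| <= L * norm2 (y - x)) -> cont2 f x.
Proof.
move=> lf e e0; exists (e / (`|L| + 1)); first by rewrite divr_gt0// ltr_wpDl.
move=> y; rewrite ltr_pdivlMr ?ltr_wpDl// => h; apply: le_lt_trans (lf y) _.
apply: le_lt_trans h; rewrite mulrC ler_wpM2l ?norm2_ge0//.
by rewrite (le_trans (ler_norm L))// lerDl.
Qed.

Lemma cont2_norm2 c x : cont2 (fun y => norm2 (y - c)) x.
Proof.
apply: (@cont2_lip 1) => y; rewrite mul1r ler_norml; apply/andP; split.
  by have := norm2_dist x y c; rewrite (norm2BC x y); lra.
by have := norm2_dist y x c; lra.
Qed.

Lemma cont2_cst (c : R) x : cont2 (fun=> c) x.
Proof. by apply/cont2P; exact: cvg_cst. Qed.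

Lemma cont2D f g x : cont2 f x -> cont2 g x -> cont2 (fun y => f y + g y) x.
Proof. by move=> /cont2P cf /cont2P cg; apply/cont2P; exact: (cvgD cf cg). Qed.

Lemma cont2N f x : cont2 f x -> cont2 (fun y => - f y) x.
Proof. by move=> /cont2P cf; apply/cont2P; exact: (cvgN cf). Qed.

Lemma cont2B f g x : cont2 f x -> cont2 g x -> cont2 (fun y => f y - g y) x.
Proof. by move=> cf cg; apply: cont2D => //; exact: cont2N. Qed.

Lemma cont2M f g x : cont2 f x -> cont2 g x -> cont2 (fun y => f y * g y) x.
Proof. by move=> /cont2P cf /cont2P cg; apply/cont2P; exact: (cvgM cf cg). Qed.

Lemma cont2X f n x : cont2 f x -> cont2 (fun y => f y ^+ n) x.
Proof.
move=> cf; elim: n => [|n ih].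
  by under eq_fun do rewrite expr0; exact: cont2_cst.
by under eq_fun do rewrite exprS; exact: cont2M.
Qed.

Lemma cont2_max0 f x : cont2 f x -> cont2 (fun y => Num.max (f y) 0) x.
Proof.
move=> cf e /cf[d d0 h]; exists d => // y /h; apply: le_lt_trans.
by rewrite /Num.max; case: ltP => h1; case: ltP => h2;
  rewrite ler_norml; apply/andP; split; rewrite ?subr0 ?sub0r ?subrr ?oppr0;
  have := ler_norm (f y - f x); have := ler_norm (f x - f y); rewrite (distrC (f x)); lra.
Qed.

Lemma closed_ball2_compact x (d : R) : compact [set y | norm2 (y - x) <= d].
Proof.
apply: (@subclosed_compact _ _ ([set` `[x.1 - d, x.1 + d]] `*` [set` `[x.2 - d, x.2 + d]])).
- have cn : continuous (fun y => norm2 (y - x)).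
    by move=> y; apply/cont2P; exact: cont2_norm2.
  have -> : [set y | norm2 (y - x) <= d] = (fun y => norm2 (y - x)) @^-1` [set r | r <= d] by [].
  by apply: closed_comp => [y _|]; [exact: cn|exact: closed_le].
- by apply: compact_setX; exact: segment_compact.
- move=> y /= h; split; rewrite /= in_itv/=.
    by have := le_trans (le_norm2_fst _) h; rewrite /= ler_distl.
  by have := le_trans (le_norm2_snd _) h; rewrite /= ler_distl.
Qed.

Lemma cont2_attains_max f x (d : R) : 0 <= d ->
  (forall y, norm2 (y - x) <= d -> cont2 f y) ->
  exists2 y0, norm2 (y0 - x) <= d & forall y, norm2 (y - x) <= d -> f y <= f y0.
Proof.
move=> d0 cf; pose A := [set y | norm2 (y - x) <= d].
have A0 : A !=set0 by exists x; rewrite /A /= subrr norm2_0.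
have [|y0 Ay0 h] := compact_EVT_max (f := f) A0 (@closed_ball2_compact x d).
  apply: continuous_in_subspaceT => y; rewrite inE => Ay.
  by apply/cont2P; exact: cf.
exists y0; first by move: Ay0; rewrite inE.
by move=> y Ay; apply: h; rewrite inE.
Qed.

End cont2_extra.

(** * Regularity of solutions *)

Section local_max.
Context {R : realType} (s : R) (s01 : 0 < s < 1).
Let s0 : 0 < s. Proof. by case/andP : s01. Qed.
Let s1 : s < 1. Proof. by case/andP : s01. Qed.
Notation ker := (ker s).

(* [int (v y - v (y + z)) ker z dz <= B], without assuming integrability. *)
Definition subsol (v : R * R -> R) (y : R * R) (B : R) :=
  forall g h : R * R -> R, measurable_fun setT g -> measurable_fun setT h ->
  (forall z, 0 <= g z) -> (forall z, 0 <= h z) ->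
  (forall z, h z <= (v y - v (y + z)) * ker z + g z) ->
  (\int[lam]_z (h z)%:E <= B%:E + \int[lam]_z (g z)%:E)%E.

(** At the maximum point the part of the integral over the ball of radius [lrad * rho] must cost at
    most half of what the rest yields. The slope there is [14 * M / rho], so up to common factors
    the cost is [14 * near_cst s * lrad], to be compared with [low_cst s / 2]: this is the second
    entry. The first keeps [norm2 z / rho] below [2^-1] for [cube_bound]. *)
Definition lrad : R := Num.min 2^-1 (low_cst s / (28 * near_cst s)).

Lemma lrad_gt0 : 0 < lrad.
Proof.
have n0 := near_cst_gt0 s01; have l0 := low_cst_gt0 s.
rewrite lt_min; apply/andP; split; first lra.
by rewrite divr_gt0// mulr_gt0.
Qed.

Lemma lrad_le : lrad <= 2^-1. Proof. by rewrite ge_min lexx. Qed.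

Lemma lrad_near : 14 * near_cst s * lrad <= low_cst s / 2.
Proof.
have n0 := near_cst_gt0 s01.
apply: (@le_trans _ _ (14 * near_cst s * (low_cst s / (28 * near_cst s)))).
  have l2 : lrad <= low_cst s / (28 * near_cst s) by rewrite /lrad ge_min lexx orbT.
  by rewrite ler_wpM2l// mulr_ge0// ltW.
by rewrite le_eqVlt; apply/orP; left; apply/eqP; field; rewrite gt_eqF.
Qed.

(** Turns a bound by the inverse cube of [1 - t] into an affine one; [14] gives equality at
    [t = 2^-1]. *)
Let cube_bound (t : R) : 0 <= t <= 2^-1 -> 1 <= (1 + 14 * t) * (1 - t) ^+ 3.
Proof.
move=> /andP[t0 t1]; rewrite -subr_ge0.
rewrite (_ : _ - _ = t * ((1 - 2 * t) * (11 - 17 * t + 7 * t ^+ 2))); last by ring.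
by rewrite !mulr_ge0//; first lra; nra.
Qed.

Variables (v : R * R -> R) (x : R * R) (d a A T : R).
Hypotheses (d0 : 0 < d) (mv : measurable_fun setT v)
  (v0 : forall y, 0 <= v y) (cv : forall y, norm2 (y - x) <= d -> cont2 v y)
  (hT : (\int[lam]_y (v y * (d + norm2 (y - x)) `^ (- (2 + s)))%:E <= T%:E)%E)
  (hsub : forall y, norm2 (y - x) < d -> 0 < v y -> subsol v y (A - a * v y)).

(* Evaluate the inequality at a maximum point of [v y * (d - norm2 (y - x)) ^+ 3]. *)
Lemma local_max_pt : 0 < v x -> exists M rho, [/\ 0 < rho <= d, 0 < M,
  v x * d ^+ 3 <= M * rho ^+ 3 &
  M * (low_cst s / 2 * (lrad * rho) `^ (- s) + a)
    <= A + (3 * d / (lrad * rho)) `^ (2 + s) * T].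
Proof.
move=> vx0.
have [y0 y0d y0max] : exists2 y0, norm2 (y0 - x) <= d &
    forall y, norm2 (y - x) <= d ->
      v y * (d - norm2 (y - x)) ^+ 3 <= v y0 * (d - norm2 (y0 - x)) ^+ 3.
  apply: (@cont2_attains_max _ (fun y => v y * (d - norm2 (y - x)) ^+ 3)); first exact: ltW.
  move=> y yd; apply: cont2M; first exact: cv.
  by apply: cont2X; apply: cont2B; [exact: cont2_cst|exact: cont2_norm2].
set M := v y0 in y0max; set rho := d - norm2 (y0 - x) in y0max.
have hx : v x * d ^+ 3 <= M * rho ^+ 3.
  by have := y0max x; rewrite subrr norm2_0 subr0; apply; exact: ltW.
have Mrho : 0 < M * rho ^+ 3 by apply: lt_le_trans hx; rewrite mulr_gt0// exprn_gt0.
have rhod : rho <= d by rewrite /rho lerBlDr lerDl norm2_ge0.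
have rho_ge0 : 0 <= rho by rewrite /rho subr_ge0.
have rho0 : 0 < rho.
  rewrite lt_neqAle rho_ge0 andbT eq_sym; apply: contraTneq Mrho => ->.
  by rewrite expr0n mulr0 ltxx.
have M0 : 0 < M by move: Mrho; rewrite pmulr_lgt0// exprn_gt0.
exists M, rho; split => //; first by rewrite rho0.
set q := lrad * rho; have q0 : 0 < q by rewrite mulr_gt0// lrad_gt0.
have q2 : q <= rho / 2 by rewrite /q mulrC ler_wpM2l// lrad_le.
have y0d' : norm2 (y0 - x) < d by rewrite -subr_gt0.
have mk := measurable_ker1 s.
(* A shift by [z] lowers the weight by at most [norm2 z], so maximality bounds [v (y0 + z)] by [M]
   times the cube of [rho / (rho - norm2 z)], which [cube_bound] makes affine in [norm2 z]. *)
have near_y0 z : norm2 z < q -> v (y0 + z) <= M + 14 * M / rho * norm2 z.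
  move=> zq; have hz : norm2 (y0 + z - x) <= norm2 (y0 - x) + norm2 z.
    by rewrite addrAC le_norm2D.
  have hd : rho - norm2 z <= d - norm2 (y0 + z - x) by rewrite /rho; lra.
  have rz : 0 < rho - norm2 z by lra.
  have := y0max (y0 + z) ltac:(by rewrite /rho in hd rz *; lra) => h1.
  have h2 : v (y0 + z) * (rho - norm2 z) ^+ 3 <= M * rho ^+ 3.
    apply: le_trans h1; rewrite ler_wpM2l// lerXn2r// nnegrE ltW//.
    exact: lt_le_trans hd.
  have := @cube_bound (norm2 z / rho) ltac:(rewrite divr_ge0 ?norm2_ge0//= ler_pdivrMr//; lra) => h3.
  rewrite -(@ler_pM2r _ ((rho - norm2 z) ^+ 3)) ?exprn_gt0//.
  apply: le_trans h2 _.
  rewrite [leRHS](_ : _ = M * rho ^+ 3 * ((1 + 14 * (norm2 z / rho)) * (1 - norm2 z / rho) ^+ 3)).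
    by rewrite ler_peMr// ltW.
  by field; rewrite gt_eqF.
have c0 : 0 <= 14 * M / rho by rewrite divr_ge0 ?mulr_ge0 ?ltW.
have k0 := ker_ge0 s.
have g10 z : 0 <= chi (norm2 z < q) * (norm2 z * ker z) :> R by rewrite !mulr_ge0 ?norm2_ge0.
have g20 z : 0 <= chi (q <= norm2 z) * (v (y0 + z) * ker z) by rewrite !mulr_ge0.
have mg1 : measurable_fun setT (fun z => chi (norm2 z < q) * (norm2 z * ker z) : R) by mfun.
have mg2 : measurable_fun setT (fun z => chi (q <= norm2 z) * (v (y0 + z) * ker z)) by mfun.
have mh1 : measurable_fun setT (fun z => chi (q <= norm2 z) * ker z : R) by mfun.
(* The test pair: the left side keeps [M * ker z] for [norm2 z >= q]; the far values of [v] and its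
   possible growth near [y0] are moved to the right side. *)
have h : (\int[lam]_z (M * (chi (q <= norm2 z) * ker z))%:E <= (A - a * M)%:E +
    \int[lam]_z (14 * M / rho * (chi (norm2 z < q) * (norm2 z * ker z)) +
    chi (q <= norm2 z) * (v (y0 + z) * ker z))%:E)%E.
  apply: (hsub y0d' M0); [by mfun|by mfun|..].
  - by move=> z; rewrite addr_ge0// mulr_ge0.
  - by move=> z; rewrite !mulr_ge0// ltW.
  move=> z; rewrite -/M; have [qz|zq] := leP q (norm2 z).
    by rewrite mul0r mulr0 add0r !mul1r mulrBl subrK.
  rewrite !mul0r mulr0 mul1r addr0 mulrA -mulrDl mulr_ge0//.
  by have := near_y0 z zq; lra.
rewrite ge0_intZ ?(ltW M0) // in h; last by move=> z; rewrite mulr_ge0.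
rewrite ge0_intD // in h; [|by mfun|by move=> z; rewrite mulr_ge0].
rewrite ge0_intZ// in h.
have h1 := ker_low s01 q0; have h2 := ker_near s01 q0.
have h3 : (\int[lam]_z (chi (q <= norm2 z)%R * (v (y0 + z) * ker z))%:E <=
    ((3 * d / q) `^ (2 + s) * T)%:E)%E.
  have mD : measurable_fun setT (fun y : R * R => v y * (d + norm2 (y - x)) `^ (- (2 + s))) by mfun.
  have D0 (y : R * R) : 0 <= v y * (d + norm2 (y - x)) `^ (- (2 + s)).
    by rewrite mulr_ge0// powR_ge0.
  (* For [norm2 z >= q] the kernel centred at [y0] is comparable with the weight centred at [x]: as
     [norm2 (y0 - x) <= d] and [q <= d], the sum [d + norm2 (z + y0 - x)] is at most
     [3 * d / q * norm2 z]. *)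
  apply: (@le_trans _ _ (\int[lam]_z ((3 * d / q) `^ (2 + s) *
      (v (z + y0) * (d + norm2 (z + y0 - x)) `^ (- (2 + s))))%:E)%E).
    apply: ge0_le_int => //; try mfun.
    move=> z; rewrite (addrC y0); have [qz|zq] := leP q (norm2 z); last first.
      by rewrite mul0r mulr_ge0 ?powR_ge0.
    rewrite mul1r mulrCA ler_wpM2l//.
    have nz : 0 < norm2 z by exact: lt_le_trans qz.
    have hd : 0 < d + norm2 (z + y0 - x) by rewrite ltr_wpDr ?norm2_ge0.
    have hz : norm2 (z + y0 - x) <= norm2 z + norm2 (y0 - x) by rewrite -addrA le_norm2D.
    have h3d : d + norm2 (z + y0 - x) <= 3 * d / q * norm2 z.
      rewrite mulrAC ler_pdivlMr//.
      have : q <= d by lra.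
      by nra.
    have p0 : 0 <= 2 + s by rewrite addr_ge0// ltW.
    have q30 : 0 <= 3 * d / q by apply: divr_ge0; [apply: mulr_ge0; [lra|exact: ltW]|exact: ltW].
    have hp : (d + norm2 (z + y0 - x)) `^ (2 + s) <= (3 * d / q) `^ (2 + s) * norm2 z `^ (2 + s).
      rewrite -powRM ?norm2_ge0// ge0_ler_powR// nnegrE; first exact: ltW.
      by rewrite mulr_ge0// norm2_ge0.
    by rewrite powRN ler_pdivlMr ?powR_gt0// mulrC ler_pdivrMr ?powR_gt0.
  have mDs : measurable_fun setT (fun z : R * R => v (z + y0) * (d + norm2 (z + y0 - x)) `^ (- (2 + s))) by mfun.
  have /= -> := ge0_intZ lam mDs (powR_ge0 (3 * d / q) (2 + s)) (fun z => D0 (z + y0)).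
  have mDE : measurable_fun setT (fun z : R * R => (v z * (d + norm2 (z - x)) `^ (- (2 + s)))%:E) by mfun.
  have := lam_shift y0 mDE (fun z => D0 z) => /= ->.
  by rewrite EFinM lee_wpmul2l// lee_fin powR_ge0.
have h4 : (M%:E * (low_cst s * q `^ (- s))%:E <= (A - a * M)%:E +
   ((14 * M / rho)%:E * (near_cst s * q `^ (1 - s))%:E + ((3 * d / q) `^ (2 + s) * T)%:E))%E.
  apply: (@le_trans _ _ (M%:E * \int[lam]_z (chi (q <= norm2 z)%R * ker z)%:E)%E).
    by rewrite lee_wpmul2l// lee_fin ltW.
  apply: (le_trans h); rewrite leeD2l// leeD// lee_wpmul2l// lee_fin.
rewrite -!EFinM -!EFinD lee_fin in h4.
have qs : q `^ (1 - s) = q * q `^ (- s).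
  by rewrite powRD ?powRr1 ?(ltW q0)// (gt_eqF q0) implybT.
rewrite qs in h4.
have qs0 : 0 <= q `^ (- s) by exact: powR_ge0.
have : 14 * M / rho * (near_cst s * (q * q `^ (- s))) <= M * (low_cst s / 2 * q `^ (- s)).
  rewrite (_ : 14 * M / rho * _ = M * (14 * near_cst s * lrad) * q `^ (- s)).
    by rewrite -mulrA ler_pM2l// ler_wpM2r// lrad_near.
  by rewrite /q; field; rewrite gt_eqF.
by lra.
Qed.

End local_max.

Section local_max_corollaries.
Context {R : realType} (s : R) (s01 : 0 < s < 1).
Let s0 : 0 < s. Proof. by case/andP : s01. Qed.
Let s1 : s < 1. Proof. by case/andP : s01. Qed.

Definition lmax_cst : R := 2 / low_cst s * (1 + 3 `^ (2 + s) / lrad s ^+ 2).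

Lemma lmax_cst_ge0 : 0 <= lmax_cst.
Proof.
apply: mulr_ge0; first by rewrite divr_ge0// ltW// low_cst_gt0.
by rewrite addr_ge0// divr_ge0 ?powR_ge0// sqr_ge0.
Qed.

(** Takes no zero-order term and multiplies the estimate of [local_max_pt] by [q] to the power [s].
    What is left of the tail factor is the inverse of [q ^+ 2], which the weight [rho ^+ 3] absorbs
    because [q] is a fixed fraction of [rho]. *)
Lemma local_max_ub (v : R * R -> R) (x : R * R) (d A T : R) :
  0 < d -> 0 <= A -> measurable_fun setT v -> (forall y, 0 <= v y) ->
  (forall y, norm2 (y - x) <= d -> cont2 v y) ->
  (\int[lam]_y (v y * (d + norm2 (y - x)) `^ (- (2 + s)))%:E <= T%:E)%E ->
  (forall y, norm2 (y - x) < d -> 0 < v y -> subsol s v y A) ->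
  v x <= lmax_cst * d `^ s * (A + T).
Proof.
move=> d0 A0 mv v0 cv hT hsub.
have T0 : 0 <= T.
  rewrite -lee_fin; apply: le_trans hT; apply: int_ge0 => y.
  by rewrite mulr_ge0// powR_ge0.
have := v0 x; rewrite le_eqVlt => /orP[/eqP <-|vx0].
  by rewrite mulr_ge0 ?addr_ge0// mulr_ge0 ?powR_ge0// lmax_cst_ge0.
have [|M [rho [/andP[rho0 rhod] M0 hx hM]]] :=
  @local_max_pt _ s s01 v x d 0 A T d0 mv v0 cv hT _ vx0.
  by move=> y yd vy; rewrite mul0r subr0; exact: hsub.
have r0 := lrad_gt0 s01; have l0 := low_cst_gt0 s; have r2 := lrad_le s.
set q := lrad s * rho in hM; have q0 : 0 < q by rewrite mulr_gt0.
have qd : q <= d by rewrite /q; nra.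
have qs : q `^ s <= d `^ s by rewrite ge0_ler_powR ?nnegrE ?(ltW s0) ?(ltW q0) ?(ltW d0).
have d3 : 0 < d ^+ 3 by rewrite exprn_gt0.
rewrite -(ler_pM2r d3); apply: (le_trans hx).
have qss : q `^ s * q `^ (- s) = 1 by rewrite powRN mulfV// gt_eqF// powR_gt0.
have e1 : (3 * d / q) `^ (2 + s) = 3 `^ (2 + s) * d ^+ 2 * d `^ s / (q ^+ 2 * q `^ s).
  apply: ln_inj; rewrite ?posrE ?(powR_gt0, mulr_gt0, invr_gt0, exprn_gt0)//.
  rewrite !(lnM, ln_powR, lnXR, lnV) ?posrE ?(powR_gt0, mulr_gt0, invr_gt0, exprn_gt0)//.
  by ring.
have h1 : M * (low_cst s / 2) <= A * q `^ s + 3 `^ (2 + s) * d ^+ 2 * d `^ s / q ^+ 2 * T.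
  have := ler_wpM2l (powR_ge0 q s) hM.
  rewrite addr0 (_ : q `^ s * _ = M * (low_cst s / 2) * (q `^ s * q `^ (- s))); last by ring.
  rewrite qss mulr1 => /le_trans; apply; rewrite e1 le_eqVlt; apply/orP; left; apply/eqP.
  by field; rewrite !gt_eqF// powR_gt0.
have ds : 0 <= d `^ s by exact: powR_ge0.
have h2 : M * (low_cst s / 2) * rho ^+ 3 <= d ^+ 3 * d `^ s * (A + 3 `^ (2 + s) / lrad s ^+ 2 * T).
  have rho3 : rho ^+ 3 <= d ^+ 3 by rewrite lerXn2r ?nnegrE// ltW.
  apply: le_trans (ler_wpM2r (exprn_ge0 3 (ltW rho0)) h1) _.
  rewrite mulrDl mulrDr lerD//.
    have hh : q `^ s * rho ^+ 3 <= d `^ s * d ^+ 3.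
      by rewrite ler_pM ?powR_ge0// exprn_ge0// ltW.
    by have := ler_wpM2l A0 hh; lra.
  rewrite (_ : _ * rho ^+ 3 = 3 `^ (2 + s) / lrad s ^+ 2 * T * (d ^+ 2 * d `^ s) * rho); last first.
    by rewrite /q; field; rewrite !gt_eqF.
  rewrite (_ : d ^+ 3 * d `^ s * _ = 3 `^ (2 + s) / lrad s ^+ 2 * T * (d ^+ 2 * d `^ s) * d); last by ring.
  rewrite ler_wpM2l// mulr_ge0//; last by rewrite mulr_ge0// sqr_ge0.
  by rewrite mulr_ge0// divr_ge0 ?powR_ge0// sqr_ge0.
have h3 : M * rho ^+ 3 <= 2 / low_cst s * (d ^+ 3 * d `^ s * (A + 3 `^ (2 + s) / lrad s ^+ 2 * T)).
  rewrite (_ : M * _ = 2 / low_cst s * (M * (low_cst s / 2) * rho ^+ 3)); last first.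
    by field; rewrite gt_eqF.
  by rewrite ler_wpM2l// divr_ge0// ltW.
apply: (le_trans h3); rewrite /lmax_cst.
set k := 3 `^ (2 + s) / lrad s ^+ 2.
have k0 : 0 <= k by rewrite divr_ge0 ?powR_ge0// sqr_ge0.
rewrite (_ : _ * d ^+ 3 = 2 / low_cst s * (d ^+ 3 * d `^ s * ((1 + k) * (A + T)))); last by ring.
rewrite ler_wpM2l ?divr_ge0// ?(ltW l0)// ler_wpM2l//.
  by rewrite mulr_ge0// ltW.
by nra.
Qed.

(** Keeps the zero-order term and discards the kernel term instead. The constant does not depend on
    [d], so the radius can be sent to infinity to make the tail [T] small. *)
Lemma local_max_absorb (v : R * R -> R) (x : R * R) (d a T : R) :
  0 < d -> 0 <= a -> measurable_fun setT v -> (forall y, 0 <= v y) ->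
  (forall y, norm2 (y - x) <= d -> cont2 v y) ->
  (\int[lam]_y (v y * (d + norm2 (y - x)) `^ (- (2 + s)))%:E <= T%:E)%E ->
  (forall y, norm2 (y - x) < d -> 0 < v y -> subsol s v y (- (a * v y))) ->
  a * v x <= (3 / lrad s) `^ (2 + s) * T.
Proof.
move=> d0 a0 mv v0 cv hT hsub.
have T0 : 0 <= T.
  rewrite -lee_fin; apply: le_trans hT; apply: int_ge0 => y.
  by rewrite mulr_ge0// powR_ge0.
have := v0 x; rewrite le_eqVlt => /orP[/eqP <-|vx0].
  by rewrite mulr0 mulr_ge0// powR_ge0.
have [|M [rho [/andP[rho0 rhod] M0 hx hM]]] :=
  @local_max_pt _ s s01 v x d a 0 T d0 mv v0 cv hT _ vx0.
  by move=> y yd vy; rewrite sub0r; exact: hsub.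
have r0 := lrad_gt0 s01; have l0 := low_cst_gt0 s.
set q := lrad s * rho in hM; have q0 : 0 < q by rewrite mulr_gt0.
have d3 : 0 < d ^+ 3 by rewrite exprn_gt0.
rewrite add0r in hM.
have h1 : a * M <= (3 * d / q) `^ (2 + s) * T.
  apply: le_trans hM; rewrite mulrDr [M * a]mulrC lerDr.
  by rewrite mulr_ge0 ?(ltW M0)// mulr_ge0 ?powR_ge0// divr_ge0// ltW.
rewrite -(ler_pM2r d3) -mulrA.
apply: le_trans (ler_wpM2l a0 hx) _; rewrite mulrA.
apply: le_trans (ler_wpM2r (exprn_ge0 3 (ltW rho0)) h1) _.
rewrite [leLHS]mulrAC [leRHS]mulrAC ler_wpM2r//.
(* The reason for the cube in the weight of [local_max_pt]: [3] exceeds [2 + s], so a positive power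
   [1 - s] of [rho <= d] is left over. *)
have e1 : (3 * d / q) `^ (2 + s) * rho ^+ 3 = (3 / lrad s) `^ (2 + s) * d `^ (2 + s) * rho `^ (1 - s).
  apply: ln_inj; rewrite ?posrE ?(powR_gt0, mulr_gt0, invr_gt0, exprn_gt0)//.
  rewrite !(lnM, ln_powR, lnXR, lnV) ?posrE ?(powR_gt0, mulr_gt0, invr_gt0, exprn_gt0)//.
  by ring.
have e2 : d ^+ 3 = d `^ (2 + s) * d `^ (1 - s).
  rewrite -powRD; last by rewrite (gt_eqF d0) implybT.
  by rewrite -powR_mulrn ?(ltW d0)//; congr (_ `^ _); ring.
rewrite e1 e2 [leRHS]mulrA ler_wpM2l//; first by rewrite mulr_ge0// powR_ge0.
by rewrite ge0_ler_powR ?nnegrE ?subr_ge0 ?(ltW s1) ?(ltW d0) ?(ltW rho0).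
Qed.

End local_max_corollaries.

(** Convergence is asked only where the limit is positive. This spares the diagonal, where the
    translated kernels do not converge but the limit integrand vanishes. *)
Lemma fatou_real d (T : measurableType d) (R : realType) (m : {measure set T -> \bar R})
    (h : nat -> T -> R) (g : T -> R) (B : R) :
  (forall k, measurable_fun setT (h k)) -> measurable_fun setT g ->
  (forall k x, 0 <= h k x) -> (forall x, 0 <= g x) ->
  (forall x, 0 < g x -> (fun k => h k x) @ \oo --> g x) ->
  (forall k, (\int[m]_x (h k x)%:E <= B%:E)%E) ->
  (\int[m]_x (g x)%:E <= B%:E)%E.
Proof.
move=> mh mg h0 g0 hg hB.
pose h' k x := chi (0 < g x) * h k x.
have mh' k : measurable_fun setT (h' k).
  by have mhk := mh k; rewrite /h'; mfun.
have h'0 k x : 0 <= h' k x by rewrite /h' mulr_ge0.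
have h'g x : (h' k x)%:E @[k --> \oo] --> (g x)%:E.
  apply: cvg_EFin; first by near=> k.
  have := g0 x; rewrite le_eqVlt => /orP[/eqP gx|gx].
    rewrite -gx (_ : _ \o _ = cst 0); first exact: cvg_cst.
    by apply/funext => k; rewrite /h' /= -gx ltxx mul0r.
  rewrite (_ : _ \o _ = (fun k => h k x)); first exact: hg.
  by apply/funext => k; rewrite /h' /= gx mul1r.
have hf := @fatou _ _ _ m setT measurableT (fun k x => (h' k x)%:E)
  (fun k => (measurable_EFinP _ _).2 (mh' k)) (fun k x _ => h'0 k x).
rewrite (_ : (\int[m]_x (g x)%:E = \int[m]_x limn_einf (fun k => (h' k x)%:E))%E); last first.
  apply: eq_integral => x _; rewrite is_cvg_limn_einfE; first by apply/esym/cvg_lim.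
  by apply/cvg_ex; exists (g x)%:E.
apply: (le_trans hf); rewrite limn_einf_lim; apply: lime_le; first exact: is_cvg_einfs.
near=> k; apply: le_trans (hB k); apply: (@le_trans _ _ (\int[m]_x (h' k x)%:E)%E).
  by apply: ereal_inf_lbound; exists k => /=.
apply: ge0_le_int => // x.
by rewrite /h' ler_piMl// lern1 leq_b1.
Unshelve. all: by end_near.
Qed.

(** * Pointwise Hoelder bounds and Baire's theorem *)

Section gagliardo1.
Context {R : realType} (s : R) (s01 : 0 < s < 1).
Let s0 : 0 < s. Proof. by case/andP : s01. Qed.
Let s1 : s < 1. Proof. by case/andP : s01. Qed.
Notation ker := (ker s).
Implicit Types (f : R * R -> R) (x y : R * R).

Definition gag1 f x : \bar R := (\int[lam]_y (`|f x - f y| * ker (y - x))%:E)%E.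

Let measurable_gag1 f x : measurable_fun setT f ->
  measurable_fun setT (fun y => `|f x - f y| * ker (y - x)).
Proof. by move=> mf; have mk := measurable_ker1 s; mfun. Qed.

Lemma ker_shift (g : R * R -> R) x : measurable_fun setT g -> (forall y, 0 <= g y) ->
  (\int[lam]_z (g (x + z) * ker z)%:E = \int[lam]_y (g y * ker (y - x))%:E)%E.
Proof.
move=> mg g0; have mk := measurable_ker1 s.
rewrite -(lam_shift x (f := fun y => (g y * ker (y - x))%:E)).
- by apply: eq_integral => z _; rewrite addrK addrC.
- by mfun.
- by move=> y; rewrite lee_fin mulr_ge0// ker_ge0.
Qed.

(** The triangle inequality through a third point [y] is integrated over a square of side
    [norm2 (x - x')]. The square is shifted by twice that length, so that [y] stays away from both
    points while both kernels are at least [5 * norm2 (x - x')] to the power [- (2 + s)]. *)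
Lemma gag1_holder f x x' (N N' : R) : measurable_fun setT f ->
  (gag1 f x <= N%:E)%E -> (gag1 f x' <= N'%:E)%E ->
  `|f x - f x'| <= 5 `^ (2 + s) * norm2 (x - x') `^ s * (N + N').
Proof.
move=> mf hN hN'; have [->|xx'] := eqVneq x x'.
  have N0 : 0 <= N + N'.
    by rewrite addr_ge0// -lee_fin ?(le_trans _ hN) ?(le_trans _ hN')//; apply: int_ge0 => y;
      rewrite mulr_ge0 ?ker_ge0.
  by rewrite subrr normr0 !mulr_ge0 ?powR_ge0.
set r := norm2 (x - x'); have r0 : 0 < r by rewrite norm2_gt0 subr_eq0.
pose B : set (R * R) := [set` `[x.1 + 2 * r, x.1 + 3 * r]] `*` [set` `[x.2, x.2 + r]].
have mB : measurable B by exact: measurableX.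
have mI : measurable_fun setT (fun z : R * R => \1_B z : R) by exact: measurable_indic.
set D := `|f x - f x'|.
have mk := measurable_ker1 s; have k0 := ker_ge0 s.
have : (((5 * r) `^ (- (2 + s)) * D)%:E * lam B <= N%:E + N'%:E)%E.
  apply: le_trans (leeD hN hN'); rewrite -lam_indic//.
  have cc0 : 0 <= (5 * r) `^ (- (2 + s)) * D by rewrite mulr_ge0 ?powR_ge0 ?normr_ge0.
  rewrite -ge0_intZ//.
  have m1 := measurable_gag1 x mf; have m2 := measurable_gag1 x' mf.
  have g1 y : 0 <= `|f x - f y| * ker (y - x) by rewrite mulr_ge0.
  have g2 y : 0 <= `|f x' - f y| * ker (y - x') by rewrite mulr_ge0.
  rewrite -(ge0_intD lam m1 m2 g1 g2).
  apply: ge0_le_int => //; [by mfun|by mfun|by move=> y; rewrite mulr_ge0|].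
  move=> y; rewrite indicE; case: (boolP (y \in B)) => [|_]; last first.
    by rewrite mulr0 addr_ge0 ?mulr_ge0.
  rewrite inE => -[/=]; rewrite !in_itv/= => /andP[y1 y1'] /andP[y2 y2'].
  have nx : norm2 (y - x) <= 4 * r.
    by rewrite (le_trans (norm2_le _))//= !ger0_norm; lra.
  have nx' : norm2 (y - x') <= 5 * r.
    by have := norm2_dist y x x'; rewrite -/r; lra.
  have px : 2 * r <= norm2 (y - x).
    by rewrite (le_trans _ (le_norm2_fst _))//= ger0_norm; lra.
  have px' : r <= norm2 (y - x').
    by have := norm2_dist y x' x; rewrite (norm2BC x') -/r; lra.
  have kx : (5 * r) `^ (- (2 + s)) <= ker (y - x).
    by apply: ker_ge => //; rewrite -?norm2_gt0; lra.
  have kx' : (5 * r) `^ (- (2 + s)) <= ker (y - x').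
    by apply: ker_ge => //; rewrite -?norm2_gt0; lra.
  rewrite mulr1; have := ler_distD (f y) (f x) (f x'); rewrite -/D (distrC (f y)) => hD.
  apply: (@le_trans _ _ ((5 * r) `^ (- (2 + s)) * (`|f x - f y| + `|f x' - f y|))).
    by rewrite ler_wpM2l// powR_ge0.
  by rewrite mulrDr lerD// mulrC ler_wpM2l.
rewrite lam_box; [|lra|lra].
rewrite -EFinM -EFinD lee_fin.
rewrite (_ : (_ - _) * _ = r ^+ 2); last by ring.
move=> h.
have e : 5 `^ (2 + s) * r `^ s * ((5 * r) `^ (- (2 + s)) * r ^+ 2) = 1.
  apply: ln_inj; rewrite ?posrE ?(powR_gt0, mulr_gt0, invr_gt0, exprn_gt0)//.
  rewrite !(lnM, ln_powR, lnXR, lnV) ?posrE ?(powR_gt0, mulr_gt0, invr_gt0, exprn_gt0)// ln1.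
  by ring.
apply: (@le_trans _ _ (5 `^ (2 + s) * r `^ s * ((5 * r) `^ (- (2 + s)) * r ^+ 2 * D))).
  by rewrite mulrA e mul1r.
rewrite ler_wpM2l//; first by rewrite mulr_ge0// powR_ge0.
by apply: le_trans h; rewrite mulrAC.
Qed.

Lemma powR_lt_root (e r : R) : 0 < e -> 0 <= r -> r < e `^ s^-1 -> r `^ s < e.
Proof.
move=> e0 r0 re; have -> : e = (e `^ s^-1) `^ s by rewrite -powRrM mulVf ?gt_eqF// powRr1// ltW.
by rewrite gt0_ltr_powR// nnegrE// powR_ge0.
Qed.

Lemma cont2_ker (z : R * R) : z != 0 -> cont2 ker z.
Proof.
move=> z0; have nz : 0 < norm2 z by rewrite norm2_gt0.
apply/cont2P.
have cn : {for z, continuous (@norm2 R)}.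
  by apply/cont2P; have := @cont2_norm2 _ 0 z; rewrite (_ : (fun y => _) = norm2)//;
    apply/funext => y; rewrite subr0.
have cp : {for norm2 z, continuous (fun a : R => a `^ (- (2 + s)))}.
  apply/differentiable_continuous/derivable1_diffP.
  by apply: derivable_powR; rewrite in_itv/= nz.
rewrite (_ : ker = (fun a : R => a `^ (- (2 + s))) \o norm2).
  exact: continuous_comp.
by apply/funext => y; rewrite /= powRN.
Qed.

Lemma seq_cvg2 (F : R * R -> R) (X : nat -> R * R) x L :
  (fun k => norm2 (X k - x)) @ \oo --> (0 : R) ->
  (forall e, 0 < e -> exists2 d, 0 < d & forall k, norm2 (X k - x) < d -> `|F (X k) - L| < e) ->
  (fun k => F (X k)) @ \oo --> L.
Proof.
move=> Xx hF; apply/cvgrPdist_lt => e /hF[d d0 hd].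
near=> k; rewrite distrC; apply: hd; near: k.
have /cvgrPdist_lt /(_ d d0) := Xx; apply: filterS => k.
by rewrite sub0r normrN ger0_norm// norm2_ge0.
Unshelve. all: by end_near.
Qed.

(** Lower semicontinuity, which makes the sublevel sets closed as Baire's theorem requires. Although
    [f] is not known to be continuous, [gag1_holder] makes it converge along points where [gag1]
    stays bounded; Fatou's lemma does the rest. *)
Lemma gag1_closed f x (N N' : R) : measurable_fun setT f -> (gag1 f x <= N'%:E)%E ->
  (forall e, 0 < e -> exists2 x', norm2 (x' - x) < e & (gag1 f x' <= N%:E)%E) ->
  (gag1 f x <= N%:E)%E.
Proof.
move=> mf hN' hx.
have ex k : exists x', norm2 (x' - x) < k.+1%:R^-1 /\ (gag1 f x' <= N%:E)%E.
  by have [|x' h1 h2] := hx k.+1%:R^-1; [rewrite invr_gt0|exists x'].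
have [X hX] := choice ex.
have Xx : (fun k => norm2 (X k - x)) @ \oo --> (0 : R).
  apply: (@squeeze_cvgr _ _ _ _ (fun=> 0) (fun k => k.+1%:R^-1)).
  - by near=> k; rewrite norm2_ge0/= ltW//; case: (hX k).
  - exact: cvg_cst.
  - exact: cvg_harmonic.
have fX : (fun k => f (X k)) @ \oo --> f x.
  apply: (seq_cvg2 Xx) => e e0.
  have NN : 0 <= N + N'.
    rewrite addr_ge0// -lee_fin; last by apply: le_trans hN'; apply: int_ge0 => y; rewrite mulr_ge0 ?ker_ge0.
    by case: (hX 0%N) => _; apply: le_trans; apply: int_ge0 => y; rewrite mulr_ge0 ?ker_ge0.
  have c0 : 0 < 5 `^ (2 + s) * (N + N' + 1) by rewrite mulr_gt0 ?powR_gt0// ltr_wpDl.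
  exists ((e / (5 `^ (2 + s) * (N + N' + 1))) `^ s^-1); first by rewrite powR_gt0// divr_gt0.
  move=> k /powR_lt_root; rewrite divr_gt0// norm2_ge0 => /(_ isT isT).
  rewrite ltr_pdivlMr// => h; have [_ hXk] := hX k.
  apply: le_lt_trans (gag1_holder mf hXk hN') _; apply: le_lt_trans h.
  rewrite -mulrA [leRHS]mulrCA ler_wpM2l ?powR_ge0// ler_wpM2l ?powR_ge0//.
  by rewrite lerDl.
have mk := measurable_ker1 s; have k0 := ker_ge0 s.
apply: (@fatou_real _ _ _ lam (fun k y => `|f (X k) - f y| * ker (y - X k)) (fun y => `|f x - f y| * ker (y - x))).
- by move=> k; exact: measurable_gag1.
- exact: measurable_gag1.
- by move=> k y; rewrite mulr_ge0.
- by move=> y; rewrite mulr_ge0.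
- move=> y hy; apply: cvgM.
    by apply: cvg_norm; apply: cvgB => //; exact: cvg_cst.
  have yx : y - x != 0.
    by apply: contraTneq hy => h; rewrite h ker0// mulr0 ltxx.
  apply: (@seq_cvg2 (fun x' => ker (y - x')) X x _ Xx).
  move=> e e0; have [d d0 hd] := cont2_ker yx e0; exists d => // k hk; apply: hd.
  by rewrite opprB addrC addrA subrK norm2BC.
- by move=> k; case: (hX k).
Unshelve. all: by end_near.
Qed.

End gagliardo1.

Section baire2.
Context {R : realType}.
Implicit Types (x y z : R * R).

(** Applied with [F] the bad set and [E k] the sublevel sets. The nested balls have their centres in
    [F] but avoid the sets [E k] in the whole plane, and these cover the plane; so the common point
    of the balls yields a contradiction wherever it lies. *)
Lemma baire2 (F : set (R * R)) (E : nat -> set (R * R)) : F !=set0 ->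
  (forall k x, (forall e, 0 < e -> exists2 x', norm2 (x' - x) < e & E k x') -> E k x) ->
  (forall x, exists k, E k x) ->
  exists x d k, [/\ F x, 0 < d & forall y, F y -> norm2 (y - x) < d -> E k y].
Proof.
move=> [x0 Fx0] cE coverE; apply: contrapT => nE.
have H x d k : F x -> 0 < d -> exists y, [/\ F y, norm2 (y - x) < d & ~ E k y].
  move=> Fx d0; apply: contrapT => h; apply: nE; exists x, d, k; split=> // y Fy yx.
  by apply: contrapT => nEy; apply: h; exists y.
have step (k : nat) (p : (R * R) * R) : exists q : (R * R) * R, F p.1 -> 0 < p.2 ->
   [/\ F q.1, 0 < q.2, norm2 (q.1 - p.1) + q.2 <= p.2 &
       forall z, norm2 (z - q.1) <= 2 * q.2 -> ~ E k z].
  have [[Fp p0]|np] := pselect (F p.1 /\ 0 < p.2); last first.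
    by exists p => h1 h2; exfalso; apply: np.
  have [y [Fy yp nEy]] := H p.1 (p.2 / 2) k Fp ltac:(by rewrite divr_gt0).
  have [e e0 he] : exists2 e, 0 < e & forall x', norm2 (x' - y) < e -> ~ E k x'.
    apply: contrapT => h; apply: nEy; apply: cE => e e0.
    apply: contrapT => h'; apply: h; exists e => // x' h1 h2; apply: h'.
    by exists x'.
  exists (y, Num.min (p.2 / 2) (e / 3)) => _ _ /=; split => //.
  - by rewrite lt_min !divr_gt0.
  - have : Num.min (p.2 / 2) (e / 3) <= p.2 / 2 by rewrite ge_min lexx.
    by lra.
  - move=> z hz; apply: he; apply: (le_lt_trans hz).
    have : Num.min (p.2 / 2) (e / 3) <= e / 3 by rewrite ge_min lexx orbT.
    by lra.
have [f hf] := choice (fun kp : nat * ((R * R) * R) => step kp.1 kp.2).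
pose S := fix S n := if n is k.+1 then f (k, S k) else (x0, 1).
have SF k : F (S k).1 /\ 0 < (S k).2.
  by elim: k => [//|k [h1 h2]] /=; have [] := hf (k, S k) h1 h2.
have Sstep k : norm2 ((S k.+1).1 - (S k).1) + (S k.+1).2 <= (S k).2.
  by have [h1 h2] := SF k; have [] := hf (k, S k) h1 h2.
have Snest k j : norm2 ((S (k + j)%N).1 - (S k).1) + (S (k + j)%N).2 <= (S k).2.
  elim: j => [|j ih]; first by rewrite addn0 subrr norm2_0 add0r.
  rewrite addnS; have := Sstep (k + j)%N.
  by have := norm2_dist (S (k + j).+1).1 (S (k + j)%N).1 (S k).1; lra.
(* Completeness by coordinates: each coordinate of the centres has a limit, obtained as a supremum
   of lower bounds, within the current radius. Two coordinates give a distance of at most twice the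
   radius, hence the factor [2] in [step]. *)
have lim (g : R * R -> R) : (forall a, `|g a| <= norm2 a) -> (forall a b, g (a - b) = g a - g b) ->
    exists c, forall k, `|c - g (S k).1| <= (S k).2.
  move=> g1 gB.
  have key k j : g (S k).1 - (S k).2 <= g (S j).1 + (S j).2.
    have d1 i l : `|g (S (i + l)%N).1 - g (S i).1| + (S (i + l)%N).2 <= (S i).2.
      by rewrite -gB; apply: le_trans (Snest i l); rewrite lerD2r.
    have := SF k; have := SF j => -[_ j0] [_ k0].
    have [kj|jk] := leqP k j.
      have := d1 k (j - k)%N; rewrite subnKC//.
      by have := ler_norm (g (S k).1 - g (S j).1); rewrite distrC; lra.
    have := d1 j (k - j)%N; rewrite subnKC// 1?ltnW//.
    by have := ler_norm (g (S k).1 - g (S j).1); lra.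
  pose A := [set g (S k).1 - (S k).2 | k in [set: nat]].
  have supA : has_sup A.
    split; first by exists (g (S 0%N).1 - (S 0%N).2); exists 0%N.
    by exists (g (S 0%N).1 + (S 0%N).2) => _ [k _ <-].
  exists (sup A) => k; rewrite ler_distl; apply/andP; split.
    by apply: ub_le_sup; [exact: supA.2|exists k].
  apply: ge_sup; first exact: supA.1.
  by move=> _ [j _ <-]; exact: key.
have [c1 hc1] := lim fst (@le_norm2_fst R) (fun a b => erefl).
have [c2 hc2] := lim snd (@le_norm2_snd R) (fun a b => erefl).
have [k Ek] := coverE (c1, c2).
have [h1 h2] := SF k; have [_ _ _ /(_ (c1, c2))] := hf (k, S k) h1 h2; apply=> //.
apply: le_trans (norm2_le _) _ => /=.
by have := hc1 k.+1; have := hc2 k.+1; rewrite /=; lra.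
Qed.

End baire2.

Section regularity.
Context {R : realType} (s : R) (s01 : 0 < s < 1).
Let s0 : 0 < s. Proof. by case/andP : s01. Qed.
Let s1 : s < 1. Proof. by case/andP : s01. Qed.
Notation ker := (ker s).
Implicit Types (u v : R * R -> R) (x y z : R * R).

Definition sol u := forall x,
  lam.-integrable setT (EFin \o (fun z => (u x - u (x + z)) * ker z)) /\
  (\int[lam]_z ((u x - u (x + z)) * ker z)%:E = (u x - u x ^+ 3)%:E)%E.

Lemma sol_of_solves_eq u : solves_eq s u -> sol u.
Proof.
move=> hu x; have [hi hr] := hu x; split; first exact: hi.
rewrite -hr /Rintegral fineK//.
exact: (integrable_fin_num measurableT hi).
Qed.

Lemma solN u : sol u -> sol (fun x => - u x).
Proof.
move=> hu x; have [hi hr] := hu x.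
have e : (fun z => (- u x - - u (x + z)) * ker z) = (fun z => - ((u x - u (x + z)) * ker z)).
  by apply/funext => z; ring.
have hiN := integrableN hi.
rewrite e; split; first by apply: (eq_integrable measurableT _ _ _ hiN) => z _ /=; rewrite EFinN.
have -> : (- u x - (- u x) ^+ 3)%:E = (- (u x - u x ^+ 3)%:E)%E by rewrite -EFinN; congr EFin; ring.
rewrite -hr -[RHS]mulN1e -(integralZl measurableT hi).
by apply: eq_integral => z _; rewrite /= mulN1e -EFinN; congr EFin; ring.
Qed.

Lemma sol_gag1 u x : measurable_fun setT u -> sol u -> (gag1 s u x < +oo)%E.
Proof.
move=> mu /(_ x)[/integrableP[_ h] _]; apply: le_lt_trans h.
have mk := measurable_ker1 s.
rewrite /gag1 -(@ker_shift _ s (fun y => `|u x - u y|) x)//; last by mfun.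
rewrite le_eqVlt; apply/orP; left; apply/eqP; apply: eq_integral => z _ /=.
by rewrite normrM (ger0_norm (ker_ge0 _ _)).
Qed.

(** At a point above the level [c] truncation subtracts exactly [c], and elsewhere it leaves values
    at least [u - c]; so every increment [v y - v (y + z)] is at most that of [u]. *)
Lemma sol_subsol u y (c B : R) : measurable_fun setT u -> sol u ->
  0 < Num.max (u y - c) 0 -> u y - u y ^+ 3 <= B ->
  subsol s (fun y => Num.max (u y - c) 0) y B.
Proof.
move=> mu hu vy uB g h mg mh g0 h0 hg; have [hi hr] := hu y.
have uy : c < u y by move: vy; rewrite lt_max ltxx orbF subr_gt0.
apply: (@le_trans _ _ ((u y - u y ^+ 3)%:E + \int[lam]_z (g z)%:E)%E).
  apply: (integrable_split hi hr mg mh g0 h0) => z.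
  apply: le_trans (hg z) _; rewrite lerD2r ler_wpM2r ?ker_ge0//.
  rewrite (@max_l _ _ (u y - c)) ?subr_ge0 ?(ltW uy)//.
  have : u (y + z) - c <= Num.max (u (y + z) - c) 0 by rewrite le_max lexx.
  by lra.
by rewrite leeD2r// lee_fin.
Qed.

(** [local_max_ub] is applied to the positive part of [u - u z]. Its tail seen from [y] is
    controlled by [gag1] at [z], because [norm2 (y - z) <= 4 * d] gives [norm2 (y' - z) <= 5 * (d +
    norm2 (y' - y))]. *)
Lemma sol_osc u y z (d N A : R) : measurable_fun setT u -> sol u -> 0 < d -> 0 <= A ->
  (forall y', norm2 (y' - y) <= d -> cont2 u y') -> norm2 (y - z) <= 4 * d ->
  (gag1 s u z <= N%:E)%E -> (forall t, u z <= t -> t - t ^+ 3 <= A) ->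
  u y - u z <= lmax_cst s * d `^ s * (A + 5 `^ (2 + s) * N).
Proof.
move=> mu hu d0 A0 cu yz hN hA.
apply: (@le_trans _ _ (Num.max (u y - u z) 0)); first by rewrite le_max lexx.
have mv : measurable_fun setT (fun y => Num.max (u y - u z) 0) by mfun.
apply: (local_max_ub s01 d0 A0 mv).
- by move=> y'; rewrite le_max lexx orbT.
- move=> y' /cu cy'; apply: cont2_max0; apply: cont2B => //; exact: cont2_cst.
- have mk := measurable_ker1 s; have k0 := ker_ge0 s.
  apply: (@le_trans _ _ (\int[lam]_y' (5 `^ (2 + s) * (`|u z - u y'| * ker (y' - z)))%:E)%E).
    apply: ge0_le_int; [by mfun|by mfun| |].
      by move=> y'; rewrite mulr_ge0 ?powR_ge0// le_max lexx orbT.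
    move=> y'; have [->|y'z] := eqVneq y' z; first by rewrite !subrr maxxx normr0 !mul0r mulr0.
    have n0 : 0 < norm2 (y' - z) by rewrite norm2_gt0 subr_eq0.
    rewrite mulrCA ler_pM ?powR_ge0//; first by rewrite le_max lexx orbT.
      by rewrite ge_max normr_ge0 andbT distrC ler_norm.
    have dd : 0 < d + norm2 (y' - y) by rewrite ltr_wpDr ?norm2_ge0.
    rewrite powRN /Defs.norm2 -/(norm2 _) -/(norm2 _) /ker ler_pdivlMr ?powR_gt0// mulrC ler_pdivrMr ?powR_gt0//.
    rewrite -powRM ?(ltW dd)// ge0_ler_powR ?nnegrE ?norm2_ge0 ?mulr_ge0 ?(ltW dd) ?addr_ge0 ?(ltW s0)//.
    by have := norm2_dist y' y z; have := norm2_ge0 (y' - y); lra.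
  have m1 : measurable_fun setT (fun y' => `|u z - u y'| * ker (y' - z)) by mfun.
  have g1 y' : 0 <= `|u z - u y'| * ker (y' - z) by rewrite mulr_ge0.
  by rewrite (ge0_intZ lam m1 (powR_ge0 _ _) g1) EFinM lee_wpmul2l// lee_fin powR_ge0.
- move=> y' _ vy'; apply: sol_subsol => //; apply: hA; apply: ltW.
  by move: vy'; rewrite lt_max ltxx orbF subr_gt0.
Qed.

Lemma cont2_holder u x (d C : R) : 0 < d -> 0 <= C ->
  (forall y, norm2 (y - x) < d -> `|u y - u x| <= C * norm2 (y - x) `^ s) -> cont2 u x.
Proof.
move=> d0 C0 hC e e0.
have C1 : 0 < C + 1 by rewrite ltr_wpDl.
exists (Num.min d ((e / (C + 1)) `^ s^-1)); first by rewrite lt_min d0 powR_gt0// divr_gt0.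
move=> y; rewrite lt_min => /andP[yd ye]; apply: le_lt_trans (hC y yd) _.
have := powR_lt_root s01 (divr_gt0 e0 C1) (norm2_ge0 _) ye; rewrite ltr_pdivlMr//.
by have := powR_ge0 (norm2 (y - x)) s; nra.
Qed.

End regularity.

Section sol_regular.
Context {R : realType} (s : R) (s01 : 0 < s < 1).
Let s0 : 0 < s. Proof. by case/andP : s01. Qed.
Let s1 : s < 1. Proof. by case/andP : s01. Qed.
Notation ker := (ker s).
Variables (u : R * R -> R) (mu : measurable_fun setT u) (hu : sol s u).
Implicit Types (x y z : R * R).

Let cubic_ub (c t : R) : c <= t -> t - t ^+ 3 <= 1 + `|c| ^+ 3.
Proof.
move=> ct; have c0 := normr_ge0 c.
have [t0|t0] := leP 0 t.
  have : 0 <= `|c| ^+ 3 by rewrite exprn_ge0.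
  have : t - t ^+ 3 <= 1 by have := sqr_ge0 (t - 1); nra.
  by lra.
have : - t <= `|c| by have := ler_norm (- c); rewrite normrN; lra.
move=> h; have : (- t) ^+ 3 <= `|c| ^+ 3 by rewrite lerXn2r// nnegrE; lra.
by rewrite exprNn; lra.
Qed.

(* By Baire's theorem [gag1 s u] is bounded near some point of the set where [u] is not locally
   continuous, which makes [u] Hoelder there; [sol_osc] controls [u] off that set. *)
Lemma sol_continuous x : cont2 u x.
Proof.
pose G y := exists2 d, 0 < d & forall y', norm2 (y' - y) < d -> cont2 u y'.
suff GT y : G y by have [d d0] := GT x; apply; rewrite subrr norm2_0.
apply: contrapT => nGy; pose F := [set y | ~ G y].
have [|k y' hy'|y'|z0 [d [k [Fz0 d0 hE]]]] :=
  @baire2 _ F (fun k => [set y | (gag1 s u y <= k%:R%:E)%E]) _ _ _.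
- by exists y.
- have := sol_gag1 y' mu hu => /ltW h.
  have [N' hN'] : exists N' : R, (gag1 s u y' <= N'%:E)%E.
    exists (fine (gag1 s u y')); rewrite fineK// ge0_fin_numE ?sol_gag1//.
    by apply: int_ge0 => z; rewrite mulr_ge0// ker_ge0.
  exact: (gag1_closed s01 mu hN' hy').
- have h := sol_gag1 y' mu hu.
  have h0 : (0 <= gag1 s u y')%E by apply: int_ge0 => z; rewrite mulr_ge0// ker_ge0.
  exists (Num.truncn (fine (gag1 s u y'))).+1 => /=.
  rewrite -[gag1 _ _ _]fineK ?ge0_fin_numE// lee_fin ltW//.
  by have /andP[] := Num.Theory.truncn_itv (fine_ge0 h0).
apply: Fz0; exists (d / 8); first by rewrite divr_gt0.
move=> x' hx'.
have [[e e0 he]|nGx'] := pselect (G x').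
  by apply: he; rewrite subrr norm2_0.
have hkx' : (gag1 s u x' <= k%:R%:E)%E by apply: hE => //; lra.
set N : R := k%:R in hE hkx'; have N0 : 0 <= N by exact: ler0n.
pose H := 5 `^ (2 + s) * (N + N); have H0 : 0 <= H by rewrite mulr_ge0 ?powR_ge0 ?addr_ge0.
(* [c] bounds [|u z|] for the points [z] of [F] near [x'], and [A] then bounds [t - t ^+ 3] for all
   [t >= u z]: a lower bound on [t] is enough because the cubic term has the good sign. The same
   holds for [- u]. *)
pose c := `|u x'| + H * d `^ s.
pose A := 1 + c ^+ 3.
have c0 : 0 <= c by rewrite addr_ge0// mulr_ge0// powR_ge0.
have A0 : 0 <= A by rewrite addr_ge0// exprn_ge0.
pose L := lmax_cst s * (A + 5 `^ (2 + s) * N).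
have L0 : 0 <= L.
  by rewrite mulr_ge0 ?lmax_cst_ge0// addr_ge0// mulr_ge0// powR_ge0.
have powS (a b : R) : 0 <= a -> a <= b -> a `^ s <= b `^ s.
  by move=> a0 ab; rewrite ge0_ler_powR ?nnegrE ?(ltW s0)// (le_trans a0).
have hF z : F z -> norm2 (z - x') < d / 2 ->
    (gag1 s u z <= N%:E)%E /\ `|u z - u x'| <= H * norm2 (z - x') `^ s.
  move=> Fz zx; have hz : (gag1 s u z <= N%:E)%E.
    by apply: hE => //; have := norm2_dist z x' z0; lra.
  split=> //; have := gag1_holder s01 mu hz hkx'.
  by rewrite /H mulrAC.
apply: (@cont2_holder _ s s01 _ _ (d / 8) (L + H * 3 `^ s)).
- by rewrite divr_gt0.
- by rewrite addr_ge0// mulr_ge0// powR_ge0.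
move=> y' hy'.
have ny' : 0 <= norm2 (y' - x') `^ s by exact: powR_ge0.
have h13 : 1 <= 3 :> R by lra.
have t3 : 1 <= (3 : R) `^ s by have := ler_powR h13 (ltW s0); rewrite powRr0.
have [Gy'|Fy'] := pselect (G y'); last first.
  have [_ h] := hF y' Fy' ltac:(lra); apply: (le_trans h).
  by rewrite ler_wpM2r//; nra.
(* A point [y'] off [F] is compared with a nearly closest point [z] of [F]. With tolerance [dd] one
   has [norm2 (y' - z) < 2 * dd], four times the radius [dd / 2] of a ball of continuity, as
   [sol_osc] demands. Since [dd <= norm2 (y' - x')], the resulting bound is Hoelder at [x']. *)
pose D := [set norm2 (y' - z) | z in F].
have infD : has_inf D.
  split; first by exists (norm2 (y' - x')); exists x'.
  by exists 0 => _ [z _ <-]; exact: norm2_ge0.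
have [e e0 he] := Gy'.
set dd := inf D.
have dd0 : 0 < dd.
  apply: (lt_le_trans e0); apply: lb_le_inf; first exact: infD.1.
  move=> _ [z Fz <-]; rewrite leNgt; apply/negP => zy; apply: Fz.
  exists (e - norm2 (y' - z)); first by rewrite subr_gt0.
  move=> w hw; apply: he; have := norm2_dist w z y'; rewrite (norm2BC z y'); lra.
have ddx : dd <= norm2 (y' - x').
  by apply: ge_inf; [exact: infD.2|exists x'].
have [_ [z Fz <-] hz] := inf_adherent dd0 infD.
rewrite -/dd in hz.
have cball w : norm2 (w - y') <= dd / 2 -> cont2 u w.
  move=> hw; have [[r r0 hr]|Fw] := pselect (G w).
    by apply: hr; rewrite subrr norm2_0.
  have : dd <= norm2 (y' - w) by apply: ge_inf; [exact: infD.2|exists w].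
  by rewrite norm2BC; lra.
have zx' : norm2 (z - x') <= 3 * norm2 (y' - x').
  by have := norm2_dist z y' x'; rewrite (norm2BC z y'); lra.
have [hgz huz] := hF z Fz ltac:(lra).
have zx'd : norm2 (z - x') `^ s <= d `^ s.
  by apply: powS; rewrite ?norm2_ge0//; lra.
have zx3 : norm2 (z - x') `^ s <= 3 `^ s * norm2 (y' - x') `^ s.
  by rewrite -powRM ?norm2_ge0//; apply: powS => //; exact: norm2_ge0.
have uzc : `|u z| <= c.
  have := ler_normD (u z - u x') (u x'); rewrite subrK => h; apply: (le_trans h).
  by rewrite /c addrC lerD2l; apply: (le_trans huz); rewrite ler_wpM2l.
have dd2 : 0 < dd / 2 by rewrite divr_gt0.
have y'z : norm2 (y' - z) <= 4 * (dd / 2) by lra.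
have cA (b : R) : `|b| <= c -> 1 + `|b| ^+ 3 <= A by move=> h; rewrite lerD2l lerXn2r// nnegrE.
have h1 : u y' - u z <= lmax_cst s * (dd / 2) `^ s * (A + 5 `^ (2 + s) * N).
  apply: (sol_osc s01 mu hu dd2 A0 cball y'z hgz) => t /cubic_ub h.
  by apply: (le_trans h); exact: cA.
have muN : measurable_fun setT (fun x => - u x) by mfun.
have hgzN : (gag1 s (fun x => (- u x)%R) z <= N%:E)%E.
  apply: le_trans hgz; rewrite /gag1 le_eqVlt; apply/orP; left; apply/eqP.
  by apply: eq_integral => w _; rewrite -opprD normrN.
have h2 : - u y' - - u z <= lmax_cst s * (dd / 2) `^ s * (A + 5 `^ (2 + s) * N).
  apply: (@sol_osc _ s s01 (fun x => - u x) _ _ _ _ _ muN (solN hu) dd2 A0 _ y'z hgzN).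
    by move=> w /cball; exact: cont2N.
  by move=> t /cubic_ub h; apply: (le_trans h); apply: cA; rewrite normrN.
have h3 : `|u y' - u z| <= L * norm2 (y' - x') `^ s.
  apply: (@le_trans _ _ (L * (dd / 2) `^ s)).
    by rewrite /L ler_norml; apply/andP; split; lra.
  by rewrite ler_wpM2l//; apply: powS; lra.
have := ler_distD (u z) (u y') (u x') => h4; apply: (le_trans h4).
rewrite mulrDl lerD//; apply: (le_trans huz).
by rewrite -mulrA ler_wpM2l.
Qed.

End sol_regular.

Lemma dominated_small d (T : measurableType d) (R : realType) (m : {measure set T -> \bar R})
    (h : nat -> T -> R) (g : T -> R) :
  (forall k, measurable_fun setT (h k)) -> measurable_fun setT g ->
  (forall k x, 0 <= h k x <= g x) -> (\int[m]_x (g x)%:E < +oo)%E ->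
  (forall x, (fun k => h k x) @ \oo --> (0 : R)) ->
  forall e, 0 < e -> exists k, (\int[m]_x (h k x)%:E <= e%:E)%E.
Proof.
move=> mh mg hg goo h0 e e0.
have g0 x : 0 <= g x by have /andP[] := hg 0%N x; exact: le_trans.
have ig : m.-integrable setT (EFin \o g) by exact: ge0_integrable.
have [] := @dominated_convergence _ _ _ m setT measurableT (fun k x => (h k x)%:E)
  (fun=> 0%E) (EFin \o g) _ _ _ ig.
- by move=> k; apply/measurable_EFinP; exact: mh.
- by apply/measurable_EFinP; exact: measurable_cst.
- apply: aeW => x _; apply: cvg_EFin; first by near=> k.
  exact: h0.
- apply: aeW => x k _ /=; have /andP[h1 h2] := hg k x.
  by rewrite lee_fin ger0_norm.
rewrite integral0 => _ _ hc.
apply: contrapT => nk.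
suff : (e%:E <= (0 : \bar R))%E by rewrite lee_fin leNgt e0.
rewrite -(cvg_lim _ hc)//; apply: lime_ge; first by apply/cvg_ex; exists 0%E.
near=> k; rewrite leNgt; apply/negP => hk; apply: nk; exists k; exact: ltW.
Unshelve. all: by end_near.
Qed.

Lemma le_powRN (R : realType) (a b q : R) : 0 < a -> a <= b -> 0 <= q ->
  b `^ (- q) <= a `^ (- q).
Proof.
move=> a0 ab q0; have b0 : 0 < b by exact: lt_le_trans ab.
rewrite !powRN lef_pV2 ?posrE ?powR_gt0//.
by rewrite ge0_ler_powR ?nnegrE ?(ltW a0) ?(ltW b0).
Qed.

(** * The bound by one for solutions *)

Section bounded.
Context {R : realType} (s : R) (s01 : 0 < s < 1).
Let s0 : 0 < s. Proof. by case/andP : s01. Qed.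
Let s1 : s < 1. Proof. by case/andP : s01. Qed.
Notation ker := (ker s).
Implicit Types (x y z : R * R).

Let mjap (a : R) x : measurable_fun setT (fun y => (a + norm2 (y - x)) `^ (- (2 + s))).
Proof. by mfun. Qed.

Lemma japanese_fin : (\int[lam]_z ((1 + norm2 z) `^ (- (2 + s)))%:E < +oo)%E.
Proof.
have mk := measurable_ker1 s; have k0 := ker_ge0 s.
pose B : set (R * R) := [set` `[- 1, 1]] `*` [set` `[- 1, 1]].
have mB : measurable B by exact: measurableX.
have mI : measurable_fun setT (fun z : R * R => \1_B z : R) by exact: measurable_indic.
have mf : measurable_fun setT (fun z => chi (1 <= norm2 z) * ker z : R) by mfun.
have f0 z : 0 <= chi (1 <= norm2 z) * ker z by rewrite mulr_ge0.
apply: (@le_lt_trans _ _ (\int[lam]_z (chi (1 <= norm2 z)%R * ker z + \1_B z)%:E)%E); last first.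
  rewrite (ge0_intD lam mf mI f0)// lam_indic// lam_box; [|lra|lra].
  have := ker_far s01 (ltr01 : 0 < 1 :> R) => h.
  by rewrite lte_add_pinfty// ?ltry// (le_lt_trans h)// ltry.
apply: ge0_le_int; [by mfun|by mfun|by move=> z; exact: powR_ge0|].
move=> z; have [z1|z1] := leP 1 (norm2 z).
  have zz : z != 0 by rewrite -norm2_gt0; lra.
  rewrite mul1r (le_trans (y := ker z)) ?lerDl//.
  by rewrite /ker -powRN le_powRN// ?norm2_gt0// ?lerDr// addr_ge0// ltW.
rewrite mul0r add0r indicE mem_set /=; last first.
  split; rewrite /= in_itv/= -ler_norml.
    by rewrite (le_trans (le_norm2_fst z))// ltW.
  by rewrite (le_trans (le_norm2_snd z))// ltW.
apply: (@le_trans _ _ ((1 : R) `^ (- (2 + s)))); last by rewrite powR1.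
by rewrite le_powRN// ?lerDl ?norm2_ge0// addr_ge0// ltW.
Qed.

Variables (u : R * R -> R) (mu : measurable_fun setT u) (hu : sol s u).

(** No maximum has to be attained. Where [u > 1], [u - u ^+ 3 <= - 2 * (u - 1)], so the positive
    part [v] of [u - 1] satisfies an inequality with absorption, and [local_max_absorb] on balls of
    radius [k + 1] bounds [2 * v x] by a tail integral. The tail is finite because
    [v y <= v x + |u x - u y|] and [gag1] is finite at [x]; it tends to [0] by dominated
    convergence. *)
Lemma sol_le1 x : u x <= 1.
Proof.
pose v y := Num.max (u y - 1) 0.
have mv : measurable_fun setT v by rewrite /v; mfun.
have v0 y : 0 <= v y by rewrite /v le_max lexx orbT.
suff vx : v x = 0 by rewrite -subr_le0 -vx /v le_max lexx.
apply/eqP; rewrite eq_le v0 andbT; apply/ler_addgt0Pr => e e0; rewrite add0r.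
pose h k y := v y * (k.+1%:R + norm2 (y - x)) `^ (- (2 + s)).
have mh k : measurable_fun setT (h k) by rewrite /h; mfun.
have n0 y := norm2_ge0 (y - x).
have k1 k : 1 <= k.+1%:R :> R by rewrite ler1n.
have hle k y : h k y <= h 0%N y.
  rewrite /h ler_wpM2l// !powRN lef_pV2 ?posrE ?powR_gt0 ?ltr_wpDr//.
  rewrite ge0_ler_powR ?nnegrE ?addr_ge0 ?(ltW s0)//.
  by rewrite lerD2r.
have h0fin : (\int[lam]_y (h 0%N y)%:E < +oo)%E.
  have mk := measurable_ker1 s.
  have m1 : measurable_fun setT (fun y => `|u x - u y| * ker (y - x)) by mfun.
  have m2 : measurable_fun setT (fun y => (1 + norm2 (y - x)) `^ (- (2 + s))) by mfun.
  have p2 y : 0 <= (1 + norm2 (y - x)) `^ (- (2 + s)) by exact: powR_ge0.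
  have p1 y : 0 <= `|u x - u y| * ker (y - x) by rewrite mulr_ge0 ?ker_ge0.
  apply: (@le_lt_trans _ _ (\int[lam]_y (`|u x - u y| * ker (y - x) +
      v x * (1 + norm2 (y - x)) `^ (- (2 + s)))%:E)%E).
    apply: ge0_le_int; [exact: mh|by mfun|by move=> y; rewrite mulr_ge0 ?powR_ge0|].
    move=> y; rewrite /h; have [->|yx] := eqVneq y x.
      by rewrite !subrr normr0 mul0r add0r.
    have vy : v y <= v x + `|u x - u y|.
      rewrite [leLHS]/v ge_max; apply/andP; split; last by rewrite addr_ge0.
      have : u x - 1 <= v x by rewrite le_max lexx.
      by have := ler_norm (u y - u x); rewrite distrC; lra.
    apply: le_trans (ler_wpM2r (powR_ge0 _ _) vy) _.
    rewrite mulrDl addrC lerD2r ler_wpM2l// /ker powRN lef_pV2 ?posrE ?powR_gt0 ?norm2_gt0 ?subr_eq0 ?ltr_wpDr//.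
    by rewrite ge0_ler_powR ?nnegrE ?addr_ge0 ?(ltW s0)// lerDr.
  have m3 : measurable_fun setT (fun y => v x * (1 + norm2 (y - x)) `^ (- (2 + s))) by mfun.
  have p3 y : 0 <= v x * (1 + norm2 (y - x)) `^ (- (2 + s)) by rewrite mulr_ge0.
  rewrite (ge0_intD lam m1 m3 p1 p3) lte_add_pinfty//; first exact: sol_gag1.
  rewrite (ge0_intZ lam m2 (v0 x) p2) lte_mul_pinfty ?lee_fin//.
  have mj : measurable_fun setT (fun z : R * R => ((1 + norm2 z) `^ (- (2 + s)))%:E) by mfun.
  have pj z : (0 <= ((1 + norm2 z)%R `^ (- (2 + s)))%:E)%E by rewrite lee_fin powR_ge0.
  by have /= -> := lam_shift (- x) mj pj; exact: japanese_fin.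
have hlim y : (fun k => h k y) @ \oo --> (0 : R).
  apply: (@squeeze_cvgr _ _ _ _ (fun=> 0) (fun k => v y * k.+1%:R^-1)).
  - near=> k; rewrite /h mulr_ge0 ?powR_ge0//= ler_wpM2l//.
    apply: (@le_trans _ _ (k.+1%:R `^ (- (2 + s)))).
      by rewrite le_powRN ?lerDl// addr_ge0// ltW.
    by rewrite -[leRHS]powR_inv1//; apply: ler_powR => //; have := s0; lra.
  - exact: cvg_cst.
  - by rewrite -[X in _ --> X](mulr0 (v y)); apply: cvgM; [exact: cvg_cst|exact: cvg_harmonic].
pose c := (3 / lrad s) `^ (2 + s); have c0 : 0 < c by rewrite powR_gt0// divr_gt0// lrad_gt0.
have h01 k y : 0 <= h k y <= h 0%N y by rewrite hle andbT /h mulr_ge0 ?powR_ge0.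
have [k hk] := @dominated_small _ _ R lam h (h 0%N) mh (mh 0%N) h01 h0fin hlim _ (divr_gt0 e0 c0).
have hv : 2 * v x <= c * (e / c).
  apply: (@local_max_absorb _ s s01 v x k.+1%:R 2 _ _ _ mv v0 _ hk) => //.
  - move=> y _; rewrite /v; apply: cont2_max0; apply: cont2B; last exact: cont2_cst.
    exact: (sol_continuous s01 mu hu).
  - move=> y _ vy; rewrite /v; apply: sol_subsol => //.
    have uy : 1 < u y by move: vy; rewrite /v lt_max ltxx orbF subr_gt0.
    rewrite /v max_l ?subr_ge0 ?(ltW uy)//.
    rewrite -subr_ge0 (_ : _ - _ = (u y - 1) ^+ 2 * (u y + 2)); last by ring.
    by rewrite mulr_ge0 ?sqr_ge0//; lra.
have -> : e = c * (e / c) by field; rewrite gt_eqF.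
by have := v0 x; lra.
Unshelve. all: by end_near.
Qed.

End bounded.

Lemma sol_bounded (R : realType) (s : R) (u : R * R -> R) : 0 < s < 1 ->
  measurable_fun setT u -> sol s u -> forall x, `|u x| <= 1.
Proof.
move=> s01 mu hu x; rewrite ler_norml (sol_le1 s01 mu hu) andbT.
have muN : measurable_fun setT (fun x => - u x) by mfun.
by have := sol_le1 s01 muN (solN hu) x; lra.
Qed.

(** * Local energy estimate *)

Section sup_convolution.
Context {R : realType}.
Variables (u : R * R -> R) (cu : forall x, cont2 u x) (u1 : forall x, `|u x| <= 1).
Variables (L : R) (L0 : 0 < L).
Implicit Types (x y z : R * R).

Let ub x : -1 <= u x <= 1. Proof. by rewrite -ler_norml. Qed.

(* The sup-convolution is Lipschitz and inherits the one-sided bound on the operator at the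
   point where the supremum is attained. *)
Lemma supconv_argmax x : exists y, norm2 (y - x) <= 2 / L /\
  forall y', u y' - L * norm2 (y' - x) <= u y - L * norm2 (y - x).
Proof.
have r0 : 0 <= 2 / L by rewrite divr_ge0// ltW.
have [|y yx hy] := @cont2_attains_max _ (fun y => u y - L * norm2 (y - x)) x (2 / L) r0.
  move=> y _; apply: cont2B => //; apply: cont2M; first exact: cont2_cst.
  exact: cont2_norm2.
exists y; split=> // y'; have [|h] := leP (norm2 (y' - x)) (2 / L); first exact: hy.
have := hy x; rewrite subrr norm2_0 mulr0 subr0 => /(_ r0); apply: le_trans.
have : 2 < L * norm2 (y' - x) by rewrite -ltr_pdivrMl// mulrC.
by have := ub x; have := ub y'; lra.
Qed.

Definition argsup x := projT1 (cid (supconv_argmax x)).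
Definition supconv x := u (argsup x) - L * norm2 (argsup x - x).

Lemma argsup_near x : norm2 (argsup x - x) <= 2 / L.
Proof. by rewrite /argsup; case: cid => y [] /=. Qed.

Lemma supconv_ge x y : u y - L * norm2 (y - x) <= supconv x.
Proof. by rewrite /supconv /argsup; case: cid => z [] /=. Qed.

Lemma supconv_ge_fun x : u x <= supconv x.
Proof. by have := supconv_ge x x; rewrite subrr norm2_0 mulr0 subr0. Qed.

Lemma supconv_le x : supconv x <= u (argsup x).
Proof. by rewrite /supconv gerBl mulr_ge0 ?norm2_ge0// ltW. Qed.

Lemma supconv_bnd x : -1 <= supconv x <= 1.
Proof.
have /andP[h _] := ub x; have /andP[_ h'] := ub (argsup x).
by rewrite (le_trans h (supconv_ge_fun x)) (le_trans (supconv_le x) h').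
Qed.

Lemma supconv_lip x y : `|supconv x - supconv y| <= L * norm2 (x - y).
Proof.
have key a b : supconv a - supconv b <= L * norm2 (a - b).
  have := supconv_ge b (argsup a); rewrite {2}/supconv.
  have := norm2_dist (argsup a) a b; have := L0; nra.
rewrite ler_norml; apply/andP; split; last exact: key.
by have := key y x; rewrite norm2BC; lra.
Qed.

(** The translate [argsup x + z] competes in the supremum at [x + z] with an unchanged penalty. So
    increments of [supconv] at [x] are dominated by those of [u] at [argsup x], where the equation
    is available. *)
Lemma supconv_shift x z : supconv x - supconv (x + z) <= u (argsup x) - u (argsup x + z).
Proof.
have := supconv_ge (x + z) (argsup x + z); rewrite {2}/supconv.
by rewrite opprD addrACA subrr addr0; lra.
Qed.

End sup_convolution.

Section gamma.
Context {R : realType} (s : R) (s01 : 0 < s < 1).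
Let s0 : 0 < s. Proof. by case/andP : s01. Qed.
Let s1 : s < 1. Proof. by case/andP : s01. Qed.
Notation ker := (ker s).
Implicit Types (x y : R * R) (z : (R * R) * (R * R)).

Definition one_cst : R := near_cst s + far_cst s.

Lemma one_cst_ge0 : 0 <= one_cst.
Proof. by rewrite addr_ge0// ltW// ?near_cst_gt0// far_cst_gt0. Qed.

Lemma ker_one : (\int[lam]_v (Num.min 1 (norm2 v) * ker v)%:E <= one_cst%:E)%E.
Proof.
have mk := measurable_ker1 s; have k0 := ker_ge0 s.
have m1 : measurable_fun setT (fun v => chi (norm2 v < 1) * (norm2 v * ker v) : R) by mfun.
have m2 : measurable_fun setT (fun v => chi (1 <= norm2 v) * ker v : R) by mfun.
have p1 (v : R * R) : 0 <= chi (norm2 v < 1) * (norm2 v * ker v) :> R by rewrite !mulr_ge0 ?norm2_ge0.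
have p2 (v : R * R) : 0 <= chi (1 <= norm2 v) * ker v :> R by rewrite !mulr_ge0.
apply: (@le_trans _ _ (\int[lam]_v (chi (norm2 v < 1)%R * (norm2 v * ker v) + chi (1 <= norm2 v)%R * ker v)%:E)%E).
  apply: ge0_le_int; [by mfun|by mfun| |].
    by move=> v; rewrite mulr_ge0// le_min ler01 norm2_ge0.
  move=> v; have [h|h] := leP 1 (norm2 v).
    by rewrite mul0r add0r.
  by rewrite mul0r addr0 mul1r.
rewrite (ge0_intD lam m1 m2 p1 p2) EFinD.
have h1 := ker_near s01 (ltr01 : 0 < 1 :> R); have h2 := ker_far s01 (ltr01 : 0 < 1 :> R).
by move: h1 h2; rewrite !powR1 !mulr1 => h1 h2; exact: leeD.
Qed.

Lemma lam2_swap (f : (R * R) * (R * R) -> \bar R) : measurable_fun setT f -> (forall z, (0 <= f z)%E) ->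
  (\int[lam2]_z f (z.2, z.1) = \int[lam2]_z f z)%E.
Proof.
move=> mf f0; rewrite (lam2_tonelliC mf f0); apply: lam2_tonelli => //.
by apply: (measurableT_comp mf); exact: measurable_swap.
Qed.

Lemma lam2_iter (f : (R * R) * (R * R) -> \bar R) : measurable_fun setT f -> (forall z, (0 <= f z)%E) ->
  (\int[lam2]_z f z = \int[lam]_x \int[lam]_w f (x, x + w)%R)%E.
Proof.
move=> mf f0; rewrite lam2_tonelli//; apply: eq_integral => x _.
rewrite -(lam_shift x (f := fun y => f (x, y)))//; last exact: measurable_slice.
by apply: eq_integral => w _; rewrite addrC.
Qed.

Lemma lam2_le_weight (w : R * R -> R) (f : (R * R) * (R * R) -> R) (B : R) (I : R) :
  measurable_fun setT w -> (forall x, 0 <= w x) -> measurable_fun setT f -> (forall z, 0 <= f z) ->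
  0 <= B -> (forall x, (\int[lam]_y (f (x, y))%:E <= B%:E)%E) ->
  (\int[lam]_x (w x)%:E <= I%:E)%E ->
  (\int[lam2]_z (w z.1 * f z)%:E <= (B * I)%:E)%E.
Proof.
move=> mw w0 mf f0 B0 hB hI.
rewrite lam2_tonelli; [|by mfun|by move=> z; rewrite lee_fin mulr_ge0].
apply: (@le_trans _ _ (\int[lam]_x (B * w x)%:E)%E).
  apply: ge0_le_integral => //.
  - by move=> x _; apply: int_ge0 => y; rewrite mulr_ge0.
  - apply: (@measurable_fun_fubini_tonelli_F _ _ _ _ _ lam (fun z => (w z.1 * f z)%:E)); first by mfun.
    by move=> z; rewrite lee_fin mulr_ge0.
  - by mfun.
  move=> x _ /=.
  have mfx : measurable_fun setT (fun y => f (x, y)) by exact: measurable_slice.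
  rewrite (ge0_intZ lam mfx (w0 x) (fun y => f0 _)) mulrC EFinM lee_wpmul2l ?lee_fin//.
by rewrite (ge0_intZ lam mw B0 w0) EFinM lee_wpmul2l ?lee_fin.
Qed.

Definition cutoff (r : R) x := Num.min 1 (Num.max (r + 1 - norm2 x) 0).

Lemma cutoff_ge0 r x : 0 <= cutoff r x.
Proof. by rewrite le_min ler01 le_max lexx orbT. Qed.

Lemma cutoff_le1 r x : cutoff r x <= 1. Proof. by rewrite ge_min lexx. Qed.

Lemma cutoff_eq1 r x : norm2 x <= r -> cutoff r x = 1.
Proof.
by move=> h; apply/min_l; rewrite le_max; apply/orP; left; lra.
Qed.

Lemma cutoff_eq0 r x : r + 1 <= norm2 x -> cutoff r x = 0.
Proof. by move=> h; rewrite /cutoff max_r ?min_r//; lra. Qed.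

Lemma cutoff_lip r x y : `|cutoff r x - cutoff r y| <= norm2 (y - x).
Proof.
have h : `|norm2 x - norm2 y| <= norm2 (y - x).
  rewrite ler_norml; have := norm2_dist x y 0; have := norm2_dist y x 0.
  by rewrite !subr0 (norm2BC x y) => h1 h2; apply/andP; split; lra.
apply: le_trans h; rewrite /cutoff.
have e (t : R) : Num.min 1 (Num.max t 0) = if t <= 0 then 0 else if t <= 1 then t else 1.
  case: leP => t0; first by rewrite minElt ltr10.
  by case: (leP t 1).
have key (a b : R) : Num.min 1 (Num.max a 0) - Num.min 1 (Num.max b 0) <= `|a - b|.
  have := ler_norm (a - b); have := normr_ge0 (a - b); rewrite !e.
  by case: (leP a 0) => ?; case: (leP b 0) => ?; [|case: (leP b 1) => ?
    |case: (leP a 1) => ?|case: (leP a 1) => ?; case: (leP b 1) => ?]; lra.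
have k1 := key (r + 1 - norm2 x) (r + 1 - norm2 y).
have k2 := key (r + 1 - norm2 y) (r + 1 - norm2 x).
rewrite (_ : r + 1 - norm2 x - _ = norm2 y - norm2 x) in k1; last by ring.
rewrite (_ : r + 1 - norm2 y - _ = norm2 x - norm2 y) in k2; last by ring.
by rewrite distrC in k1; rewrite ler_norml; apply/andP; split; lra.
Qed.

Lemma measurable_cutoff d (T : measurableType d) (r : R) (f : T -> R * R) :
  measurable_fun setT f -> measurable_fun setT (fun t => cutoff r (f t)).
Proof. by move=> mf; rewrite /cutoff; mfun. Qed.

Lemma lam_ball_le r : 0 <= r -> (\int[lam]_x (chi (norm2 x <= r)%R : R)%:E <= (4 * r ^+ 2)%:E)%E.
Proof.
move=> r0; pose B : set (R * R) := [set` `[- r, r]] `*` [set` `[- r, r]].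
have mB : measurable B by exact: measurableX.
have mI : measurable_fun setT (fun v : R * R => \1_B v : R) by exact: measurable_indic.
apply: (@le_trans _ _ (\int[lam]_x (\1_B x)%:E)%E).
  apply: ge0_le_int => //; first by mfun.
  move=> x; case: (leP (norm2 x) r) => [h|//]; rewrite indicE mem_set//.
  split; rewrite /= in_itv/= -ler_norml.
    exact: le_trans (le_norm2_fst x) h.
  exact: le_trans (le_norm2_snd x) h.
rewrite lam_indic// lam_box; [|lra|lra]; rewrite lee_fin.
by rewrite le_eqVlt; apply/orP; left; apply/eqP; ring.
Qed.

Lemma cutoff_int r : 0 <= r -> (\int[lam]_x (cutoff r x)%:E <= (4 * (r + 1) ^+ 2)%:E)%E.
Proof.
move=> r0; have r10 : 0 <= r + 1 by rewrite addr_ge0.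
apply: le_trans (lam_ball_le r10); apply: ge0_le_int; [by apply: measurable_cutoff; mfun|by mfun| |].
  by move=> x; exact: cutoff_ge0.
by move=> x; case: (leP (norm2 x) (r + 1)) => [_|/ltW /cutoff_eq0 -> //]; exact: cutoff_le1.
Qed.

(** The difference of cutoffs vanishes unless one point lies in the ball of radius [r + 1], and it
    is at most the minimum of [1] and the distance, against which the kernel is integrable. The area
    of the ball gives the quadratic factor. *)
Lemma cutoff_ker r : 0 <= r ->
  (\int[lam2]_z (`|cutoff r z.1 - cutoff r z.2| * ker (z.2 - z.1))%:E <= (8 * one_cst * (r + 1) ^+ 2)%:E)%E.
Proof.
move=> r0; have r10 : 0 <= r + 1 by rewrite addr_ge0.
have mk := measurable_ker1 s; have k0 := ker_ge0 s.
have mc : measurable_fun setT (cutoff r) by apply: (measurable_cutoff r (f := id)); mfun.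
pose f z : R := Num.min 1 (norm2 (z.2 - z.1)) * ker (z.2 - z.1).
have f0 z : 0 <= f z by rewrite mulr_ge0// le_min ler01 norm2_ge0.
have mf : measurable_fun setT f by rewrite /f; mfun.
pose w x : R := chi (norm2 x <= r + 1).
have mw : measurable_fun setT w by rewrite /w; mfun.
have w0 x : 0 <= w x by rewrite /w.
have fB x : (\int[lam]_y (f (x, y))%:E <= one_cst%:E)%E.
  rewrite -(lam_shift x (f := fun y => (f (x, y))%:E)); [|by mfun|by move=> y; rewrite lee_fin].
  by under eq_integral do rewrite /f /= addrK; exact: ker_one.
have hJ := lam2_le_weight mw w0 mf f0 one_cst_ge0 fB (lam_ball_le r10).
have m1 : measurable_fun setT (fun z => w z.1 * f z) by mfun.
have m2 : measurable_fun setT (fun z => w z.2 * f z) by mfun.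
have p1 z : 0 <= w z.1 * f z by rewrite mulr_ge0.
have p2 z : 0 <= w z.2 * f z by rewrite mulr_ge0.
apply: (@le_trans _ _ (\int[lam2]_z (w z.1 * f z + w z.2 * f z)%:E)%E).
  apply: ge0_le_int; [by mfun|by mfun|by move=> z; rewrite mulr_ge0|].
  move=> z; rewrite -mulrDl /f mulrA ler_wpM2r//.
  have h1 : `|cutoff r z.1 - cutoff r z.2| <= Num.min 1 (norm2 (z.2 - z.1)).
    rewrite le_min cutoff_lip andbT ler_norml.
    have := cutoff_ge0 r z.1; have := cutoff_le1 r z.1; have := cutoff_ge0 r z.2; have := cutoff_le1 r z.2.
    by move=> *; apply/andP; split; lra.
  have := f0 z; have := norm2_ge0 (z.2 - z.1) => n0 _.
  have mi0 : 0 <= Num.min 1 (norm2 (z.2 - z.1)) by rewrite le_min ler01.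
  rewrite /w; case: (leP (norm2 z.1) (r + 1)) => [_|/ltW /cutoff_eq0 h].
    by apply: (le_trans h1); rewrite ler_peMl// lerDl.
  case: (leP (norm2 z.2) (r + 1)) => [_|/ltW /cutoff_eq0 h']; first by rewrite add0r mul1r.
  by rewrite h h' subrr normr0 addr0 mul0r.
rewrite (ge0_intD lam2 m1 m2 p1 p2).
have -> : (\int[lam2]_z (w z.2 * f z)%:E = \int[lam2]_z (w z.1 * f z)%:E)%E.
  rewrite -(lam2_swap (f := fun z => (w z.1 * f z)%:E)); [|by mfun|by move=> z; rewrite lee_fin].
  by apply: eq_integral => z _; rewrite /f /= -(norm2N (z.1 - z.2)) -(kerN s (z.1 - z.2)) opprB.
apply: (le_trans (leeD hJ hJ)); rewrite -EFinD lee_fin.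
by rewrite le_eqVlt; apply/orP; left; apply/eqP; ring.
Qed.

End gamma.

Lemma measurable_slice2 {R : realType} (f : (R * R) * (R * R) -> R) :
  measurable_fun setT f -> forall x : R * R, measurable_fun setT (fun y => f (x, y)).
Proof. by move=> mf x; exact: measurable_slice. Qed.

Lemma measurable_shift {R : realType} (f : R * R -> R) :
  measurable_fun setT f -> forall x : R * R, measurable_fun setT (fun y : R * R => f (y + x)).
Proof. by move=> mf x; apply: (measurableT_comp mf); mfun. Qed.

Lemma min1_scale {R : realType} (L n : R) : 1 <= L -> 0 <= n ->
  Num.min 1 (L * n) <= L * Num.min 1 n.
Proof. by move=> L1 n0; case: (leP 1 (L * n)); case: (leP 1 n); nra. Qed.

Section gamma_bound.
Context {R : realType} (s : R) (s01 : 0 < s < 1).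
Let s0 : 0 < s. Proof. by case/andP : s01. Qed.
Let s1 : s < 1. Proof. by case/andP : s01. Qed.
Notation ker := (ker s).
Implicit Types (x y : R * R) (z : (R * R) * (R * R)).

Definition gamma_cst : R := 16 + 32 * one_cst s.

Lemma gamma_cst_ge0 : 0 <= gamma_cst.
Proof. by rewrite addr_ge0// mulr_ge0// one_cst_ge0. Qed.

Lemma subsol_scale (v : R * R -> R) y (B c : R) (a b : R * R -> R) :
  subsol s v y B -> 0 <= B -> 0 <= c -> measurable_fun setT a -> measurable_fun setT b ->
  (forall w, 0 <= a w) -> (forall w, 0 <= b w) ->
  (forall w, b w <= c * ((v y - v (y + w)) * ker w) + a w) ->
  (\int[lam]_w (b w)%:E <= (c * B)%:E + \int[lam]_w (a w)%:E)%E.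
Proof.
move=> hv B0 c0 ma mb a0 b0 hab; move: c0; rewrite le_eqVlt => /orP[/eqP c0|c0].
  rewrite -c0 mul0r add0e; apply: ge0_le_int => // w.
  by have := hab w; rewrite -c0 mul0r add0r.
have ci0 : 0 <= c^-1 by rewrite invr_ge0 ltW.
have := hv (fun w => c^-1 * a w) (fun w => c^-1 * b w) ltac:(by mfun) ltac:(by mfun)
  ltac:(by move=> w; rewrite mulr_ge0) ltac:(by move=> w; rewrite mulr_ge0).
rewrite (ge0_intZ lam ma ci0 a0) (ge0_intZ lam mb ci0 b0) => h.
have {}h : (c%:E * (c^-1%:E * \int[lam]_w (b w)%:E) <=
    c%:E * (B%:E + c^-1%:E * \int[lam]_w (a w)%:E))%E.
  rewrite lee_wpmul2l ?lee_fin ?(ltW c0)//; apply: h => w.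
  by rewrite -(ler_pM2l c0) mulrDr !mulVKf ?gt_eqF.
have q0 : (0 <= c^-1%:E * \int[lam]_w (a w)%:E)%E by rewrite mule_ge0 ?lee_fin// int_ge0.
have B0' : (0 <= B%:E)%E by rewrite lee_fin.
move: h; rewrite (ge0_muleDr _ B0' q0).
by rewrite !muleA -!EFinM divff ?gt_eqF// !mul1e.
Qed.

(* The carre du champ identity [(a - b)^2 = 2 a (a - b) - (a^2 - b^2)], with the last term
   integrated by parts against the cutoff. *)
Lemma gamma_lip (G : R * R -> R) (L r : R) : 1 <= L -> 0 <= r -> measurable_fun setT G ->
  (forall x, 0 <= G x <= 2) -> (forall x y, `|G x - G y| <= L * norm2 (y - x)) ->
  (forall x, subsol s G x 1) ->
  (\int[lam2]_z (cutoff r z.1 * ((G z.1 - G z.2) ^+ 2 * ker (z.2 - z.1)))%:E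
     <= (gamma_cst * (r + 1) ^+ 2)%:E)%E.
Proof.
move=> L1 r0 mG G2 GL Gsub.
have mk := measurable_ker1 s; have k0 := ker_ge0 s.
have mc : measurable_fun setT (cutoff r) by apply: (measurable_cutoff r (f := id)); mfun.
have c0 := cutoff_ge0 r; have c1 := cutoff_le1 r.
pose h x := G x ^+ 2.
have mh : measurable_fun setT h by rewrite /h; mfun.
pose f1 z := (G z.1 - G z.2) ^+ 2 * ker (z.2 - z.1).
pose f2 z := Num.max (h z.1 - h z.2) 0 * ker (z.2 - z.1).
pose f3 z := Num.max (h z.2 - h z.1) 0 * ker (z.2 - z.1).
have mf1 : measurable_fun setT f1 by rewrite /f1; mfun.
have mf2 : measurable_fun setT f2 by rewrite /f2; mfun.
have mf3 : measurable_fun setT f3 by rewrite /f3; mfun.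
have f10 z : 0 <= f1 z by rewrite mulr_ge0 ?sqr_ge0.
have f20 z : 0 <= f2 z by rewrite mulr_ge0// le_max lexx orbT.
have f30 z : 0 <= f3 z by rewrite mulr_ge0// le_max lexx orbT.
(* The inequality at [x] is multiplied by [2 * G x], which must be nonnegative; hence the range
   [[0, 2]] of [G]. The difference of squares is split into its positive part [f2] and negative part
   [f3], to stay among nonnegative integrands. *)
have hx x : (\int[lam]_y (cutoff r x * (f1 (x, y) + f2 (x, y)))%:E <=
    (4 * cutoff r x)%:E + \int[lam]_y (cutoff r x * f3 (x, y))%:E)%E.
  have mx : measurable_fun setT (fun y => f1 (x, y) + f2 (x, y)).
    exact: (measurable_funD (measurable_slice2 mf1 x) (measurable_slice2 mf2 x)).
  have mx3 : measurable_fun setT (fun y => f3 (x, y)) := (measurable_slice2 mf3 x).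
  rewrite (ge0_intZ lam mx (c0 x) (fun y => addr_ge0 (f10 _) (f20 _))).
  rewrite (ge0_intZ lam mx3 (c0 x) (fun y => f30 _)).
  apply: (@le_trans _ _ ((cutoff r x)%:E * (4%:E + \int[lam]_y (f3 (x, y))%:E))%E); last first.
    rewrite ge0_muleDr ?lee_fin//; last by apply: int_ge0.
    by rewrite -EFinM mulrC.
  rewrite lee_wpmul2l ?lee_fin//.
  have /andP[G0 G2x] := G2 x.
  apply: (@le_trans _ _ ((2 * G x * 1)%:E + \int[lam]_y (f3 (x, y))%:E)%E); last first.
    by rewrite leeD2r// lee_fin; lra.
  have mxE : measurable_fun setT (fun y => (f1 (x, y) + f2 (x, y))%:E).
    by apply/measurable_EFinP.
  have mx3E : measurable_fun setT (fun y => (f3 (x, y))%:E) by apply/measurable_EFinP.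
  have p1 y : (0 <= (f1 (x, y) + f2 (x, y))%:E)%E by rewrite lee_fin addr_ge0.
  have p3 y : (0 <= (f3 (x, y))%:E)%E by rewrite lee_fin.
  rewrite -(lam_shift x mxE p1) -(lam_shift x mx3E p3).
  have ma := measurable_shift mx3 x; have mb := measurable_shift mx x.
  have pa (w : R * R) : 0 <= f3 (x, w + x) by [].
  have pb (w : R * R) : 0 <= f1 (x, w + x) + f2 (x, w + x) by rewrite addr_ge0.
  have cx : 0 <= 2 * G x by rewrite mulr_ge0.
  apply: (subsol_scale (Gsub x) ler01 cx ma mb pa pb).
  move=> w; rewrite /f1 /f2 /f3 /= addrK (addrC w).
  rewrite -mulrDl mulrA -mulrDl ler_wpM2r// /h.
  by case: (leP (G x ^+ 2 - G (x + w) ^+ 2) 0) => h1;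
    case: (leP (G (x + w) ^+ 2 - G x ^+ 2) 0) => h2; lra.
have m12 : measurable_fun setT (fun z => (cutoff r z.1 * (f1 z + f2 z))%:E) by mfun.
have m3 : measurable_fun setT (fun z => (cutoff r z.1 * f3 z)%:E) by mfun.
have p12 z : (0 <= (cutoff r z.1 * (f1 z + f2 z))%:E)%E by rewrite lee_fin mulr_ge0// addr_ge0.
have p3 z : (0 <= (cutoff r z.1 * f3 z)%:E)%E by rewrite lee_fin mulr_ge0.
have step1 : (\int[lam2]_z (cutoff r z.1 * (f1 z + f2 z))%:E <=
   (16 * (r + 1) ^+ 2)%:E + \int[lam2]_z (cutoff r z.1 * f3 z)%:E)%E.
  rewrite (lam2_tonelli m12 p12) (lam2_tonelli m3 p3).
  have mF3 := @measurable_fun_fubini_tonelli_F _ _ _ _ _ lam _ m3 p3.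
  apply: (@le_trans _ _ (\int[lam]_x ((4 * cutoff r x)%:E + \int[lam]_y (cutoff r x * f3 (x, y))%:E))%E).
    apply: ge0_le_integral => //.
    - by move=> x _; apply: integral_ge0.
    - exact: (@measurable_fun_fubini_tonelli_F _ _ _ _ _ lam _ m12 p12).
    - by apply: emeasurable_funD => //; mfun.
    - by move=> x _; exact: hx.
  have m4 : measurable_fun setT (fun x => (4 * cutoff r x)%:E) by mfun.
  have p4 x : setT x -> (0 <= (4 * cutoff r x)%:E)%E by move=> _; rewrite lee_fin mulr_ge0.
  have p5 x : setT x -> (0 <= \int[lam]_y (cutoff r x * f3 (x, y))%:E)%E.
    by move=> _; apply: int_ge0 => y; rewrite mulr_ge0.
  rewrite [leLHS](@ge0_integralD _ _ R lam _ measurableT _ _ p4 m4 p5 mF3).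
  rewrite leeD2r// (ge0_intZ lam mc)//.
  apply: (@le_trans _ _ (4%:E * (4 * (r + 1) ^+ 2)%:E)%E).
    by rewrite lee_wpmul2l ?lee_fin// cutoff_int.
  by rewrite -EFinM lee_fin mulrA; lra.
have n0 x y := norm2_ge0 (y - x).
have hdiff x y : `|h x - h y| <= 4 * Num.min 1 (L * norm2 (y - x)).
  have /andP[gx gx'] := G2 x; have /andP[gy gy'] := G2 y.
  have e : `|h x - h y| = `|G x - G y| * (G x + G y).
    by rewrite /h subr_sqr normrM (ger0_norm (addr_ge0 gx gy)).
  have a0 := normr_ge0 (G x - G y).
  have a2 : `|G x - G y| <= 2 by rewrite ler_norml; lra.
  have h4 : `|h x - h y| <= 4 by rewrite /h ler_norml; apply/andP; split; nra.
  case: (leP 1 (L * norm2 (y - x))) => _; first by rewrite mulr1.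
  by rewrite e; have := GL x y; nra.
have f2B x : (\int[lam]_y (f2 (x, y))%:E <= (4 * L * one_cst s)%:E)%E.
  have mf2r := measurable_slice2 mf2 x.
  have mf2x : measurable_fun setT (fun y => (f2 (x, y))%:E) by apply/measurable_EFinP.
  have pf2x y : (0 <= (f2 (x, y))%:E)%E by rewrite lee_fin.
  rewrite -(lam_shift x mf2x pf2x).
  have mm : measurable_fun setT (fun w => Num.min 1 (norm2 w) * ker w : R) by mfun.
  have pm (w : R * R) : 0 <= Num.min 1 (norm2 w) * ker w by rewrite mulr_ge0// le_min ler01 norm2_ge0.
  have L40 : 0 <= 4 * L by rewrite mulr_ge0//; lra.
  apply: (@le_trans _ _ (\int[lam]_w (4 * L * (Num.min 1 (norm2 w) * ker w))%:E)%E).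
    apply: (ge0_le_int lam (measurable_shift mf2r x)); [by mfun|by move=> w; exact: f20|].
    move=> w; rewrite /f2 /= addrK mulrA ler_wpM2r//.
    have := hdiff x (w + x); rewrite addrK => hd.
    apply: (@le_trans _ _ `|h x - h (w + x)|).
      by rewrite ge_max normr_ge0 andbT ler_norm.
    by apply: (le_trans hd); rewrite -mulrA ler_wpM2l// min1_scale// norm2_ge0.
  by rewrite (ge0_intZ lam mm L40 pm) [leRHS]EFinM lee_wpmul2l ?lee_fin//; exact: ker_one.
have L0 : 0 <= 4 * L * one_cst s by rewrite !mulr_ge0 ?one_cst_ge0//; lra.
(* [L] enters only through this finiteness: the term must be finite in order to be cancelled at the
   end, and its size is then forgotten. *)
have F2fin : (\int[lam2]_z (cutoff r z.1 * f2 z)%:E \is a fin_num)%E.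
  rewrite ge0_fin_numE; last by apply: int_ge0 => z; rewrite mulr_ge0.
  by apply: (le_lt_trans (lam2_le_weight mc c0 mf2 f20 L0 f2B (cutoff_int r0))); rewrite ltry.
have mcf2 : measurable_fun setT (fun z => cutoff r z.1 * f2 z) by mfun.
have mcf1 : measurable_fun setT (fun z => cutoff r z.1 * f1 z) by mfun.
have pcf2 z : 0 <= cutoff r z.1 * f2 z by rewrite mulr_ge0.
have pcf1 z : 0 <= cutoff r z.1 * f1 z by rewrite mulr_ge0.
pose q z := `|cutoff r z.1 - cutoff r z.2| * ker (z.2 - z.1).
have mq : measurable_fun setT q by rewrite /q; mfun.
have q0 z : 0 <= q z by rewrite mulr_ge0.
(* Exchanging the two points turns [f3] into [f2] with the cutoff taken at the other point, so only
   a difference of cutoffs remains, controlled by [cutoff_ker]. *)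
have step2 : (\int[lam2]_z (cutoff r z.1 * f3 z)%:E <=
    \int[lam2]_z (cutoff r z.1 * f2 z)%:E + (32 * one_cst s * (r + 1) ^+ 2)%:E)%E.
  rewrite -(lam2_swap m3 p3).
  have mcf3s : measurable_fun setT (fun z => cutoff r z.2 * f3 (z.2, z.1)).
    by rewrite /f3; mfun.
  have m4q : measurable_fun setT (fun z => 4 * q z) by mfun.
  have p4q z : 0 <= 4 * q z by rewrite mulr_ge0.
  apply: (@le_trans _ _ (\int[lam2]_z (cutoff r z.1 * f2 z + 4 * q z)%:E)%E).
    apply: (ge0_le_int lam2 mcf3s (measurable_funD mcf2 m4q) (fun z => mulr_ge0 (c0 _) (f30 _))).
    move=> z; have -> : f3 (z.2, z.1) = f2 z.
      by rewrite /f3 /f2 /= -(kerN s (z.1 - z.2)) opprB.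
    rewrite /= -lerBlDl -mulrBl.
    apply: (@le_trans _ _ (`|cutoff r z.1 - cutoff r z.2| * f2 z)).
      by rewrite ler_wpM2r// distrC ler_norm.
    rewrite /q /f2 !mulrA ler_wpM2r// mulrC ler_wpM2r//.
    rewrite ge_max; apply/andP; split => //.
    apply: le_trans (ler_norm _) _; apply: (le_trans (hdiff _ _)).
    by rewrite ler_piMr// ge_min lexx.
  rewrite (ge0_intD lam2 mcf2 m4q pcf2 p4q) leeD2l//.
  rewrite (ge0_intZ lam2 mq _ q0)//.
  apply: (@le_trans _ _ (4%:E * (8 * one_cst s * (r + 1) ^+ 2)%:E)%E).
    by rewrite lee_wpmul2l ?lee_fin//; exact: cutoff_ker.
  by rewrite -EFinM lee_fin; lra.
have step3 : (\int[lam2]_z (cutoff r z.1 * (f1 z + f2 z))%:E =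
    \int[lam2]_z (cutoff r z.1 * f1 z)%:E + \int[lam2]_z (cutoff r z.1 * f2 z)%:E)%E.
  rewrite -(ge0_intD lam2 mcf1 mcf2 pcf1 pcf2).
  by apply: eq_integral => z _; rewrite mulrDr.
rewrite step3 in step1; move: step1 step2 F2fin.
rewrite -/f1; set A := (X in (X + _ <= _)%E); set B := (X in (_ + X <= _)%E).
move=> h1 h2 Bfin; rewrite -(leeD2rE _ _ Bfin).
apply: (le_trans h1); apply: (le_trans (leeD (lexx _) h2)).
rewrite addeCA [leRHS]addeC leeD2l// -EFinD lee_fin /gamma_cst.
by rewrite le_eqVlt; apply/orP; left; apply/eqP; ring.
Qed.

End gamma_bound.

Section gamma_bound_sol.
Context {R : realType} (s : R) (s01 : 0 < s < 1).
Let s0 : 0 < s. Proof. by case/andP : s01. Qed.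
Let s1 : s < 1. Proof. by case/andP : s01. Qed.
Notation ker := (ker s).
Implicit Types (x y : R * R) (z : (R * R) * (R * R)).
Variables (u : R * R -> R) (mu : measurable_fun setT u) (hu : sol s u).

(** [gamma_lip] applies to the sup-convolutions raised by [1] into [[0, 2]]; they are subsolutions
    with bound [1] because [t - t ^+ 3 <= 1] on [[-1, 1]]. The constant is independent of the
    Lipschitz constant, so Fatou's lemma carries the bound over to [u]. *)
Lemma gamma_bound (r : R) : 0 <= r ->
  (\int[lam2]_z (cutoff r z.1 * ((u z.1 - u z.2) ^+ 2 * ker (z.2 - z.1)))%:E
     <= (gamma_cst s * (r + 1) ^+ 2)%:E)%E.
Proof.
move=> r0; have cu := sol_continuous s01 mu hu; have u1 := sol_bounded s01 mu hu.
have L0 k : 0 < k.+1%:R :> R by rewrite ltr0Sn.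
pose S k x := supconv cu u1 (L0 k) x.
have mS k : measurable_fun setT (S k).
  by apply: cont2_measurable => x; apply: (@cont2_lip _ k.+1%:R) => y; exact: supconv_lip.
have mk := measurable_ker1 s; have k0 := ker_ge0 s.
have mc : measurable_fun setT (cutoff r) by apply: (measurable_cutoff r (f := id)); mfun.
have mh (v : R * R -> R) : measurable_fun setT v ->
    measurable_fun setT (fun z => cutoff r z.1 * ((v z.1 - v z.2) ^+ 2 * ker (z.2 - z.1))).
  by move=> mv; mfun.
have ph (v : R * R -> R) z : 0 <= cutoff r z.1 * ((v z.1 - v z.2) ^+ 2 * ker (z.2 - z.1)).
  by rewrite mulr_ge0 ?cutoff_ge0// mulr_ge0 ?sqr_ge0.
have Scvg x : (fun k => S k x) @ \oo --> u x.
  have hA : (fun k => u (argsup cu u1 (L0 k) x)) @ \oo --> u x.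
    apply: (@seq_cvg2 _ u (fun k => argsup cu u1 (L0 k) x) x (u x)).
      apply: (@squeeze_cvgr _ _ _ _ (fun=> 0) (fun k => 2 * k.+1%:R^-1)).
      - by apply: nearW => k; rewrite norm2_ge0 (argsup_near cu u1 (L0 k) x).
      - exact: cvg_cst.
      - rewrite -[X in _ --> X](mulr0 2); apply: cvgM; first exact: cvg_cst.
        exact: cvg_harmonic.
    move=> e e0; have [d d0 hd] := cu x e e0.
    by exists d => // k; exact: hd.
  apply: (@squeeze_cvgr _ _ _ _ (fun=> u x) (fun k => u (argsup cu u1 (L0 k) x))) => //.
  - by apply: nearW => k; rewrite supconv_ge_fun supconv_le.
  - exact: cvg_cst.
apply: (@fatou_real _ _ _ lam2
   (fun k z => cutoff r z.1 * ((S k z.1 - S k z.2) ^+ 2 * ker (z.2 - z.1)))).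
- by move=> k; exact: mh.
- exact: mh.
- by move=> k z; exact: ph.
- by move=> z; exact: ph.
- move=> z _; apply: cvgM; first exact: cvg_cst.
  apply: cvgM; last exact: cvg_cst.
  by rewrite !expr2; apply: cvgM; apply: cvgB; exact: Scvg.
move=> k; pose G x := S k x + 1.
have GB x y : G x - G y = S k x - S k y by rewrite /G; ring.
have -> : (\int[lam2]_z (cutoff r z.1 * ((S k z.1 - S k z.2) ^+ 2 * ker (z.2 - z.1)))%:E
   = \int[lam2]_z (cutoff r z.1 * ((G z.1 - G z.2) ^+ 2 * ker (z.2 - z.1)))%:E)%E.
  by apply: eq_integral => z _; rewrite GB.
apply: (@gamma_lip _ s s01 G k.+1%:R r) => //.
- by rewrite ler1n.
- by rewrite /G; have := mS k => mSk; mfun.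
- by move=> x; rewrite /G; have := supconv_bnd cu u1 (L0 k) x; rewrite /S; lra.
- move=> x y; rewrite GB norm2BC; exact: supconv_lip.
move=> x g h mg mh' g0 h0 hgh; have [ia ea] := hu (argsup cu u1 (L0 k) x).
apply: (le_trans (integrable_split ia ea mg mh' g0 h0 _)).
  move=> w; apply: (le_trans (hgh w)); rewrite lerD2r ler_wpM2r//.
  by rewrite GB; exact: supconv_shift.
rewrite leeD2r// lee_fin.
have := u1 (argsup cu u1 (L0 k) x); rewrite ler_norml.
move: (u _) => t /andP[h1 h2]; have h3 : 0 <= 1 - t ^+ 2 by nra.
by have [t0|t0] := leP 0 t; nra.
Qed.

End gamma_bound_sol.

(** * The energy in a centred ball *)

Section energy.
Context {R : realType} (s : R) (s01 : 0 < s < 1).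
Let s0 : 0 < s. Proof. by case/andP : s01. Qed.
Let s1 : s < 1. Proof. by case/andP : s01. Qed.
Notation ker := (ker s).
Implicit Types (x y : R * R) (z : (R * R) * (R * R)) (u : R * R -> R).

(** The indicator of the pairs with at least one point in the ball, that is of the domain of [Edir].
    Written as a maximum so that [mfun] can treat it; [inrE] gives the Boolean form. *)
Definition inr (r : R) z : R := Num.max (chi (norm2 z.1 < r)) (chi (norm2 z.2 < r)).
Lemma inrE r z : inr r z = chi ((norm2 z.1 < r) || (norm2 z.2 < r)).
Proof. by rewrite /inr; case: (_ < _); case: (_ < _); rewrite /= maxEle ?lexx ?ler01 ?ler10. Qed.

Definition dens u z := (u z.1 - u z.2) ^+ 2 * ker (z.2 - z.1).
Definition Dr r u : \bar R := (\int[lam2]_z (inr r z * dens u z)%:E)%E.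
Definition Wr r u : \bar R := (\int[lam]_x (chi (norm2 x < r)%R * (1 - u x ^+ 2) ^+ 2)%:E)%E.

Lemma EnergyE u r : Energy s u (eball 0 r) = (Dr r u + Wr r u)%E.
Proof.
rewrite /Energy EdirE; congr (_ + _)%E.
  rewrite integral_mkcond; apply: eq_integral => z _; rewrite patchE /inr /dens.
  rewrite -/(inr r z) inrE /ker norm2BC.
  have nB x : r <= norm2 x -> (~` eball 0 r) x.
    by move=> h; rewrite /eball /= subr0; apply/negP; rewrite -leNgt.
  have Bx x : norm2 x < r -> ~ (~` eball 0 r) x.
    by move=> h; apply; rewrite /eball /= subr0.
  case: ifPn => [/set_mem nz|/negP nz].
    have -> : (norm2 z.1 < r) || (norm2 z.2 < r).
      apply/contraT; rewrite negb_or -!leNgt => /andP[h1 h2].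
      by exfalso; apply: nz; split; apply: nB.
    by rewrite mul1r.
  have -> : (norm2 z.1 < r) || (norm2 z.2 < r) = false; last by rewrite mul0r.
  apply/negP => /orP[h|h]; apply: nz; apply/mem_set.
    by move=> [/(Bx _ h)].
  by move=> [_ /(Bx _ h)].
rewrite /Wr integral_mkcond; apply: eq_integral => x _; rewrite patchE.
case: ifPn => [/set_mem|/negP nz]; case: (ltP (norm2 x) r) => h; rewrite ?mul1r ?mul0r//.
  by rewrite /eball /= subr0 ltNge h.
by exfalso; apply: nz; apply/mem_set; rewrite /eball /= subr0.
Qed.

Lemma inr_ge0 r z : 0 <= inr r z.
Proof. by rewrite /inr le_max; apply/orP; left. Qed.

Lemma measurable_inr r : measurable_fun setT (inr r).
Proof. by rewrite /inr; mfun. Qed.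

Lemma dens_ge0 u z : 0 <= dens u z.
Proof. by rewrite /dens mulr_ge0 ?sqr_ge0// ker_ge0. Qed.

Lemma measurable_dens u : measurable_fun setT u -> measurable_fun setT (dens u).
Proof. by move=> mu; have mk := measurable_ker1 s; rewrite /dens; mfun. Qed.

Lemma densC u z : dens u (z.2, z.1) = dens u z.
Proof. by rewrite /dens /= -(kerN s (z.1 - z.2)) opprB -sqrrN opprB. Qed.

Lemma chi_cutoff r x : chi (norm2 x < r) <= cutoff r x :> R.
Proof. by case: ltP => [/ltW/cutoff_eq1 ->//|_]; exact: cutoff_ge0. Qed.

Lemma inr_le r z : inr r z <= cutoff r z.1 + cutoff r z.2.
Proof.
rewrite /inr ge_max; apply/andP; split; apply: (le_trans (chi_cutoff _ _)).
  by rewrite lerDl cutoff_ge0.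
by rewrite lerDr cutoff_ge0.
Qed.

Lemma Dr_fin u r : measurable_fun setT u -> sol s u -> 0 <= r -> (Dr r u < +oo)%E.
Proof.
move=> mu hu r0; have md := measurable_dens mu; have mi := measurable_inr r.
have d0 := dens_ge0 u.
have mc : measurable_fun setT (cutoff r) by apply: (measurable_cutoff r (f := id)); mfun.
have m1 : measurable_fun setT (fun z => cutoff r z.1 * dens u z) by mfun.
have m2 : measurable_fun setT (fun z => cutoff r z.2 * dens u z) by mfun.
have p1 z : 0 <= cutoff r z.1 * dens u z by rewrite mulr_ge0// cutoff_ge0.
have p2 z : 0 <= cutoff r z.2 * dens u z by rewrite mulr_ge0// cutoff_ge0.
have G := gamma_bound s01 mu hu r0.
have m1E : measurable_fun setT (fun z => (cutoff r z.1 * dens u z)%:E) by apply/measurable_EFinP.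
have sw : (\int[lam2]_z (cutoff r z.2 * dens u z)%:E = \int[lam2]_z (cutoff r z.1 * dens u z)%:E)%E.
  rewrite -(lam2_swap m1E) => [|z]; last by rewrite lee_fin.
  by apply: eq_integral => z _; rewrite densC.
apply: (@le_lt_trans _ _ (\int[lam2]_z (cutoff r z.1 * dens u z + cutoff r z.2 * dens u z)%:E)%E).
  apply: (ge0_le_int lam2); [by mfun|by mfun|by move=> z; rewrite mulr_ge0// inr_ge0|].
  by move=> z; rewrite -mulrDl ler_wpM2r// inr_le.
rewrite (ge0_intD lam2 m1 m2 p1 p2) sw.
by apply: (le_lt_trans (leeD G G)); rewrite -EFinD ltry.
Qed.

End energy.

(** * Functions monotone along every translation *)

Section one_dimensional.
Context {R : realType}.
Implicit Types (x y h : R * R) (t c : R).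

(** For [t] from [-1] to [1], an arc from [(0, - c)] to [(0, c)] that avoids the origin when [c] is
    nonzero: a half circle without trigonometry. It is linear in [c], so for fixed [t] it describes
    a line through the origin. *)
Definition parab (c t : R) : R * R := (c * (1 - t ^+ 2), c * t).

Lemma parab_lip c t t' : `|t| <= 1 -> `|t'| <= 1 ->
  norm2 (parab c t' - parab c t) <= `|c| * (3 * `|t' - t|).
Proof.
move=> t1 t1'; apply: (le_trans (norm2_le _)); rewrite /= -!mulrBr !normrM.
have -> : 1 - t' ^+ 2 - (1 - t ^+ 2) = - ((t' - t) * (t' + t)) by ring.
rewrite normrN normrM -mulrDr ler_wpM2l//.
have := ler_normD t' t; have := normr_ge0 (t' - t); nra.
Qed.

Section closed_total.
Variable P : R * R -> Prop.
Hypothesis Pcl : forall h, (forall e, 0 < e -> exists2 h', norm2 (h' - h) < e & P h') -> P h.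

Lemma parab_closed c t : `|t| <= 1 ->
  (forall e, 0 < e -> exists t', [/\ `|t'| <= 1, `|t' - t| < e & P (parab c t')]) -> P (parab c t).
Proof.
move=> t1 ht; apply: Pcl => e e0; have d0 : 0 < e / (3 * `|c| + 1).
  by rewrite divr_gt0// ltr_wpDl// mulr_ge0.
have [t' [t1' tt' Pt']] := ht _ d0; exists (parab c t') => //.
apply: (le_lt_trans (parab_lip c t1 t1')); move: tt'.
rewrite ltr_pdivlMr; last by rewrite ltr_wpDl// mulr_ge0.
have := normr_ge0 (t' - t); have := normr_ge0 c; nra.
Qed.

End closed_total.

(* The path [parab c] joins two opposite points, so it meets both [P] and [- P]. *)
Lemma closed_total_sym (P : R * R -> Prop) c :
  (forall h, (forall e, 0 < e -> exists2 h', norm2 (h' - h) < e & P h') -> P h) ->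
  (forall h, P h \/ P (- h)) -> P (parab c 1) ->
  exists t, [/\ `|t| <= 1, P (parab c t) & P (- parab c t)].
Proof.
move=> Pcl Pt P1.
pose Q h := P (- h).
have Qcl h : (forall e, 0 < e -> exists2 h', norm2 (h' - h) < e & Q h') -> Q h.
  move=> hh; apply: Pcl => e /hh[h' h1 h2]; exists (- h') => //.
  by rewrite -opprD norm2N.
pose T := [set t : R | `|t| <= 1 /\ Q (parab c t)].
have Tm1 : T (- 1).
  split; first by rewrite normrN1.
  suff e : - parab c (- 1) = parab c 1 by rewrite /Q e.
  by rewrite /parab; congr pair; rewrite /=; ring.
have Tub : ubound T 1 by move=> t [h _]; apply: le_trans h; exact: ler_norm.
have Ts : has_sup T by split; [exists (- 1)|exists 1].
have s1 : `|sup T| <= 1.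
  rewrite ler_norml; apply/andP; split; last by apply: ge_sup => //; exists (- 1).
  by apply: ub_le_sup => //; exists 1.
have QT : Q (parab c (sup T)).
  apply: (parab_closed Qcl s1) => e e0; have [t Tt st] := sup_adherent e0 Ts.
  exists t; case: (Tt) => h1 h2; split => //.
  have : t <= sup T by apply: ub_le_sup => //; exists 1.
  by move=> h; rewrite distrC ger0_norm ?subr_ge0//; lra.
have [e1|n1] := eqVneq (sup T) 1.
  by exists 1; split; [rewrite normr1|exact: P1|rewrite -e1].
exists (sup T); split => //.
apply: (parab_closed Pcl s1) => e e0.
have sl : sup T < 1 by move: s1; rewrite ler_norml lt_neqAle n1 => /andP[].
have sg : -1 <= sup T by move: s1; rewrite ler_norml => /andP[].
pose d := Num.min (e / 2) (1 - sup T).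
have d0 : 0 < d by rewrite lt_min divr_gt0//= subr_gt0.
have d1 : d <= 1 - sup T by rewrite ge_min lexx orbT.
have de : d <= e / 2 by rewrite ge_min lexx.
have t1 : `|sup T + d| <= 1 by rewrite ler_norml; apply/andP; split; lra.
exists (sup T + d); split => //.
  by rewrite addrAC subrr add0r gtr0_norm//; lra.
have [//|Qt] := Pt (parab c (sup T + d)).
have : sup T + d <= sup T by apply: ub_le_sup; [exists 1|split].
by lra.
Qed.

(** Each scale [2^-1 ^+ k] carries a period on its arc, with parameter [tk k]. Integer multiples
    bring it to all coarser scales, so a cluster point [t] of the parameters yields periods
    [parab (2^-1 ^+ k) t] of every scale on one line; their multiples are dense in it. *)
Lemma monotone_one_dim (u : R * R -> R) : (forall x, cont2 u x) ->
  (forall t k, (forall x, u x <= u (x + (t, t * k))) \/ (forall x, u (x + (t, t * k)) <= u x)) ->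
  exists (ubar : R -> R) (w : R * R), norm2 w = 1 /\ forall x, u x = ubar (dot2 w x).
Proof.
move=> cu mono.
pose P h := forall x, u x <= u (x + h).
have Pcl h : (forall e, 0 < e -> exists2 h', norm2 (h' - h) < e & P h') -> P h.
  move=> hh x; rewrite leNgt; apply/negP => lt.
  have [d d0 hd] := cu (x + h) (u x - u (x + h)) ltac:(by rewrite subr_gt0).
  have [h' hh' Ph'] := hh _ d0; have := hd (x + h').
  rewrite opprD addrACA subrr add0r => /(_ hh'); have := Ph' x; have := ler_norm (u (x + h') - u (x + h)).
  lra.
have Pt0 h : h.1 != 0 -> P h \/ P (- h).
  move=> h0; have -> : h = (h.1, h.1 * (h.2 / h.1)) by rewrite mulrCA divff// mulr1; case: (h).
  have [h1|h1] := mono h.1 (h.2 / h.1); [by left|right => x].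
  by have := h1 (x - (h.1, h.1 * (h.2 / h.1))); rewrite subrK.
(* A vertical [h] is the limit of the vectors [(e, h.2)] with [e > 0]: either arbitrarily small [e]
   give elements of [P], and [h] is in [P], or all small [e] give opposites of elements of [P], and
   [- h] is. *)
have Pt h : P h \/ P (- h).
  have [h0|] := eqVneq h.1 0; last exact: Pt0.
  have nr (e : R) : 0 < e -> norm2 ((e, h.2) - h) < e + e.
    by move=> e0; apply: (le_lt_trans (norm2_le _)); rewrite /= h0 subr0 subrr normr0 addr0 gtr0_norm//; lra.
  have [hP|] := pselect (forall e, 0 < e -> exists e', [/\ 0 < e', e' < e & P (e', h.2)]).
    left; apply: Pcl => e e0; have [e' [e0' ee' Pe]] := hP (e / 2) ltac:(lra).
    by exists (e', h.2) => //; apply: (lt_le_trans (nr _ e0')); lra.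
  move/existsNP => [d /not_implyP[d0 nP]]; right; apply: Pcl => e e0.
  pose e' := Num.min (e / 2) (d / 2).
  have e0' : 0 < e' by rewrite lt_min !divr_gt0.
  have [h1 h2] : e' <= e / 2 /\ e' <= d / 2 by rewrite !ge_min !lexx orbT.
  exists (- (e', h.2)); first by rewrite -opprD norm2N; apply: (lt_le_trans (nr _ e0')); lra.
  have [Pe|//] := Pt0 (e', h.2) ltac:(by rewrite /= gt_eqF).
  by exfalso; apply: nP; exists e'; split => //; lra.
pose G h := P h /\ P (- h).
have GE h x : G h -> u (x + h) = u x.
  move=> [h1 h2]; apply/eqP; rewrite eq_le h1 andbT.
  by have := h2 (x + h); rewrite addrK.
have GI h : (forall x, u (x + h) = u x) -> G h.
  move=> hh; split => x; first by rewrite hh.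
  by have := hh (x - h); rewrite subrK => ->.
have Gcl h : (forall e, 0 < e -> exists2 h', norm2 (h' - h) < e & G h') -> G h.
  move=> hh; split; apply: Pcl => e /hh[h' h1 [h2 h3]]; first by exists h'.
  by exists (- h') => //; rewrite -opprD norm2N.
have Gex c : exists t, `|t| <= 1 /\ G (parab c t).
  have [P1|P1] := Pt (parab c 1).
    by have [t [t1 h1 h2]] := closed_total_sym Pcl Pt P1; exists t.
  have Qcl h : (forall e, 0 < e -> exists2 h', norm2 (h' - h) < e & P (- h')) -> P (- h).
    move=> hh; apply: Pcl => e /hh[h' h1 h2]; exists (- h') => //.
    by rewrite -opprD norm2N.
  have Qt h : P (- h) \/ P (- - h) by rewrite opprK; case: (Pt h) => ?; [right|left].
  have [t [t1 h1 h2]] := closed_total_sym (P := fun h => P (- h)) Qcl Qt P1.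
  by exists t; split => //; split => //; rewrite -(opprK (parab c t)).
pose tk k := projT1 (cid (Gex (2^-1 ^+ k))).
have tk1 k : `|tk k| <= 1 by rewrite /tk; case: cid => t [].
have tkG k : G (parab (2^-1 ^+ k) (tk k)) by rewrite /tk; case: cid => t [].
have Gn h n : G h -> G (iter n (+%R h) 0).
  move=> Gh; elim: n => [|n ih] /=; first by apply: GI => x; rewrite addr0.
  by apply: GI => x; rewrite addrA (GE _ _ ih) (GE _ _ Gh).
have parab_iter c t n : iter n (+%R (parab c t)) 0 = parab (n%:R * c) t.
  elim: n => [|n ih]; first by rewrite /parab !mul0r.
  by rewrite iterS ih -natr1 /parab; congr pair; rewrite /=; ring.
have tkG' k j : (k <= j)%N -> G (parab (2^-1 ^+ k) (tk j)).
  move=> kj; have := Gn _ (2 ^ (j - k))%N (tkG j); rewrite parab_iter.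
  congr G; congr (parab _ _); rewrite natrX -{2}(subnKC kj) exprD mulrCA -exprMn divff// expr1n mulr1//.
have [t [/= t1 tcl]] : [set t : R | t \in `[(-1 : R), 1]] `&` cluster (tk @ \oo) !=set0.
  apply: (@segment_compact _ (-1) 1); exists 0%N => // k _ /=.
  by rewrite in_itv/= -ler_norml.
have {}t1 : `|t| <= 1 by move: t1; rewrite in_itv/= -ler_norml.
have tc k e : 0 < e -> exists j, (k <= j)%N /\ `|tk j - t| < e.
  move=> e0; have [_ [/= [j kj <-] h]] := tcl [set tk j | j in [set j | (k <= j)%N]] (ball t e)
     ltac:(by exists k => // j /= kj; exists j) (nbhsx_ballx _ _ e0).
  by exists j; split => //; rewrite distrC.
have Gk k : G (parab (2^-1 ^+ k) t).
  apply: (parab_closed Gcl t1) => e e0; have [j [kj h]] := tc k e e0.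
  by exists (tk j); split => //; exact: tkG'.
have Gpos c : 0 <= c -> G (parab c t).
  move=> c0; apply: Gcl => e e0.
  pose N := norm2 (parab 1 t).
  have N0 : 0 <= N by exact: norm2_ge0.
  have parabN a : norm2 (parab a t) = `|a| * N.
    by rewrite /N -norm2_scale /parab !mul1r.
  have [k hk] : exists k, 2^-1 ^+ k * (N + 1) < e.
    have : (fun k => 2^-1 ^+ k * (N + 1) : R) @ \oo --> 0 * (N + 1).
      apply: cvgM; last exact: cvg_cst.
      by apply: cvg_expr; rewrite ger0_norm; lra.
    rewrite mul0r => /cvgrPdist_lt/(_ e e0)[k _ /(_ k (leqnn k))] /=.
    rewrite sub0r normrN ger0_norm; first by exists k.
    by rewrite mulr_ge0 ?exprn_ge0//; lra.
  have q0 : 0 < 2^-1 ^+ k :> R by rewrite exprn_gt0.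
  pose n := Num.truncn (c / 2^-1 ^+ k).
  have /andP[n1 n2] : n%:R <= c / 2^-1 ^+ k < n.+1%:R.
    by apply: truncn_itv; rewrite divr_ge0// ltW.
  exists (parab (n%:R * 2^-1 ^+ k) t); last by rewrite -parab_iter; exact: Gn.
  have -> : parab (n%:R * 2^-1 ^+ k) t - parab c t = parab (n%:R * 2^-1 ^+ k - c) t.
    by rewrite /parab; congr pair; rewrite /=; ring.
  rewrite parabN; move: n1 n2; rewrite ler_pdivlMr// ltr_pdivrMr// => n1 n2.
  rewrite distrC ger0_norm ?subr_ge0//; apply: le_lt_trans hk.
  rewrite ler_pM ?subr_ge0//; last by rewrite lerDl.
  by move: n2; rewrite -natr1; lra.
have Gall c : G (parab c t).
  have [/Gpos//|c0] := leP 0 c.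
  have [] := Gpos (- c) ltac:(lra); have -> : parab (- c) t = - parab c t.
    by rewrite /parab; congr pair; rewrite /=; ring.
  by rewrite opprK.
pose p := parab 1 t; pose N := norm2 p.
have N0 : 0 < N.
  rewrite norm2_gt0; apply/eqP; rewrite /p /parab !mul1r => -[] h1 h2.
  by move: h1; rewrite h2 expr0n subr0 => /eqP; rewrite oner_eq0.
have N2 : N ^+ 2 = p.1 * p.1 + p.2 * p.2 by rewrite /N sqr_norm2.
have Nn : N != 0 by rewrite gt_eqF.
pose q1 : R := - p.2 / N; pose q2 : R := p.1 / N.
exists (fun y : R => u (y * q1, y * q2)), (q1, q2); rewrite {}/q1 {}/q2; split.
  rewrite /norm2 /dot2 /=.
  have -> : - p.2 / N * (- p.2 / N) + p.1 / N * (p.1 / N) = (p.1 * p.1 + p.2 * p.2) / N ^+ 2.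
    by field.
  by rewrite -N2 divff ?sqrtr1// expf_neq0.
(* Translation by this period replaces [x] by its orthogonal projection onto the line spanned by the
   unit normal [(q1, q2)] of the line of periods. *)
move=> x; have G1 := Gall (- (dot2 p x / N ^+ 2)).
rewrite -(GE _ x G1); congr u; rewrite /dot2.
have p1E : p.1 = 1 - t ^+ 2 by rewrite /p /parab /= mul1r.
have p2E : p.2 = t by rewrite /p /parab /= mul1r.
have e (a : R) : N ^+ 2 * a = (p.1 * p.1 + p.2 * p.2) * a by rewrite N2.
rewrite /parab -p1E -[in X in (_, X)]p2E; case: x {G1} => x1 x2 /=.
congr pair; apply: (mulfI (expf_neq0 2 Nn)).
  rewrite mulrDr e.
  have -> : N ^+ 2 * (- ((p.1 * x1 + p.2 * x2) / N ^+ 2) * p.1) = - (p.1 * x1 + p.2 * x2) * p.1 by field.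
  have -> : N ^+ 2 * ((- p.2 / N * x1 + p.1 / N * x2) * (- p.2 / N)) = - (- p.2 * x1 + p.1 * x2) * p.2 by field.
  by rewrite /=; ring.
rewrite mulrDr e.
have -> : N ^+ 2 * (- ((p.1 * x1 + p.2 * x2) / N ^+ 2) * p.2) = - (p.1 * x1 + p.2 * x2) * p.2 by field.
have -> : N ^+ 2 * ((- p.2 / N * x1 + p.1 / N * x2) * (p.1 / N)) = (- p.2 * x1 + p.1 * x2) * p.1 by field.
by rewrite /=; ring.
Qed.

End one_dimensional.

(** * Submodularity of the energy *)

Section submodularity.
Context {R : realType} (s : R) (s01 : 0 < s < 1).
Let s0 : 0 < s. Proof. by case/andP : s01. Qed.
Let s1 : s < 1. Proof. by case/andP : s01. Qed.
Notation ker := (ker s).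
Notation pos x := (Num.max x 0).
Implicit Types (x y : R * R) (z : (R * R) * (R * R)) (u v : R * R -> R).

(** If the pairs [a, c] and [b, d] are ordered the same way, maximum and minimum merely rename the
    two rows. If the orders are strictly reversed, one entry is exchanged and the sum drops by the
    cross term. *)
Lemma submodular (a b c d : R) :
  (Num.max a c - Num.max b d) ^+ 2 + (Num.min a c - Num.min b d) ^+ 2
    + 2 * (pos (a - c) * pos (d - b) + pos (c - a) * pos (b - d))
  = (a - b) ^+ 2 + (c - d) ^+ 2.
Proof.
have p (x y : R) : pos (x - y) = if x <= y then 0 else x - y.
  by case: (leP x y) => h; [rewrite max_r// subr_le0|rewrite max_l// subr_ge0 ltW].
rewrite !p !maxEle !minEle.
by case: (ltgtP a c) => h1; case: (ltgtP b d) => h2; rewrite ?h1 ?h2; ring.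
Qed.

(** The constants depend on [u] and [v] alone, so the bound is uniform over all [w] that agree with
    [v] on one fixed ball; the slides do so as soon as their cutoff is wide enough. *)
Lemma gain_pos u v x0 y0 : (forall x, cont2 u x) -> (forall x, cont2 v x) ->
  v x0 < u x0 -> u y0 < v y0 -> exists c rho, [/\ 0 < c, 0 < rho &
  forall (w : R * R -> R) (m : (R * R) * (R * R) -> R), measurable_fun setT w -> measurable_fun setT m ->
    (forall z, 0 <= m z) -> (forall z, norm2 z.1 <= rho -> norm2 z.2 <= rho -> 1 <= m z) ->
    (forall x, norm2 x <= rho -> w x = v x) ->
    (c%:E <= \int[lam2]_z (m z * (pos (u z.1 - w z.1) * pos (w z.2 - u z.2) * ker (z.2 - z.1)))%:E)%E].
Proof.
move=> cu cv hx hy.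
have mu := cont2_measurable cu.
pose a := u x0 - v x0; pose b := v y0 - u y0.
have a0 : 0 < a by rewrite subr_gt0.
have b0 : 0 < b by rewrite subr_gt0.
have [d1 d10 hd1] := cont2B (cu x0) (cv x0) ltac:(exact: (divr_gt0 a0 (ltr0n _ 2))).
have [d2 d20 hd2] := cont2B (cv y0) (cu y0) ltac:(exact: (divr_gt0 b0 (ltr0n _ 2))).
pose d := Num.min d1 d2 / 4.
have d0 : 0 < d by rewrite divr_gt0// lt_min d10.
have [dd1 dd2] : 4 * d <= d1 /\ 4 * d <= d2.
  by rewrite /d mulrCA divff// mulr1 !ge_min !lexx orbT.
pose box x := [set` `[x.1 - d, x.1 + d]] `*` [set` `[x.2 - d, x.2 + d]] : set (R * R).
have mbox x : measurable (box x) by exact: measurableX.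
have lbox x : lam (box x) = ((2 * d) ^+ 2)%:E.
  by rewrite lam_box; [congr (_%:E); ring|lra|lra].
have inbox x y : box x y -> norm2 (y - x) < 4 * d.
  rewrite /box /= !in_itv/= => -[/andP[h1 h2] /andP[h3 h4]].
  apply: (le_lt_trans (norm2_le _)) => /=.
  have h5 : `|y.1 - x.1| <= d by rewrite ler_norml; apply/andP; split; lra.
  have h6 : `|y.2 - x.2| <= d by rewrite ler_norml; apply/andP; split; lra.
  by lra.
have b1 x : box x0 x -> a / 2 <= u x - v x.
  move=> /inbox h; have := hd1 x (lt_le_trans h dd1); rewrite ltr_norml /a => /andP[]; lra.
have b2 x : box y0 x -> b / 2 <= v x - u x.
  move=> /inbox h; have := hd2 x (lt_le_trans h dd2); rewrite ltr_norml /b => /andP[]; lra.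
pose rho := norm2 x0 + norm2 y0 + 4 * d.
have rho0 : 0 < rho by rewrite ltr_wpDl ?addr_ge0 ?norm2_ge0// mulr_gt0.
have rx x : box x0 x -> norm2 x <= rho.
  move=> /inbox h; have := norm2_dist x x0 0; rewrite !subr0 => h'.
  by have := norm2_ge0 y0; rewrite /rho; lra.
have ry x : box y0 x -> norm2 x <= rho.
  move=> /inbox h; have := norm2_dist x y0 0; rewrite !subr0 => h'.
  by have := norm2_ge0 x0; rewrite /rho; lra.
(* On the product of the two squares the positive parts are at least [a / 2] and [b / 2], and the
   points, which differ since [u - v] changes sign, are at distance at most [2 * rho]. *)
pose q := (a / 2) * (b / 2) * (2 * rho) `^ (- (2 + s)).
have q0 : 0 < q by rewrite !mulr_gt0 ?powR_gt0// ?divr_gt0// mulr_gt0.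
exists (q * ((2 * d) ^+ 2 * (2 * d) ^+ 2)), rho; split => //.
  have dd0 : 0 < (2 * d) ^+ 2 by rewrite exprn_gt0// mulr_gt0.
  by rewrite mulr_gt0// mulr_gt0.
move=> w m mw mm m0 m1 hw.
have mk := measurable_ker1 s; have k0 := ker_ge0 s.
have mi x : measurable_fun setT (\1_(box x) : R * R -> R) by exact: measurable_indic.
have i0 x y : 0 <= \1_(box x) y :> R by rewrite indicE.
have mf : measurable_fun setT (fun z => q * (\1_(box x0) z.1 * \1_(box y0) z.2)).
  have mi1 := mi x0; have mi2 := mi y0; by mfun.
have e1 : (\int[lam2]_z (q * (\1_(box x0) z.1 * \1_(box y0) z.2))%:E =
    (q * ((2 * d) ^+ 2 * (2 * d) ^+ 2))%:E)%E.
  have mfE : measurable_fun setT (fun z => (q * (\1_(box x0) z.1 * \1_(box y0) z.2))%:E).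
    by apply/measurable_EFinP.
  have pf z : (0 <= (q * (\1_(box x0) z.1 * \1_(box y0) z.2))%:E)%E.
    by rewrite lee_fin mulr_ge0 ?(ltW q0)// mulr_ge0.
  rewrite (lam2_tonelli mfE pf).
  have h x : (\int[lam]_y (q * (\1_(box x0) x * \1_(box y0) y))%:E
      = (q * (2 * d) ^+ 2 * \1_(box x0) x)%:E)%E.
    have c0 : 0 <= q * \1_(box x0) x by rewrite mulr_ge0 ?(ltW q0).
    under eq_integral do rewrite mulrA.
    rewrite (ge0_intZ lam (mi y0) c0 (i0 y0)) lam_indic// lbox -EFinM; congr (_%:E); ring.
  under eq_integral do rewrite h.
  have c0 : 0 <= q * (2 * d) ^+ 2 by rewrite mulr_ge0 ?(ltW q0)// exprn_ge0// mulr_ge0// ltW.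
  rewrite (ge0_intZ lam (mi x0) c0 (i0 x0)) lam_indic// lbox -EFinM; congr (_%:E); ring.
rewrite -e1; apply: (ge0_le_int lam2 mf).
- by mfun.
- by move=> z; rewrite mulr_ge0 ?(ltW q0)// mulr_ge0.
move=> z.
have nn : 0 <= m z * (pos (u z.1 - w z.1) * pos (w z.2 - u z.2) * ker (z.2 - z.1)).
  by rewrite mulr_ge0// mulr_ge0// mulr_ge0// le_max lexx orbT.
rewrite !indicE; have [/set_mem h1|_] := boolP (z.1 \in box x0); last by rewrite mul0r mulr0.
have [/set_mem h2|_] := boolP (z.2 \in box y0); last by rewrite mulr0 mulr0.
rewrite !mulr1 (hw _ (rx _ h1)) (hw _ (ry _ h2)).
have u1 := b1 _ h1; have u2 := b2 _ h2.
have zn : z.2 - z.1 != 0.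
  by apply/eqP => /eqP; rewrite subr_eq0 => /eqP e; move: u2; rewrite e; lra.
have zr : norm2 (z.2 - z.1) <= 2 * rho.
  have := norm2_dist z.2 0 z.1; rewrite sub0r subr0 norm2N.
  by have := rx _ h1; have := ry _ h2; lra.
have kz := ker_ge s01 zn zr.
have mz := m1 z (rx _ h1) (ry _ h2).
rewrite -[leLHS]mul1r ler_pM//; first by rewrite ltW.
rewrite /q ler_pM ?powR_ge0//; first by rewrite mulr_ge0// divr_ge0// ltW.
by rewrite ler_pM ?divr_ge0 ?(ltW a0) ?(ltW b0)// le_max ?u1 ?u2.
Qed.

End submodularity.

(** * Smooth compactly supported functions *)

Section calculus.
Context {R : realType}.
Implicit Types (f g : R -> R) (p q : {poly R}) (t x y h : R).

Lemma is_derive_quad f (x d C : R) :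
  (forall h, `|f (x + h) - f x - d * h| <= C * h ^+ 2) -> is_derive x (1 : R) f d.
Proof.
move=> hf; have C0 : 0 <= C.
  by have := hf 1; rewrite expr1n !mulr1 => hh; exact: (le_trans (normr_ge0 _) hh).
have h : (fun h : R => h^-1 *: (f (h *: (1 : R) + x) - f x)) @ 0^' --> d.
  apply/cvgrPdist_le => e e0.
  have e1 : 0 < e / (C + 1) by rewrite divr_gt0// ltr_wpDl.
  near=> t.
  have t0 : t != 0 by near: t; exact: nbhs_dnbhs_neq.
  have te : `|t| <= e / (C + 1).
    near: t; apply: dnbhs0_le; exact: e1.
  have -> : d - t^-1 *: (f (t *: (1 : R) + x) - f x) = - (t^-1 * (f (x + t) - f x - d * t)).
    by rewrite /GRing.scale /= mulr1 (addrC t); field.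
  rewrite normrN normrM normfV ler_pdivrMl ?normr_gt0//.
  apply: (le_trans (hf t)); have -> : t ^+ 2 = `|t| * `|t| by rewrite -expr2 real_normK ?num_real.
  have tp := normr_ge0 t; move: te; rewrite ler_pdivlMr ?ltr_wpDl// => te.
  by rewrite mulrCA ler_wpM2l//; nra.
by split; [apply/cvg_ex; exists d|exact: cvg_lim h].
Unshelve. all: by end_near. Qed.

Lemma is_derive_affine f (x b : R) : (forall h, f (x + h) = f x + b * h) -> is_derive x (1 : R) f b.
Proof.
move=> hf; apply: (@is_derive_quad _ _ _ 0) => h.
have -> : f (x + h) - f x - b * h = 0 by rewrite hf; ring.
by rewrite normr0 mul0r.
Qed.

Lemma is_derive_cont f (f' : R -> R) : (forall x, is_derive x 1 f (f' x)) -> continuous f.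
Proof.
by move=> df x; apply/differentiable_continuous/derivable1_diffP; apply: ex_derive; exact: df.
Qed.

Lemma mean_value f (f' : R -> R) (x y : R) : (forall x, is_derive x 1 f (f' x)) ->
  exists c, `|c - x| <= `|y - x| /\ f y - f x = f' c * (y - x).
Proof.
move=> df; have cf : forall A, {within A, continuous f}.
  by move=> A; apply: continuous_subspaceT; exact: is_derive_cont df.
have [xy|/ltW yx] := leP x y.
  have [c] := @MVT_segment R f f' x y xy (fun x _ => df x) (cf _).
  rewrite in_itv/= => /andP[h1 h2] h3; exists c; split => //.
  by rewrite !ger0_norm ?subr_ge0// lerD2r.
have [c] := @MVT_segment R f f' y x yx (fun x _ => df x) (cf _).
rewrite in_itv/= => /andP[h1 h2] h3; exists c; split.
  by rewrite !ler0_norm ?subr_le0//; lra.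
by rewrite -opprB h3; ring.
Qed.

Lemma lip_of_derive f (f' : R -> R) (M : R) : (forall x, is_derive x 1 f (f' x)) ->
  (forall x, `|f' x| <= M) -> forall x y, `|f y - f x| <= M * `|y - x|.
Proof.
move=> df hM x y; have [c [_ ->]] := mean_value x y df.
by rewrite normrM ler_wpM2r.
Qed.

Lemma taylor_of_derive f (f' f'' : R -> R) (M : R) : (forall x, is_derive x 1 f (f' x)) ->
  (forall x, is_derive x 1 f' (f'' x)) -> (forall x, `|f'' x| <= M) ->
  forall x h, `|f (x + h) - f x - f' x * h| <= M * h ^+ 2.
Proof.
move=> df df' hM x h; have M0 : 0 <= M by apply: le_trans (hM 0).
have [c [h1 h2]] := mean_value x (x + h) df.
move: h1; rewrite h2 addrAC subrr add0r -mulrBl normrM => h1.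
have := lip_of_derive df' hM x c => h3.
rewrite -real_normK ?num_real// expr2 mulrA ler_wpM2r//.
by apply: (le_trans h3); rewrite ler_wpM2l.
Qed.

(** Induction on the polynomial: half of the exponent is spent on the new factor [x] and half on the
    polynomial that it multiplies. *)
Lemma poly_expR_bound p (e : R) : 0 < e ->
  exists2 C, 0 <= C & forall x, 0 <= x -> `|p.[x]| <= C * expR (e * x).
Proof.
elim/poly_ind: p e => [|p c ih] e e0.
  by exists 0 => // x _; rewrite horner0 normr0 mul0r.
have e2 : 0 < e / 2 by rewrite divr_gt0.
have [C C0 hC] := ih _ e2; exists (C * (2 / e) + `|c|).
  by rewrite addr_ge0// mulr_ge0// divr_ge0// ltW.
move=> x x0; rewrite hornerMXaddC mulrDl; apply: (le_trans (ler_normD _ _)).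
apply: lerD.
  rewrite normrM (ger0_norm x0).
  have -> : expR (e * x) = expR (e / 2 * x) * expR (e / 2 * x).
    by rewrite -expRD; congr expR; field.
  have h : x <= 2 / e * expR (e / 2 * x).
    rewrite -ler_pdivrMl ?divr_gt0// invf_div.
    by have := expR_ge1Dx (e / 2 * x); lra.
  have := hC x x0; have := expR_gt0 (e / 2 * x); set E := expR _ => E0 hp.
  apply: (@le_trans _ _ (C * E * (2 / e * E))); last by rewrite le_eqVlt; apply/orP; left; apply/eqP; ring.
  by rewrite ler_pM.
have : 1 <= expR (e * x) by rewrite -expR0 ler_expR mulr_ge0// ltW.
by have := normr_ge0 c; nra.
Qed.

(* The derivatives of [exp (- 1 / t)], extended by [0] to [t <= 0]. *)
Definition flat p (t : R) : R := if 0 < t then p.[t^-1] * expR (- t^-1) else 0.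

(** By the chain rule, the derivative of [p(1/t) exp(-1/t)] is [(1/t)^2 (p - p')(1/t) exp(-1/t)]. *)
Definition flatD p : {poly R} := 'X^2 * (p - p^`()).

Lemma flat_bound p : exists2 C, 0 <= C & forall t, `|flat p t| <= C.
Proof.
have [C C0 hC] := poly_expR_bound p ltr01; exists C => // t; rewrite /flat.
case: ltP => t0; last by rewrite normr0.
have h : 0 <= t^-1 by rewrite invr_ge0 ltW.
rewrite normrM (ger0_norm (expR_ge0 _)) expRN ler_pdivrMr ?expR_gt0//.
by have := hC _ h; rewrite mul1r.
Qed.

Lemma is_derive_flat p t : is_derive t 1 (flat p) (flat (flatD p) t).
Proof.
have [t0|t0|->] := ltgtP t 0.
- rewrite {2}/flat ltNge (ltW t0) /=.
  have d0 : is_derive t (1 : R) (fun=> 0 : R) 0 by apply: is_derive_affine => h; rewrite mul0r addr0.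
  apply: (@near_eq_is_derive _ _ _ (fun=> 0) (flat p) t 1 0 _ d0).
  near=> x; rewrite /flat; case: ltP => // x0.
  have : x < 0 by near: x; exact: lt_nbhsl.
  by rewrite ltNge (ltW x0).
- rewrite {2}/flat t0.
  have tn : t != 0 by rewrite gt_eqF.
  have dV : is_derive t 1 (fun x : R => x^-1) (- t ^- 2 *: (1 : R)).
    by apply: is_deriveV => //; exact: is_derive_id.
  have dp : is_derive (t^-1) 1 (horner p) (p^`()).[t^-1].
    by apply: DeriveDef; [exact: derivable_horner|rewrite -derive1E derivE].
  have dpV := @is_derive1_comp _ (horner p) _ _ _ _ dp dV.
  have dN := is_deriveN dV.
  have dE := @is_derive1_comp _ expR (fun x : R => - x^-1) t _ _ (is_derive_expR (- t^-1)) dN.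
  apply: (@near_eq_is_derive _ _ _ ((horner p \o GRing.inv) * (expR \o (fun x : R => - x^-1))%R)).
    near=> x; rewrite /flat ifT //.
    by near: x; exact: lt_nbhsr.
  apply: (is_derive_eq (is_deriveM dpV dE)).
  rewrite /flatD /= !hornerE /GRing.scale /= !hornerE /= exprVn.
  by move: (t ^- 2) => c; ring.
rewrite {2}/flat ltxx /=.
(* At the origin, [flat p h] equals [h ^+ 2] times the value at [h] of the flat function of
   ['X^2 * p], which is bounded; a quadratic bound makes the derivative vanish. *)
have [C C0 hC] := flat_bound ('X^2 * p).
apply: (@is_derive_quad _ _ _ C) => h.
rewrite mul0r subr0 add0r {2}/flat ltxx subr0; have := hC h; rewrite /flat.
case: ltP => h0 hh; last by rewrite normr0 mulr_ge0// sqr_ge0.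
move: hh; rewrite hornerM hornerXn exprVn -mulrA normrM gtr0_norm ?invr_gt0 ?exprn_gt0//.
by rewrite ler_pdivrMl ?exprn_gt0// [X in _ -> _ <= X]mulrC.
Unshelve. all: by end_near. Qed.

(** Two polynomials are carried along so that the derivative is again a combination of functions of
    this shape, with the same support in [[-1, 1]]. *)
Definition bump1 p q (t : R) : R := flat p (1 + t) * flat q (1 - t).

Lemma bump1_0 p q t : 1 <= `|t| -> bump1 p q t = 0.
Proof.
rewrite ler_normr => /orP[h|h]; rewrite /bump1 /flat.
  by rewrite [X in _ * X]ifF ?mulr0// ltNge; apply/negbF; lra.
by rewrite ifF ?mul0r// ltNge; apply/negbF; lra.
Qed.

Lemma bump1_bound p q : exists2 C, 0 <= C & forall t, `|bump1 p q t| <= C.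
Proof.
have [C C0 hC] := flat_bound p; have [D D0 hD] := flat_bound q.
by exists (C * D); [rewrite mulr_ge0|move=> t; rewrite normrM ler_pM].
Qed.

Lemma is_derive_bump1 p q t :
  is_derive t 1 (bump1 p q) (bump1 (flatD p) q t - bump1 p (flatD q) t).
Proof.
have d1 : is_derive t 1 (fun x => 1 + x : R) 1.
  by apply: is_derive_affine => h; ring.
have d2 : is_derive t 1 (fun x => 1 - x : R) (- 1).
  by apply: is_derive_affine => h; ring.
have e1 := @is_derive1_comp _ (flat p) (fun x : R => 1 + x) t _ _ (is_derive_flat p (1 + t)) d1.
have e2 := @is_derive1_comp _ (flat q) (fun x : R => 1 - x) t _ _ (is_derive_flat q (1 - t)) d2.
apply: (is_derive_eq (is_deriveM e1 e2)).
by rewrite /bump1 /GRing.scale /=; ring.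
Qed.

Lemma bump1_taylor p q : exists2 C, 0 <= C & forall t h,
  `|bump1 p q (t + h) - bump1 p q t
     - (bump1 (flatD p) q t - bump1 p (flatD q) t) * h| <= C * h ^+ 2.
Proof.
have dd t : is_derive t 1 (fun t => bump1 (flatD p) q t - bump1 p (flatD q) t)
   ((bump1 (flatD (flatD p)) q t - bump1 (flatD p) (flatD q) t)
     - (bump1 (flatD p) (flatD q) t - bump1 p (flatD (flatD q)) t)).
  by have := is_deriveB (is_derive_bump1 (flatD p) q t) (is_derive_bump1 p (flatD q) t).
have [C1 C10 h1] := bump1_bound (flatD (flatD p)) q.
have [C2 C20 h2] := bump1_bound (flatD p) (flatD q).
have [C3 C30 h3] := bump1_bound p (flatD (flatD q)).
exists (C1 + C2 + (C2 + C3)); first by rewrite !addr_ge0.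
apply: (taylor_of_derive (is_derive_bump1 p q) dd) => x.
apply: (le_trans (ler_normB _ _)); apply: lerD; apply: (le_trans (ler_normB _ _)); exact: lerD.
Qed.

Lemma bump1_lip p q : exists2 C, 0 <= C & forall t h, `|bump1 p q (t + h) - bump1 p q t| <= C * `|h|.
Proof.
have [C1 C10 h1] := bump1_bound (flatD p) q; have [C2 C20 h2] := bump1_bound p (flatD q).
exists (C1 + C2); first exact: addr_ge0.
move=> t h; have := @lip_of_derive _ _ (C1 + C2) (is_derive_bump1 p q) _ t (t + h).
rewrite [X in _ <= _ * `|X|]addrAC subrr add0r; apply => x.
by apply: (le_trans (ler_normB _ _)); exact: lerD.
Qed.

Lemma bump1_gt0 t : `|t| < 1 -> 0 < bump1 1 1 t.
Proof.
rewrite ltr_norml => /andP[h1 h2]; rewrite /bump1 /flat !hornerE.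
by rewrite !ifT; [rewrite mulr_gt0 ?expR_gt0|lra|lra].
Qed.

Lemma bump1_ge0 t : 0 <= bump1 1 1 t.
Proof. by have [/bump1_0->//|/bump1_gt0/ltW] := leP 1 `|t|. Qed.

End calculus.

Section cutoff_profile.
Context {R : realType}.
Notation pos x := (Num.max x 0).
Implicit Types (t x y : R).

(* Only [C^1], which is all that the change of variables needs. *)
Definition prof t : R := pos (1 - pos (t - 1) ^+ 2) ^+ 2.
Definition dprof t : R := - 4 * pos (1 - pos (t - 1) ^+ 2) * pos (t - 1).

Lemma is_derive_pos2 t : is_derive t (1 : R) (fun x => pos x ^+ 2) (2 * pos t).
Proof.
apply: (@is_derive_quad _ _ _ _ 1) => h; rewrite mul1r ler_norml.
by case: (leP t 0) => h1; case: (leP (t + h) 0) => h2; apply/andP; split; nra.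
Qed.

Lemma is_derive_prof t : is_derive t (1 : R) prof (dprof t).
Proof.
have d1 : is_derive t 1 (fun x => x - 1 : R) 1.
  by apply: is_derive_affine => h; ring.
have d2 := @is_derive1_comp _ (fun x => pos x ^+ 2) (fun x : R => x - 1) t _ _ (is_derive_pos2 (t - 1)) d1.
have d3 := is_deriveB (is_derive_cst (1 : R) t 1) d2.
have d4 := @is_derive1_comp _ (fun x => pos x ^+ 2) _ _ _ _ (is_derive_pos2 _) d3.
by apply: (is_derive_eq d4); rewrite /dprof /=; ring.
Qed.

Lemma prof_ge0 t : 0 <= prof t. Proof. exact: sqr_ge0. Qed.

Lemma prof_le1 t : prof t <= 1.
Proof.
rewrite /prof -[leRHS](expr1n _ 2) ler_sqr ?nnegrE ?ler01// ?le_max ?lexx ?orbT//.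
by rewrite ge_max ler01 andbT gerBl sqr_ge0.
Qed.

Lemma prof_eq1 t : t <= 1 -> prof t = 1.
Proof. by move=> h; rewrite /prof (@max_r _ _ (t - 1)) ?subr_le0// expr0n subr0 max_l ?ler01// expr1n. Qed.

Lemma prof_eq0 t : 2 <= t -> prof t = 0.
Proof.
move=> h; rewrite /prof (@max_l _ _ (t - 1)); last by lra.
by rewrite max_r ?expr0n//; nra.
Qed.

Lemma dprof_eq0 t : 2 <= t -> dprof t = 0.
Proof.
move=> h; rewrite /dprof (@max_l _ _ (t - 1)); last by lra.
by rewrite max_r ?mulr0 ?mul0r//; nra.
Qed.

Lemma dprof_bound t : `|dprof t| <= 4.
Proof.
rewrite /dprof; case: (leP (t - 1) 0) => h; first by rewrite mulr0 normr0.
case: (leP (1 - (t - 1) ^+ 2) 0) => h'; first by rewrite mulr0 mul0r normr0.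
move: (t - 1) h h' => y h h'; have y1 : y <= 1 by nra.
have a : 0 <= (1 - y ^+ 2) * y by rewrite mulr_ge0// ltW.
have b : (1 - y ^+ 2) * y <= 1 by nra.
by rewrite ler_norml; apply/andP; split; lra.
Qed.

Lemma prof_lip x y : `|prof y - prof x| <= 4 * `|y - x|.
Proof. exact: (lip_of_derive is_derive_prof dprof_bound). Qed.

Lemma dprof_continuous : continuous dprof.
Proof.
have cp (f : R -> R) : continuous f -> continuous (fun x => pos (f x)).
  move=> cf x; apply: continuous_max; [exact: cf|exact: cvg_cst].
have c1 : continuous (fun t : R => pos (t - 1)).
  by apply: cp => x; apply: cvgB; [exact: cvg_id|exact: cvg_cst].
move=> x; apply: cvgM; last exact: c1.
apply: cvgM; first exact: cvg_cst.
apply: (cp (fun t : R => 1 - pos (t - 1) ^+ 2)) => y; apply: cvgB; first exact: cvg_cst.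
rewrite !expr2; apply: cvgM; exact: c1.
Qed.

End cutoff_profile.

Section bumps.
Context {R : realType} (l : R).
Implicit Types (x y z w : R * R) (f g : R * R -> R).

(* Finite sums of products of one-dimensional bumps: a class of compactly supported
   functions that contains its own partial derivatives. *)
Inductive bumps : (R * R -> R) -> Prop :=
| bumps_one c p q p' q' : bumps (fun z => c * (bump1 p q (l * z.1) * bump1 p' q' (l * z.2)))
| bumps_add f g : bumps f -> bumps g -> bumps (fun z => f z + g z).

Lemma bumps_scale a f : bumps f -> bumps (fun z => a * f z).
Proof.
elim=> [c p q p' q'|f1 f2 _ h1 _ h2].
  rewrite (_ : (fun z => _) = (fun z => (a * c) * (bump1 p q (l * z.1) * bump1 p' q' (l * z.2)))).
    exact: bumps_one.
  by apply/funext => z; rewrite mulrA.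
rewrite (_ : (fun z => _) = (fun z => a * f1 z + a * f2 z)); first exact: bumps_add.
by apply/funext => z; rewrite mulrDr.
Qed.

Lemma bumps_supp f : bumps f -> forall z, 1 <= `|l * z.1| \/ 1 <= `|l * z.2| -> f z = 0.
Proof.
elim=> [c p q p' q'|f1 f2 _ h1 _ h2] z hz; last by rewrite h1// h2// addr0.
by case: hz => /bump1_0 ->; rewrite ?mul0r ?mulr0 ?mulr0.
Qed.

Lemma bumps_bound f : bumps f -> exists2 C, 0 <= C & forall z, `|f z| <= C.
Proof.
elim=> [c p q p' q'|f1 f2 _ [C1 C10 h1] _ [C2 C20 h2]].
  have [A A0 hA] := bump1_bound p q; have [B B0 hB] := bump1_bound p' q'.
  exists (`|c| * (A * B)); first by rewrite !mulr_ge0.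
  by move=> z; rewrite normrM ler_wpM2l// normrM ler_pM.
exists (C1 + C2); first exact: addr_ge0.
by move=> z; apply: (le_trans (ler_normD _ _)); exact: lerD.
Qed.

Lemma norm_prod_le (M : R) w : 0 <= M -> (M * (`|l * w.1| + `|l * w.2|)) <= M * (2 * `|l|) * norm2 w.
Proof.
move=> M0; rewrite !normrM -mulrDr -!mulrA ler_wpM2l// mulrCA ler_wpM2l//.
have := le_norm2_fst w; have := le_norm2_snd w; lra.
Qed.

Lemma bumps_lip f : bumps f -> exists2 C, 0 <= C & forall z w, `|f (z + w) - f z| <= C * norm2 w.
Proof.
elim=> [c p q p' q'|f1 f2 _ [C1 C10 h1] _ [C2 C20 h2]]; last first.
  exists (C1 + C2); first exact: addr_ge0.
  move=> z w; rewrite opprD addrACA mulrDl; apply: (le_trans (ler_normD _ _)).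
  by apply: lerD.
have [A A0 hA] := bump1_bound p q; have [B B0 hB] := bump1_bound p' q'.
have [A1 A10 hA1] := bump1_lip p q; have [B1 B10 hB1] := bump1_lip p' q'.
pose M := `|c| * (A1 * B + A * B1).
have M0 : 0 <= M by rewrite mulr_ge0// addr_ge0// mulr_ge0.
exists (M * (2 * `|l|)); first by rewrite mulr_ge0// mulr_ge0.
move=> z w; apply: le_trans (norm_prod_le w M0).
rewrite -mulrBr normrM /M -[leRHS]mulrA ler_wpM2l//.
have -> : l * (z + w).1 = l * z.1 + l * w.1 by rewrite mulrDr.
have -> : l * (z + w).2 = l * z.2 + l * w.2 by rewrite mulrDr.
move: (l * z.1) (l * w.1) (l * z.2) (l * w.2) => s H t L.
have -> : bump1 p q (s + H) * bump1 p' q' (t + L) - bump1 p q s * bump1 p' q' t =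
  (bump1 p q (s + H) - bump1 p q s) * bump1 p' q' (t + L)
   + bump1 p q s * (bump1 p' q' (t + L) - bump1 p' q' t) by ring.
have e5 : `|(bump1 p q (s + H) - bump1 p q s) * bump1 p' q' (t + L)| <= A1 * `|H| * B.
  by rewrite normrM ler_pM.
have e6 : `|bump1 p q s * (bump1 p' q' (t + L) - bump1 p' q' t)| <= A * (B1 * `|L|).
  by rewrite normrM ler_pM.
apply: (le_trans (ler_normD _ _)); apply: (le_trans (lerD e5 e6)).
have p1 : 0 <= A1 * B * `|L| by rewrite mulr_ge0// mulr_ge0.
have p2 : 0 <= A * B1 * `|H| by rewrite mulr_ge0// mulr_ge0.
by rewrite mulrDl !mulrDr; lra.
Qed.

Lemma bumps_cont f : bumps f -> forall x, cont2 f x.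
Proof.
move=> /bumps_lip[C C0 hC] x; apply: (@cont2_lip _ C) => y.
by have := hC x (y - x); rewrite (addrC x) subrK.
Qed.

Lemma bumps_meas f : bumps f -> measurable_fun setT f.
Proof. by move=> /bumps_cont hf; exact: cont2_measurable. Qed.


Lemma product_taylor (a b a' b' A B A1 B1 Ca Cb H L aH bL : R) :
  0 <= A -> 0 <= B -> 0 <= A1 -> 0 <= B1 -> 0 <= Ca -> 0 <= Cb ->
  `|aH - a - a' * H| <= Ca * H ^+ 2 -> `|bL - b - b' * L| <= Cb * L ^+ 2 ->
  `|bL| <= B -> `|a| <= A -> `|a'| <= A1 -> `|bL - b| <= B1 * `|L| ->
  `|aH * bL - a * b - (a' * b * H + a * b' * L)| <= (Ca * B + A * Cb + A1 * B1) * (H ^+ 2 + L ^+ 2).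
Proof.
move=> A0 B0 A10 B10 Ca0 Cb0 h1 h2 hB hA hA1 hB1.
have -> : aH * bL - a * b - (a' * b * H + a * b' * L) =
  (aH - a - a' * H) * bL + a * (bL - b - b' * L) + a' * H * (bL - b) by ring.
have e1 : `|(aH - a - a' * H) * bL| <= Ca * H ^+ 2 * B by rewrite normrM ler_pM.
have e2 : `|a * (bL - b - b' * L)| <= A * (Cb * L ^+ 2) by rewrite normrM ler_pM.
have e3 : `|a' * H * (bL - b)| <= A1 * `|H| * (B1 * `|L|).
  by rewrite !normrM ler_pM// ?mulr_ge0// ler_wpM2r.
have e4 : `|H| * `|L| <= H ^+ 2 + L ^+ 2.
  rewrite -(real_normK (num_real H)) -(real_normK (num_real L)).
  have := sqr_ge0 (`|H| - `|L|); have := normr_ge0 H; have := normr_ge0 L; nra.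
have s1 := sqr_ge0 H; have s2 := sqr_ge0 L.
have e5 : A1 * `|H| * (B1 * `|L|) <= A1 * B1 * (H ^+ 2 + L ^+ 2).
  have -> : A1 * `|H| * (B1 * `|L|) = A1 * B1 * (`|H| * `|L|) by ring.
  by rewrite ler_wpM2l// mulr_ge0.
have e6 : 0 <= Ca * B * L ^+ 2 by rewrite mulr_ge0// mulr_ge0.
have e7 : 0 <= A * Cb * H ^+ 2 by rewrite mulr_ge0// mulr_ge0.
apply: (le_trans (ler_normD _ _)); apply: (le_trans (lerD (ler_normD _ _) (lexx _))).
by move: e1 e2 e3 e5 e6 e7; rewrite !mulrDl !mulrDr; lra.
Qed.

Lemma sqr_norm2_scale w : (l * w.1) ^+ 2 + (l * w.2) ^+ 2 = l ^+ 2 * norm2 w ^+ 2.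
Proof. by rewrite sqr_norm2 /dot2; ring. Qed.

Lemma bumps_taylor f : bumps f -> exists f1 f2, [/\ bumps f1, bumps f2 & exists2 C, 0 <= C &
  forall z w, `|f (z + w) - f z - (f1 z * w.1 + f2 z * w.2)| <= C * norm2 w ^+ 2].
Proof.
elim=> [c p q p' q'|F G _ [f1 [f2 [bf1 bf2 [C C0 hC]]]] _ [g1 [g2 [bg1 bg2 [D D0 hD]]]]]; last first.
  exists (fun z => f1 z + g1 z), (fun z => f2 z + g2 z); split; [exact: bumps_add|exact: bumps_add|].
  exists (C + D); first exact: addr_ge0.
  move=> z w; rewrite [leRHS]mulrDl.
  have -> : F (z + w) + G (z + w) - (F z + G z) - ((f1 z + g1 z) * w.1 + (f2 z + g2 z) * w.2)
     = (F (z + w) - F z - (f1 z * w.1 + f2 z * w.2)) + (G (z + w) - G z - (g1 z * w.1 + g2 z * w.2)) by ring.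
  by apply: (le_trans (ler_normD _ _)); exact: lerD.
have [A A0 hA] := bump1_bound p q; have [B B0 hB] := bump1_bound p' q'.
have [A2 A20 hA2] := bump1_bound (flatD p) q; have [A3 A30 hA3] := bump1_bound p (flatD q).
have [B1 B10 hB1] := bump1_lip p' q'.
have [Ca Ca0 hCa] := bump1_taylor p q; have [Cb Cb0 hCb] := bump1_taylor p' q'.
exists (fun z => (c * l) * (bump1 (flatD p) q (l * z.1) * bump1 p' q' (l * z.2))
               + (- (c * l)) * (bump1 p (flatD q) (l * z.1) * bump1 p' q' (l * z.2))).
exists (fun z => (c * l) * (bump1 p q (l * z.1) * bump1 (flatD p') q' (l * z.2))
               + (- (c * l)) * (bump1 p q (l * z.1) * bump1 p' (flatD q') (l * z.2))).
split; [by apply: bumps_add; apply: bumps_one|by apply: bumps_add; apply: bumps_one|].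
pose M := `|c| * (Ca * B + A * Cb + (A2 + A3) * B1).
have M0 : 0 <= M.
  by rewrite mulr_ge0// addr_ge0//; [rewrite addr_ge0// mulr_ge0|rewrite mulr_ge0// addr_ge0].
exists (M * l ^+ 2); first by rewrite mulr_ge0// sqr_ge0.
move=> z w; rewrite -[leRHS]mulrA -sqr_norm2_scale.
have -> : l * (z + w).1 = l * z.1 + l * w.1 by rewrite mulrDr.
have -> : l * (z + w).2 = l * z.2 + l * w.2 by rewrite mulrDr.
have hA' : `|bump1 (flatD p) q (l * z.1) - bump1 p (flatD q) (l * z.1)| <= A2 + A3.
  by apply: (le_trans (ler_normB _ _)); exact: lerD.
have := product_taylor A0 B0 (addr_ge0 A20 A30) B10 Ca0 Cb0 (hCa (l * z.1) (l * w.1))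
  (hCb (l * z.2) (l * w.2)) (hB (l * z.2 + l * w.2)) (hA (l * z.1)) hA' (hB1 (l * z.2) (l * w.2)).
set X := (X in `|X| <= _); set Y := (Y in _ -> `|Y| <= _).
have -> : Y = c * X by rewrite /Y /X; ring.
by move=> h; rewrite normrM /M -[leRHS]mulrA ler_wpM2l.
Qed.

End bumps.

Section linear_form.
Context {R : realType}.

Definition lform (a b : R) (w : R * R) : R := a * w.1 + b * w.2.

Lemma lform_is_linear a b : linear (lform a b : (R * R)%type -> R^o).
Proof.
by move=> c v w; rewrite /lform /= /GRing.scale /=; ring.
Qed.

HB.instance Definition _ a b := GRing.isLinear.Build R (R * R)%type R^o *:%R (lform a b) (lform_is_linear a b).

Lemma norm2_le_norm (w : R * R) : norm2 w <= 2 * `|w|.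
Proof.
have h1 : `|w.1| <= `|w| by rewrite prod_normE le_max lexx.
have h2 : `|w.2| <= `|w| by rewrite prod_normE le_max lexx orbT.
by apply: (le_trans (norm2_le _)); lra.
Qed.

Lemma diff_quad (H : R * R -> R) (x : R * R) (a b C : R) : 0 <= C ->
  (forall w, `|H (x + w) - H x - (a * w.1 + b * w.2)| <= C * norm2 w ^+ 2) ->
  differentiable H x /\ forall v, 'D_v H x = a * v.1 + b * v.2.
Proof.
move=> C0 hH.
have lc : continuous (lform a b : (R * R)%type -> R).
  by move=> y; apply: cvgD; apply: cvgM; [exact: cvg_cst|exact: cvg_fst|exact: cvg_cst|exact: cvg_snd].
have ho : (H : (R * R)%type -> R^o) \o shift x = cst (H x) + (lform a b : (R * R)%type -> R^o) +o_ (0 : (R * R)%type) id.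
  apply/eqaddoP => e e0.
  have d0 : 0 < e / (4 * C + 1) by rewrite divr_gt0// ltr_wpDl// mulr_ge0.
  apply/nbhs_ballP; exists (e / (4 * C + 1)) => // w.
  rewrite -ball_normE /= sub0r normrN => /ltW hw.
  rewrite !fctE /= /lform opprD addrA (addrC w).
  apply: (le_trans (hH w)).
  have n0 := norm2_ge0 w; have n1 := norm2_le_norm w; have w0 := normr_ge0 w.
  move: hw; rewrite ler_pdivlMr; last by rewrite ltr_wpDl// mulr_ge0.
  move=> hw; apply: (@le_trans _ _ (C * (2 * `|w|) ^+ 2)).
    by rewrite ler_wpM2l// ler_sqr ?nnegrE// mulr_ge0.
  have -> : C * (2 * `|w|) ^+ 2 = (`|w| * (4 * C)) * `|w| by ring.
  rewrite ler_wpM2r//; apply: le_trans hw; rewrite ler_wpM2l//; lra.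
have dE := diff_unique lc ho.
have dH : differentiable (H : (R * R)%type -> R^o) x.
  by apply/diff_locallyP; rewrite dE; split.
by split => // v; rewrite deriveE// dE.
Qed.

End linear_form.

Section convolution.
Context {R : realType}.
Implicit Types (x y z w : R * R) (f g : R * R -> R).
Variables (l : R).

Lemma int_ball_supp (phi : R * R -> R) (M r : R) : 0 <= M -> 0 <= r -> measurable_fun setT phi ->
  (forall y, `|phi y| <= M * chi (norm2 y <= r)) ->
  lam.-integrable setT (EFin \o phi) /\ `|Rintegral lam setT phi| <= M * (4 * r ^+ 2).
Proof.
move=> M0 r0 mphi hphi.
have mb : measurable_fun setT (fun y : R * R => chi (norm2 y <= r) : R) by mfun.
have le : (\int[lam]_y `|(phi y)%:E| <= (M * (4 * r ^+ 2))%:E)%E.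
  apply: (@le_trans _ _ (\int[lam]_y (M * chi (norm2 y <= r)%R)%:E)%E).
    have -> : (\int[lam]_y `|(phi y)%:E| = \int[lam]_y (`|phi y|)%:E)%E by [].
    by apply: (ge0_le_int lam) => //; mfun.
  rewrite (ge0_intZ lam mb M0 (fun y => ler0n _ _)) [leRHS]EFinM lee_wpmul2l ?lee_fin//.
  exact: lam_ball_le.
have ip : lam.-integrable setT (EFin \o phi).
  apply/integrableP; split; first by mfun.
  by apply: (le_lt_trans le); rewrite ltry.
split => //; rewrite -lee_fin EFin_normr_Rintegral//.
by apply: le_trans le; apply: le_abse_integral => //; mfun.
Qed.

(** The bump is centred at [x] and evaluated at [y - x]; hence the factors [-1] when [x] is
    differentiated. *)
Definition convol g f x : R := Rintegral lam setT (fun y => g y * f (y - x)).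

Variables (g : R * R -> R) (M r : R).
Hypotheses (M0 : 0 <= M) (r0 : 0 <= r) (mg : measurable_fun setT g)
  (gM : forall y, `|g y| <= M * chi (norm2 y <= r)).

Lemma convol_integrable f x : (exists2 C, 0 <= C & forall z, `|f z| <= C) -> measurable_fun setT f ->
  lam.-integrable setT (EFin \o (fun y => g y * f (y - x))).
Proof.
move=> [C C0 hC] mf; apply: (@int_ball_supp _ (M * C) r _ _ _ _).1 => //.
- by rewrite mulr_ge0.
- by mfun.
by move=> y; rewrite normrM mulrAC ler_pM.
Qed.

Let convolI f x : bumps l f -> lam.-integrable setT (EFin \o (fun y => g y * f (y - x))).
Proof. by move=> bf; apply: convol_integrable; [exact: bumps_bound bf|exact: bumps_meas bf]. Qed.

Lemma convolD f1 f2 x : bumps l f1 -> bumps l f2 ->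
  convol g (fun z => f1 z + f2 z) x = convol g f1 x + convol g f2 x.
Proof.
move=> b1 b2; rewrite /convol -RintegralD//; try exact: convolI.
by apply: eq_Rintegral => y _; rewrite mulrDr.
Qed.

Lemma convolZ f a x : bumps l f -> convol g (fun z => a * f z) x = a * convol g f x.
Proof.
move=> b1; rewrite /convol -RintegralZl//; last exact: convolI.
by apply: eq_Rintegral => y _; rewrite mulrCA.
Qed.

Lemma convol_taylor f : bumps l f -> exists f1 f2, [/\ bumps l f1, bumps l f2 & exists2 C, 0 <= C &
  forall x w, `|convol g f (x + w) - convol g f x - (convol g f1 x * w.1 + convol g f2 x * w.2)| <= C * norm2 w ^+ 2].
Proof.
move=> bf; have [f1 [f2 [b1 b2 [C C0 hC]]]] := bumps_taylor bf.
have b1' := bumps_scale (-1) b1; have b2' := bumps_scale (-1) b2.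
exists (fun z => -1 * f1 z), (fun z => -1 * f2 z); split => //.
exists (M * C * (4 * r ^+ 2)); first by rewrite !mulr_ge0 ?sqr_ge0.
move=> x w; have := bumps_meas bf; have := bumps_meas b1; have := bumps_meas b2 => mf2 mf1 mf.
pose F1 y := g y * f (y - (x + w)); pose F2 y := g y * f (y - x).
pose F3 y := g y * (-1 * f1 (y - x)); pose F4 y := g y * (-1 * f2 (y - x)).
have i1 : lam.-integrable setT (EFin \o F1) by exact: convolI.
have i2 : lam.-integrable setT (EFin \o F2) by exact: convolI.
have i3 : lam.-integrable setT (EFin \o F3) by exact: (convolI x b1').
have i4 : lam.-integrable setT (EFin \o F4) by exact: (convolI x b2').
have i3' : lam.-integrable setT (EFin \o (fun y => F3 y * w.1)).
  have -> : EFin \o (fun y => F3 y * w.1) = (fun y => (w.1%:E * (EFin \o F3) y)%E).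
    by apply/funext => y /=; rewrite EFinM muleC.
  exact: integrableZl.
have i4' : lam.-integrable setT (EFin \o (fun y => F4 y * w.2)).
  have -> : EFin \o (fun y => F4 y * w.2) = (fun y => (w.2%:E * (EFin \o F4) y)%E).
    by apply/funext => y /=; rewrite EFinM muleC.
  exact: integrableZl.
have i12 : lam.-integrable setT (EFin \o (fun y => F1 y - F2 y)).
  have -> : EFin \o (fun y => F1 y - F2 y) = ((EFin \o F1) \- (EFin \o F2))%E by apply/funext.
  exact: integrableB.
have i34 : lam.-integrable setT (EFin \o (fun y => F3 y * w.1 + F4 y * w.2)).
  have -> : EFin \o (fun y => F3 y * w.1 + F4 y * w.2) =
     ((EFin \o (fun y => (F3 y * w.1)%R)) \+ (EFin \o (fun y => (F4 y * w.2)%R)))%E by apply/funext.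
  exact: integrableD.
have -> : convol g f (x + w) - convol g f x -
    (convol g (fun z => -1 * f1 z) x * w.1 + convol g (fun z => -1 * f2 z) x * w.2) =
  Rintegral lam setT (fun y => F1 y - F2 y - (F3 y * w.1 + F4 y * w.2)).
  by rewrite RintegralB// RintegralB// RintegralD// !RintegralZr.
have -> : M * C * (4 * r ^+ 2) * norm2 w ^+ 2 = M * (C * norm2 w ^+ 2) * (4 * r ^+ 2) by ring.
apply: (@int_ball_supp _ (M * (C * norm2 w ^+ 2)) r _ _ _ _).2 => //.
- by rewrite mulr_ge0// mulr_ge0// sqr_ge0.
- by rewrite /F1 /F2 /F3 /F4; mfun.
move=> y; have -> : F1 y - F2 y - (F3 y * w.1 + F4 y * w.2) =
    g y * (f (y - x + (- w)) - f (y - x) - (f1 (y - x) * (- w).1 + f2 (y - x) * (- w).2)).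
  by rewrite /F1 /F2 /F3 /F4 opprD addrA /=; ring.
by rewrite normrM mulrAC ler_pM// -(norm2N w).
Qed.

Lemma convol_lip f : bumps l f -> exists2 C, 0 <= C & forall x y, `|convol g f y - convol g f x| <= C * norm2 (y - x).
Proof.
move=> bf; have [C C0 hC] := bumps_lip bf; have mf := bumps_meas bf.
exists (M * C * (4 * r ^+ 2)); first by rewrite !mulr_ge0 ?sqr_ge0.
move=> x y; rewrite /convol -RintegralB//; try exact: convolI.
rewrite mulrAC; apply: (@int_ball_supp _ (M * C * norm2 (y - x)) r _ _ _ _).2 => //.
- by rewrite mulr_ge0 ?norm2_ge0// mulr_ge0.
- by mfun.
move=> z; rewrite -mulrBr normrM -(mulrA M) mulrAC ler_pM//.
have := hC (z - x) (x - y); rewrite addrA subrK norm2BC; exact.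
Qed.

(** Every derivative falls on the bump and [bumps] contains it, so the induction on the list of
    directions never leaves the functions [convol g h]. *)
Lemma convol_smooth f : bumps l f -> smooth (convol g f).
Proof.
move=> bf vs x.
have step f' : bumps l f' -> differentiable (convol g f') x /\
    forall v, exists2 h, bumps l h & 'D_v (convol g f') = convol g h.
  move=> bf'; have [f1 [f2 [b1 b2 [C C0 hC]]]] := convol_taylor bf'.
  split; first exact: (diff_quad C0 (hC x)).1.
  move=> v; exists (fun z => v.1 * f1 z + v.2 * f2 z).
    by apply: bumps_add; exact: bumps_scale.
  apply/funext => y; rewrite (diff_quad C0 (hC y)).2 convolD; try exact: bumps_scale.
  by rewrite !convolZ// ![_ * v.1]mulrC ![_ * v.2]mulrC.
suff [h bh ->] : exists2 h, bumps l h & Defs.iterD vs (convol g f) = convol g h by exact: (step h bh).1.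
elim: vs => [|v vs [h bh ih]] /=; first by exists f.
have [h' bh' e] := (step h bh).2 v; exists h' => //.
by rewrite ih -e; apply/funext.
Qed.

End convolution.

(** * Logarithmic cutoffs and deformations of the plane *)

Section log_estimates.
Context {R : realType}.

Lemma ln_le_subr1 (x : R) : 0 < x -> ln x <= x - 1.
Proof.
move=> x0; have := expR_ge1Dx (ln x); rewrite lnK ?posrE//; lra.
Qed.

Lemma sqrt1D_lip (a b : R) : 0 <= a -> a <= b ->
  Num.sqrt (1 + b ^+ 2) - Num.sqrt (1 + a ^+ 2) <= b - a.
Proof.
move=> a0 ab; have b0 : 0 <= b by exact: le_trans ab.
have p (x : R) : 0 < 1 + x ^+ 2 by rewrite ltr_pwDl// sqr_ge0.
have q (x : R) : 0 <= x -> x <= Num.sqrt (1 + x ^+ 2).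
  by move=> x0; rewrite -[leLHS](ger0_norm x0) -sqrtr_sqr ler_wsqrtr// lerDr.
have e (x : R) : Num.sqrt (1 + x ^+ 2) ^+ 2 = 1 + x ^+ 2 by rewrite sqr_sqrtr// ltW.
have ea := e a; have eb := e b; have qa := q a a0; have qb := q b b0.
have sa : 0 < Num.sqrt (1 + a ^+ 2) by rewrite sqrtr_gt0.
have sb : 0 < Num.sqrt (1 + b ^+ 2) by rewrite sqrtr_gt0.
move: ea eb qa qb sa sb; move: (Num.sqrt _) (Num.sqrt _) => B A ea eb qa qb sa sb.
have h : (B - A) * (B + A) <= (b - a) * (B + A).
  have -> : (B - A) * (B + A) = (b - a) * (b + a) by rewrite -!subr_sqr eb ea; ring.
  by rewrite ler_wpM2l ?subr_ge0// lerD.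
by move: h; rewrite ler_pM2r// addr_gt0.
Qed.

Lemma ln1D_lip (a b : R) : 0 <= a -> a <= b ->
  0 <= ln (1 + b ^+ 2) - ln (1 + a ^+ 2) <= 2 * ((b - a) / Num.sqrt (1 + a ^+ 2)).
Proof.
move=> a0 ab; have b0 : 0 <= b by exact: le_trans ab.
have p (x : R) : 0 < 1 + x ^+ 2 by rewrite ltr_pwDl// sqr_ge0.
have sp (x : R) : 0 < Num.sqrt (1 + x ^+ 2) by rewrite sqrtr_gt0.
apply/andP; split; first by rewrite subr_ge0 ler_ln ?posrE// lerD2l ler_sqr.
have e (x : R) : ln (1 + x ^+ 2) = 2 * ln (Num.sqrt (1 + x ^+ 2)).
  by rewrite -lnXR// sqr_sqrtr// ltW.
rewrite !e -mulrBr ler_wpM2l// -ln_div ?posrE//.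
apply: (le_trans (ln_le_subr1 _)); first by rewrite divr_gt0.
have -> : Num.sqrt (1 + b ^+ 2) / Num.sqrt (1 + a ^+ 2) - 1 =
    (Num.sqrt (1 + b ^+ 2) - Num.sqrt (1 + a ^+ 2)) / Num.sqrt (1 + a ^+ 2).
  by rewrite mulrBl divff ?gt_eqF.
by rewrite ler_wpM2r ?invr_ge0 ?(ltW (sp _))// sqrt1D_lip.
Qed.

End log_estimates.

Section deformation.
Context {R : realType} (k d rho : R).
Hypotheses (d0 : 0 < d) (rho0 : 0 < rho) (hrho : 2 <= d * ln (1 + rho ^+ 2)).
Implicit Types (x y : R * R).

Let E := norm2 (1, k : R).
Definition nsq x := 1 + dot2 x x.
(** Equal to [1] while [ln (1 + |x|^2) <= 1 / d] and to [0] once it reaches [2 / d], hence beyond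
    radius [rho] by [hrho]. Its slope is of order [d / |x|]. *)
Definition logcut x := prof (d * ln (nsq x)).
(** The derivative of [logcut] in the direction [(1, k)]. *)
Definition dlogcut x := dprof (d * ln (nsq x)) * (d * ((2 * x.1 + 2 * k * x.2) / nsq x)).
(** Up to the square of [8 * d], a majorant of the squared slope of [logcut]. *)
Definition logweight x : R := chi (norm2 x < rho) / nsq x.

Lemma nsqE x : nsq x = 1 + norm2 x ^+ 2. Proof. by rewrite sqr_norm2. Qed.

Lemma nsq_ge1 x : 1 <= nsq x. Proof. by rewrite lerDl dot2_ge0. Qed.

Lemma nsq_gt0 x : 0 < nsq x. Proof. exact: lt_le_trans (nsq_ge1 x). Qed.

Lemma logweight_ge0 x : 0 <= logweight x. Proof. by rewrite divr_ge0// ltW// nsq_gt0. Qed.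

Let far x : rho <= norm2 x -> 2 <= d * ln (nsq x).
Proof.
move=> h; apply: (le_trans hrho); rewrite ler_pM2l// nsqE ler_ln ?posrE ?ltr_pwDl ?sqr_ge0//.
by rewrite lerD2l ler_sqr ?nnegrE ?norm2_ge0// ltW.
Qed.

Lemma logcut_eq0 x : rho <= norm2 x -> logcut x = 0.
Proof. by move=> /far; exact: prof_eq0. Qed.

Lemma dlogcut_eq0 x : rho <= norm2 x -> dlogcut x = 0.
Proof. by move=> /far h; rewrite /dlogcut dprof_eq0// mul0r. Qed.

Lemma logcut_eq1 x : d * ln (nsq x) <= 1 -> logcut x = 1.
Proof. exact: prof_eq1. Qed.

Lemma logcut_ge0 x : 0 <= logcut x. Proof. exact: prof_ge0. Qed.
Lemma logcut_le1 x : logcut x <= 1. Proof. exact: prof_le1. Qed.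

Let logcut_lip0 x y : norm2 x <= norm2 y ->
  `|logcut y - logcut x| <= 8 * d * norm2 (y - x) / Num.sqrt (nsq x).
Proof.
move=> xy; apply: (le_trans (prof_lip _ _)).
have /andP[h1 h2] := ln1D_lip (norm2_ge0 x) xy.
rewrite -mulrBr !nsqE normrM (gtr0_norm d0) (ger0_norm h1).
have h3 : norm2 y - norm2 x <= norm2 (y - x).
  by have := norm2_dist y x 0; rewrite !subr0; lra.
have s0 : 0 <= (Num.sqrt (1 + norm2 x ^+ 2))^-1 by rewrite invr_ge0 sqrtr_ge0.
have h4 : (norm2 y - norm2 x) / Num.sqrt (1 + norm2 x ^+ 2) <= norm2 (y - x) / Num.sqrt (1 + norm2 x ^+ 2).
  by rewrite ler_wpM2r.
have h5 : ln (1 + norm2 y ^+ 2) - ln (1 + norm2 x ^+ 2) <= 2 * (norm2 (y - x) / Num.sqrt (1 + norm2 x ^+ 2)) by lra.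
have -> : 8 * d * norm2 (y - x) / Num.sqrt (1 + norm2 x ^+ 2) =
  4 * (d * (2 * (norm2 (y - x) / Num.sqrt (1 + norm2 x ^+ 2)))) by ring.
by rewrite ler_wpM2l// ler_wpM2l// ltW.
Qed.

Lemma logcut_lip x y : `|logcut y - logcut x| <= 8 * d * norm2 (y - x).
Proof.
have key a b : norm2 a <= norm2 b -> `|logcut b - logcut a| <= 8 * d * norm2 (b - a).
  move=> ab; apply: (le_trans (logcut_lip0 ab)).
  rewrite ler_piMr ?mulr_ge0 ?norm2_ge0 ?(ltW d0)// invf_le1 ?sqrtr_gt0 ?nsq_gt0//.
  by rewrite -{1}sqrtr1 ler_wsqrtr// nsq_ge1.
have [/key//|/ltW/key] := leP (norm2 x) (norm2 y).
by rewrite distrC norm2BC.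
Qed.

(** The logarithm grows radially, and its increment between two radii is governed by the smaller
    one. So the weight of the point nearer to the origin suffices, and the sum of both weights makes
    the bound symmetric. *)
Lemma logcut_diff_sqr x y : (logcut y - logcut x) ^+ 2 <= (8 * d) ^+ 2 * norm2 (y - x) ^+ 2 * (logweight x + logweight y).
Proof.
have key a b : norm2 a <= norm2 b -> (logcut b - logcut a) ^+ 2 <= (8 * d) ^+ 2 * norm2 (b - a) ^+ 2 * (logweight a + logweight b).
  move=> ab; have c0 : 0 <= (8 * d) ^+ 2 * norm2 (b - a) ^+ 2 by rewrite mulr_ge0// sqr_ge0.
  have [ra|ra] := leP rho (norm2 a).
    rewrite !logcut_eq0 ?(le_trans ra ab)// subrr expr0n/= mulr_ge0// addr_ge0// logweight_ge0//.
  apply: (@le_trans _ _ ((8 * d) ^+ 2 * norm2 (b - a) ^+ 2 * logweight a)); last first.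
    by rewrite ler_wpM2l// lerDl logweight_ge0.
  rewrite /logweight ra mul1r -(real_normK (num_real (_ - _))).
  have -> : (8 * d) ^+ 2 * norm2 (b - a) ^+ 2 / nsq a = (8 * d * norm2 (b - a) / Num.sqrt (nsq a)) ^+ 2.
    by rewrite -[in LHS](sqr_sqrtr (ltW (nsq_gt0 a))); field; rewrite gt_eqF// sqrtr_gt0 nsq_gt0.
  rewrite ler_sqr ?nnegrE ?logcut_lip0//.
  by rewrite divr_ge0 ?sqrtr_ge0// mulr_ge0 ?norm2_ge0// mulr_ge0// ltW.
have [/key//|/ltW/key] := leP (norm2 x) (norm2 y).
move=> h; have -> : (logcut y - logcut x) ^+ 2 = (logcut x - logcut y) ^+ 2 by ring.
by rewrite norm2BC (addrC (logweight x)).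
Qed.

Lemma dir_bound x : `|2 * x.1 + 2 * k * x.2| <= 2 * E * norm2 x.
Proof.
rewrite -mulrA -mulrDr normrM ger0_norm// -mulrA ler_wpM2l//.
have p0 : 0 <= E * norm2 x by rewrite mulr_ge0// norm2_ge0.
rewrite -ler_sqr ?nnegrE// real_normK ?num_real// exprMn !sqr_norm2 /dot2 /=.
have := sqr_ge0 (k * x.1 - x.2); nra.
Qed.

Lemma dlogcut_sqr x : dlogcut x ^+ 2 <= (8 * d * E) ^+ 2 * logweight x.
Proof.
have E0 : 0 <= E by exact: norm2_ge0.
have [h|h] := leP rho (norm2 x).
  by rewrite dlogcut_eq0// expr0n/= mulr_ge0 ?sqr_ge0 ?logweight_ge0.
rewrite /logweight h mul1r.
have b : `|dlogcut x| <= 8 * d * E * (norm2 x / nsq x).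
  rewrite /dlogcut normrM.
  have -> : 8 * d * E * (norm2 x / nsq x) = 4 * (d * (2 * E * norm2 x / nsq x)) by ring.
  rewrite ler_pM// ?dprof_bound// normrM (gtr0_norm d0) ler_wpM2l ?(ltW d0)//.
  by rewrite normrM normfV (gtr0_norm (nsq_gt0 x)) ler_wpM2r ?invr_ge0 ?(ltW (nsq_gt0 _))// dir_bound.
rewrite -(real_normK (num_real (dlogcut x))).
apply: (@le_trans _ _ ((8 * d * E * (norm2 x / nsq x)) ^+ 2)).
  by rewrite ler_sqr ?nnegrE// (le_trans _ b).
rewrite exprMn ler_wpM2l ?sqr_ge0//.
have n1 := nsq_gt0 x; rewrite exprMn exprVn ler_pdivrMr ?exprn_gt0//.
have -> : (nsq x)^-1 * nsq x ^+ 2 = nsq x by field; rewrite gt_eqF.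
by rewrite nsqE lerDr.
Qed.

Lemma dlogcut_bound x : `|dlogcut x| <= 8 * d * E.
Proof.
have c0 : 0 <= 8 * d * E by rewrite mulr_ge0 ?norm2_ge0// mulr_ge0// ltW.
rewrite -ler_sqr ?nnegrE// real_normK ?num_real//; apply: (le_trans (dlogcut_sqr x)).
rewrite ler_piMr ?sqr_ge0// /logweight ler_pdivrMr ?nsq_gt0// mul1r.
by apply: le_trans (nsq_ge1 x); case: (_ < _).
Qed.

Lemma is_derive_logcut (b a : R) :
  is_derive a (1 : R) (fun a => logcut (a, b + k * a)) (dlogcut (a, b + k * a)).
Proof.
pose N (a : R) : R := 1 + (a ^+ 2 + (b + k * a) ^+ 2).
have NE a' : nsq (a', b + k * a') = N a' by rewrite /nsq /dot2 /N /= !expr2.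
have N0 : 0 < N a by rewrite -NE nsq_gt0.
have dN : is_derive a (1 : R) N (2 * a + 2 * k * (b + k * a)).
  apply: (@is_derive_quad _ _ _ _ (1 + k ^+ 2)) => h.
  have -> : N (a + h) - N a - (2 * a + 2 * k * (b + k * a)) * h = (1 + k ^+ 2) * h ^+ 2.
    by rewrite /N; ring.
  by rewrite ger0_norm// mulr_ge0 ?sqr_ge0// addr_ge0// sqr_ge0.
have dl := @is_derive1_comp _ (@ln R) N a _ _ (is_derive1_ln N0) dN.
have dd : is_derive (ln (N a)) (1 : R) (fun t => d * t) d by apply: is_derive_affine => h; rewrite mulrDr.
have d2 := @is_derive1_comp _ (fun t => d * t) (@ln R \o N) a _ _ dd dl.
have d3 := @is_derive1_comp _ prof ((fun t => d * t) \o (@ln R \o N)) a _ _ (is_derive_prof _) d2.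
rewrite (_ : (fun a => _) = prof \o ((fun t => d * t) \o (@ln R \o N))); last first.
  by apply/funext => a' /=; rewrite /logcut NE.
apply: (is_derive_eq d3); rewrite /dlogcut NE /=.
by rewrite (mulrC (N a)^-1).
Qed.

Lemma dlogcut_continuous (b : R) : continuous (fun a => dlogcut (a, b + k * a)).
Proof.
have cid : continuous (fun a : R => a) by move=> x; exact: cvg_id.
have caf : continuous (fun a : R => b + k * a).
  by move=> x; apply: cvgD; [exact: cvg_cst|apply: cvgM; [exact: cvg_cst|exact: cid]].
have cN : continuous (fun a => nsq (a, b + k * a)).
  move=> x; rewrite /nsq /dot2 /=; apply: cvgD; first exact: cvg_cst.
  by apply: cvgD; apply: cvgM; [exact: cid|exact: cid|exact: caf|exact: caf].
move=> x; rewrite /dlogcut; apply: cvgM.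
  apply: (@continuous_comp _ _ _ (fun a => d * ln (nsq (a, b + k * a))) dprof).
    apply: cvgM; first exact: cvg_cst.
    apply: (@continuous_comp _ _ _ (fun a => nsq (a, b + k * a)) (@ln R)); first exact: cN.
    by apply: continuous_ln; exact: nsq_gt0.
  exact: dprof_continuous.
apply: cvgM; first exact: cvg_cst.
apply: cvgM; last by apply: cvgV; [rewrite gt_eqF ?nsq_gt0|exact: cN].
apply: cvgD; first by apply: cvgM; [exact: cvg_cst|exact: cid].
by apply: cvgM; [exact: cvg_cst|exact: caf].
Qed.

Lemma cont2_logcut x : cont2 logcut x.
Proof. by apply: (@cont2_lip _ (8 * d)) => y; exact: logcut_lip. Qed.

Lemma measurable_logcut : measurable_fun setT logcut.
Proof. by apply: cont2_measurable; exact: cont2_logcut. Qed.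

Lemma measurable_nsq : measurable_fun setT nsq.
Proof. by rewrite /nsq /dot2; mfun. Qed.

Lemma measurable_logweight : measurable_fun setT logweight.
Proof.
have mn := measurable_nsq; rewrite /logweight; mfun.
by apply: measurable_invf => // x; rewrite ltW// nsq_gt0.
Qed.

Lemma measurable_dlogcut : measurable_fun setT dlogcut.
Proof.
have mn := measurable_nsq; rewrite /dlogcut; apply: measurable_funM.
  apply: (measurableT_comp (continuous_measurable_fun dprof_continuous)).
  apply: measurable_funM; first exact: measurable_cst.
  by apply: (measurableT_comp _ mn); exact: measurable_ln.
mfun; by apply: measurable_invf => // x; rewrite ltW// nsq_gt0.
Qed.

Section map.
Variables (t : R).
Hypothesis (ht : 8 * d * E * `|t| <= 4^-1).

(** Where [logcut] is [1] this is the translation by [(t, t * k)], and beyond radius [rho] the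
    identity. Points stay on their line of direction [(1, k)], so [deformJ], the derivative along
    that line, is the Jacobian. *)
Definition deform x : R * R := (x.1 + t * logcut x, x.2 + k * (t * logcut x)).
Definition deformJ x : R := 1 + t * dlogcut x.

Lemma jac_ge x : 3 / 4 <= deformJ x.
Proof.
have h : `|t * dlogcut x| <= 4^-1.
  by rewrite normrM mulrC; apply: le_trans ht; rewrite ler_wpM2r// dlogcut_bound.
by move: h; rewrite ler_norml /deformJ => /andP[]; lra.
Qed.

Lemma jac_ge0 x : 0 <= deformJ x.
Proof. by apply: le_trans (jac_ge x); rewrite divr_ge0. Qed.

Lemma defo_diff x y : norm2 (deform y - deform x - (y - x)) <= 4^-1 * norm2 (y - x).
Proof.
have -> : deform y - deform x - (y - x) = (t * (logcut y - logcut x) * 1, t * (logcut y - logcut x) * k).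
  by rewrite /deform; congr pair; rewrite /=; ring.
rewrite (norm2_scale (t * (logcut y - logcut x)) (1, k)) normrM -/E.
have h := logcut_lip x y; have n0 := norm2_ge0 (y - x).
have E0 : 0 <= E by exact: norm2_ge0.
apply: (@le_trans _ _ (8 * d * E * `|t| * norm2 (y - x))); last by rewrite ler_wpM2r.
have -> : 8 * d * E * `|t| * norm2 (y - x) = `|t| * (8 * d * norm2 (y - x)) * E by ring.
by rewrite ler_wpM2r// ler_wpM2l.
Qed.

Lemma defo_expand x y : norm2 (y - x) <= 2 * norm2 (deform y - deform x).
Proof.
have h := defo_diff x y.
have e : (deform y - deform x) + - (deform y - deform x - (y - x)) = y - x.
  by rewrite opprB addrCA subrr addr0.
have := le_norm2D (deform y - deform x) (- (deform y - deform x - (y - x))).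
rewrite e norm2N; have := norm2_ge0 (deform y - deform x); lra.
Qed.

Lemma defo_inj x y : deform x = deform y -> x = y.
Proof.
move=> e; have := defo_expand y x; rewrite e subrr norm2_0 mulr0 => h.
by apply/eqP; rewrite -subr_eq0 -norm2_eq0 eq_le h norm2_ge0.
Qed.

Let line b a := a + t * logcut (a, b + k * a).

Let is_derive_line b a : is_derive a (1 : R) (line b) (deformJ (a, b + k * a)).
Proof.
have h1 : is_derive a (1 : R) (fun a : R => a) 1 by apply: is_derive_affine => h; rewrite mul1r.
have h2 : is_derive (logcut (a, b + k * a)) (1 : R) (fun u => t * u) t.
  by apply: is_derive_affine => h; rewrite mulrDr.
have h3 := @is_derive1_comp _ (fun u => t * u) (fun a => logcut (a, b + k * a)) a _ _ h2 (is_derive_logcut b a).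
exact: (is_deriveD h1 h3).
Qed.

Let line_mono b : {mono line b : x y / x <= y}.
Proof.
apply: le_mono => x y xy; have [c [_ h]] := mean_value x y (is_derive_line b).
rewrite -subr_gt0 h mulr_gt0 ?subr_gt0//.
by apply: lt_le_trans (jac_ge _); rewrite divr_gt0.
Qed.

Let line_surj (b y : R) : exists a, line b a = y.
Proof.
have cl : continuous (line b) by exact: is_derive_cont (is_derive_line b).
have h a : `|line b a - a| <= `|t|.
  by rewrite /line addrAC subrr add0r normrM ler_piMr// ger0_norm ?logcut_ge0// logcut_le1.
have := h (y - `|t|); have := h (y + `|t|); rewrite !ler_norml => /andP[h1 h2] /andP[h3 h4].
have le : y - `|t| <= y + `|t| by have := normr_ge0 t; lra.
have [||c _ <-] := @IVT R (line b) _ _ y le; [exact: continuous_subspaceT| |by exists c].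
by rewrite ge_min le_max; apply/andP; split; apply/orP; [left|right]; lra.
Qed.

Lemma defo_surj x : exists y, deform y = x.
Proof.
have [a ha] := line_surj (x.2 - k * x.1) x.1.
exists (a, x.2 - k * x.1 + k * a); rewrite /deform /= [RHS]surjective_pairing.
move: ha; rewrite /line => ha; congr pair => //.
by rewrite -addrA -mulrDr ha subrK.
Qed.

Lemma lam_shear (G : R * R -> \bar R) : measurable_fun setT G -> (forall x, (0 <= G x)%E) ->
  (\int[lam]_x G x = \int[@lebesgue_measure R]_b \int[@lebesgue_measure R]_a G (a, b + k * a)%R)%E.
Proof.
move=> mG G0; rewrite (lam_tonelli mG G0).
have ms : measurable_fun setT (fun x : R * R => (x.1, x.2 + k * x.1)) by mfun.
have mG' : measurable_fun setT (fun x => G (x.1, x.2 + k * x.1)) := measurableT_comp mG ms.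
rewrite -(lam_tonelliC mG' (fun x => G0 _)) (lam_tonelli mG' (fun x => G0 _)).
apply: eq_integral => a _ /=.
rewrite (@ge0_integral_shift R (k * a) (fun b => G (a, b)))//.
by apply: (measurable_slice (T1 := measurableTypeR R) (T2 := measurableTypeR R)).
Qed.

(** Shear coordinates [(a, b + k * a)] preserve area and turn the lines of direction [(1, k)] into
    coordinate lines; on each of them the map is increasing, onto and continuously
    differentiable. *)
Lemma defo_change (G : R * R -> \bar R) : measurable_fun setT G -> (forall x, (0 <= G x)%E) ->
  (\int[lam]_x G x = \int[lam]_x (G (deform x) * (deformJ x)%:E))%E.
Proof.
move=> mG G0.
have me := measurable_logcut; have mde := measurable_dlogcut.
have md : measurable_fun setT deform by rewrite /deform; mfun.
have mj : measurable_fun setT deformJ by rewrite /deformJ; mfun.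
have mGd : measurable_fun setT (fun x => G (deform x)) := measurableT_comp mG md.
have mH : measurable_fun setT (fun x => (G (deform x) * (deformJ x)%:E)%E).
  by apply: emeasurable_funM => //; apply/measurable_EFinP.
have H0 x : (0 <= G (deform x) * (deformJ x)%:E)%E by rewrite mule_ge0// lee_fin jac_ge0.
rewrite (lam_shear mG G0) (lam_shear mH H0); apply: eq_integral => b _.
have ms : measurable_fun setT (fun a : measurableTypeR R => (a, b + k * a) : measurableTypeR R * measurableTypeR R).
  by mfun.
have cj : continuous (fun a => deformJ (a, b + k * a)).
  move=> a; apply: cvgD; first exact: cvg_cst.
  by apply: cvgM; [exact: cvg_cst|exact: dlogcut_continuous].
have := @ge0_substitution R (line b) (fun a => deformJ (a, b + k * a)) (fun a => G (a, b + k * a))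
  (is_derive_line b) cj (fun a => jac_ge0 _) (line_mono b) (line_surj b) (measurableT_comp mG ms) (fun a => G0 _).
move=> ->; apply: eq_integral => a _.
by rewrite /deform /line /= mulrDr addrA.
Qed.

End map.

End deformation.

(** * Minimality against continuous competitors *)

Section averaging.
Context {R : realType}.
Implicit Types (x y z w v : R * R) (f g : R * R -> R).

Lemma Rint_shift f x : measurable_fun setT f ->
  Rintegral lam setT (fun w => f (w + x)) = Rintegral lam setT f.
Proof.
move=> mf.
have E (h : R * R -> R) : Rintegral lam setT h =
    fine (\int[lam]_y (Num.max (h y) 0)%:E - \int[lam]_y (Num.max (- h y) 0)%:E)%E.
  by rewrite /Rintegral integralE; congr (fine (_ - _)%E); apply: eq_integral => y _;
    rewrite ?funeposE ?funenegE /= EFin_max.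
have mp : measurable_fun setT (fun y => (Num.max (f y) 0)%:E) by mfun.
have mn : measurable_fun setT (fun y => (Num.max (- f y) 0)%:E) by mfun.
have pp y : (0 <= (Num.max (f y) 0)%:E)%E by rewrite lee_fin le_max lexx orbT.
have pn y : (0 <= (Num.max (- f y) 0)%:E)%E by rewrite lee_fin le_max lexx orbT.
by rewrite !E; congr (fine (_ - _)%E); [exact: (lam_shift x mp pp)|exact: (lam_shift x mn pn)].
Qed.

Lemma bump1_low (t : R) : `|t| <= 2^-1 -> expR (- 4) <= bump1 1 1 t.
Proof.
rewrite ler_norml => /andP[h1 h2]; rewrite /bump1 /flat !ifT; [|lra|lra].
have h1' (x : R) : (1 : {poly R}).[x] = 1 by rewrite -polyC1 hornerC.
rewrite !h1' !mul1r -expRD ler_expR.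
have h3 : (1 + t)^-1 <= 2 by rewrite invf_ple ?posrE; lra.
have h4 : (1 - t)^-1 <= 2 by rewrite invf_ple ?posrE; lra.
lra.
Qed.

Lemma mollifier (l : R) : 0 < l -> exists k : R * R -> R, [/\ bumps l k, forall z, 0 <= k z,
  forall z, 2 / l <= norm2 z -> k z = 0 & (\int[lam]_z (k z)%:E = 1)%E].
Proof.
move=> l0.
pose b z : R := 1 * (bump1 1 1 (l * z.1) * bump1 1 1 (l * z.2)).
have bb : bumps l b by exact: bumps_one.
have b0 z : 0 <= b z by rewrite /b mul1r mulr_ge0 ?bump1_ge0.
have bs z : 2 / l <= norm2 z -> b z = 0.
  rewrite ler_pdivrMr// => h; apply: (bumps_supp bb).
  have [h1|h1] := leP 1 `|l * z.1|; [by left|right].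
  have := norm2_le z; move: h1; rewrite !normrM (gtr0_norm l0) => h1 h2; nra.
have mb := bumps_meas bb; have [C C0 hC] := bumps_bound bb.
have r0 : 0 <= 2 / l by rewrite divr_ge0// ltW.
have [ib _] := @int_ball_supp R b C (2 / l) C0 r0 mb ltac:(
  move=> z; case: (leP (norm2 z) (2 / l)) => [_|/ltW/bs ->]; [by rewrite mulr1|by rewrite normr0 mulr0]).
pose I := Rintegral lam setT b.
have IE : (\int[lam]_z (b z)%:E = I%:E)%E.
  by rewrite /I /Rintegral fineK//; exact: integrable_fin_num ib.
have I0 : 0 < I.
  rewrite -lte_fin -IE.
  pose B : set (R * R) := [set` `[0, (2 * l)^-1]] `*` [set` `[0, (2 * l)^-1]].
  have mB : measurable B by exact: measurableX.
  have l2 : 0 < (2 * l)^-1 by rewrite invr_gt0 mulr_gt0.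
  have c0 : 0 <= expR (- 4) * expR (- 4) :> R by rewrite mulr_ge0 ?expR_ge0.
  have mI : measurable_fun setT (fun z : R * R => \1_B z : R) by exact: measurable_indic.
  have i0 z : 0 <= \1_B z :> R by rewrite indicE.
  apply: (@lt_le_trans _ _ (\int[lam]_z (expR (- 4) * expR (- 4) * \1_B z)%:E)%E).
    rewrite (ge0_intZ lam mI c0 i0) lam_indic// lam_box ?(ltW l2)// subr0 -EFinM lte_fin.
    by rewrite !mulr_gt0 ?expR_gt0.
  apply: (ge0_le_int lam) => //; first by mfun.
  move=> z; rewrite indicE; have [/set_mem|_] := boolP (z \in B); last by rewrite mulr0.
  rewrite /B /= !in_itv/= => -[/andP[h1 h2] /andP[h3 h4]].
  have key (a : R) : 0 <= a -> a <= (2 * l)^-1 -> expR (- 4) <= bump1 1 1 (l * a).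
    move=> a0 al; apply: bump1_low; rewrite ger0_norm ?mulr_ge0 ?(ltW l0)//.
    apply: (le_trans (ler_wpM2l (ltW l0) al)).
    by rewrite le_eqVlt; apply/orP; left; apply/eqP; field; rewrite gt_eqF.
  by rewrite mulr1 /b mul1r ler_pM ?expR_ge0 ?key.
exists (fun z => I^-1 * b z); split.
- exact: bumps_scale.
- by move=> z; rewrite mulr_ge0// invr_ge0 ltW.
- by move=> z /bs ->; rewrite mulr0.
have Ii : 0 <= I^-1 by rewrite invr_ge0 ltW.
by rewrite (ge0_intZ lam mb Ii b0) IE -EFinM mulVf// gt_eqF.
Qed.

Section kernel.
Variables (k : R * R -> R) (mk : measurable_fun setT k) (k0 : forall z, 0 <= k z)
  (k1 : (\int[lam]_z (k z)%:E = 1)%E).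

Lemma bounded_integrable (phi : R * R -> R) (M : R) : measurable_fun setT phi -> 0 <= M ->
  (forall z, `|phi z| <= M) -> lam.-integrable setT (EFin \o (fun w => phi w * k w)).
Proof.
move=> mphi M0 hM; apply/integrableP; split; first by mfun.
apply: (@le_lt_trans _ _ (\int[lam]_z (M * k z)%:E)%E).
  have -> : (\int[lam]_x `|(EFin \o (fun w => (phi w * k w)%R)) x| = \int[lam]_x (`|phi x * k x|)%:E)%E by [].
  apply: (ge0_le_int lam) => //; [by mfun|by mfun|].
  by move=> z; rewrite normrM (ger0_norm (k0 z)) ler_wpM2r.
by rewrite (ge0_intZ lam mk M0 k0) k1 mule1 ltry.
Qed.

Lemma Rint_k : Rintegral lam setT k = 1.
Proof. by rewrite /Rintegral k1. Qed.

Lemma k_integrable : lam.-integrable setT (EFin \o k).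
Proof. by apply: ge0_integrable => //; rewrite k1 ltry. Qed.

Lemma avg_dist (phi : R * R -> R) (M c e : R) : measurable_fun setT phi -> 0 <= M ->
  (forall z, `|phi z| <= M) -> (forall z, k z != 0 -> `|phi z - c| <= e) ->
  `|Rintegral lam setT (fun w => phi w * k w) - c| <= e.
Proof.
move=> mphi M0 hM he; have ip := bounded_integrable mphi M0 hM.
have key (psi : R * R -> R) (a : R) : lam.-integrable setT (EFin \o (fun w => psi w * k w)) ->
    (forall z, k z != 0 -> psi z <= a) -> Rintegral lam setT (fun w => psi w * k w) <= a.
  move=> ipsi hpsi; rewrite -[leRHS]mulr1 -Rint_k -RintegralZl//; last exact: k_integrable.
  apply: le_Rintegral => //.
    have -> : EFin \o (fun x => a * k x) = (fun x => (a%:E * (EFin \o k) x)%E) by apply/funext.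
    by apply: integrableZl => //; exact: k_integrable.
  by move=> z _; have [->|kz] := eqVneq (k z) 0; rewrite ?mulr0// ler_wpM2r// hpsi.
rewrite ler_norml; apply/andP; split; last first.
  by rewrite lerBlDr; apply: key => // z kz; have := he z kz; rewrite ler_norml => /andP[]; lra.
have iN : lam.-integrable setT (EFin \o (fun w => (- phi w) * k w)).
  by apply: (@bounded_integrable _ M) => //; [mfun|move=> z; rewrite normrN].
have := key (fun w => - phi w) (e - c) iN.
have -> : Rintegral lam setT (fun w => - phi w * k w) = - Rintegral lam setT (fun w => phi w * k w).
  rewrite -mulN1r -RintegralZl//; apply: eq_Rintegral => z _; rewrite mulN1r mulNr//.
move=> h; have := h ltac:(move=> z kz; have := he z kz; rewrite ler_norml => /andP[]; lra); lra.
Qed.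

Lemma jensen_sqr (phi : R * R -> R) (M : R) : measurable_fun setT phi -> 0 <= M ->
  (forall z, `|phi z| <= M) ->
  ((Rintegral lam setT (fun w => phi w * k w) ^+ 2)%:E <= \int[lam]_w (phi w ^+ 2 * k w)%:E)%E.
Proof.
move=> mphi M0 hM; set A := Rintegral _ _ _.
have ip := bounded_integrable mphi M0 hM.
have i2 : lam.-integrable setT (EFin \o (fun w => phi w ^+ 2 * k w)).
  apply: (@bounded_integrable _ (M ^+ 2)); [by mfun|exact: sqr_ge0|].
  by move=> z; rewrite normrX ler_sqr ?nnegrE.
have i3 : lam.-integrable setT (EFin \o (fun w => 2 * A * (phi w * k w))).
  have -> : EFin \o (fun w => 2 * A * (phi w * k w)) = (fun w => ((2 * A)%:E * (EFin \o (fun w => (phi w * k w)%R)) w)%E) by apply/funext.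
  exact: integrableZl.
have i4 : lam.-integrable setT (EFin \o (fun w => A ^+ 2 * k w)).
  have -> : EFin \o (fun w => A ^+ 2 * k w) = (fun w => ((A ^+ 2)%:E * (EFin \o k) w)%E) by apply/funext.
  by apply: integrableZl => //; exact: k_integrable.
have -> : (\int[lam]_w (phi w ^+ 2 * k w)%:E = (Rintegral lam setT (fun w => phi w ^+ 2 * k w))%:E)%E.
  by rewrite /Rintegral fineK//; exact: integrable_fin_num i2.
rewrite lee_fin.
have -> : A ^+ 2 = Rintegral lam setT (fun w => 2 * A * (phi w * k w) - A ^+ 2 * k w).
  rewrite RintegralB// !RintegralZl//; last exact: k_integrable.
  by rewrite Rint_k -/A; ring.
apply: le_Rintegral => //.
  have -> : EFin \o (fun w => 2 * A * (phi w * k w) - A ^+ 2 * k w) =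
    ((EFin \o (fun w => (2 * A * (phi w * k w))%R)) \- (EFin \o (fun w => (A ^+ 2 * k w)%R)))%E by apply/funext.
  exact: integrableB.
move=> z _; rewrite mulrA -mulrBl ler_wpM2r//.
by have := sqr_ge0 (phi z - A); rewrite sqrrB mulr2n; lra.
Qed.

(** Jensen's inequality for the probability density [k] at each [x], then Tonelli's theorem, since
    all translates of [phi ^+ 2] have the same integral. *)
Lemma convol_L2 (phi : R * R -> R) (M : R) : measurable_fun setT phi -> 0 <= M ->
  (forall z, `|phi z| <= M) ->
  measurable_fun setT (fun x => Rintegral lam setT (fun w => phi (w + x) * k w)) ->
  (\int[lam]_x (Rintegral lam setT (fun w => phi (w + x) * k w) ^+ 2)%:E <= \int[lam]_x (phi x ^+ 2)%:E)%E.
Proof.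
move=> mphi M0 hM mF.
have mphi2 : measurable_fun setT (fun x => phi x ^+ 2) by mfun.
have madd : measurable_fun setT (fun z : (R * R) * (R * R) => phi (z.2 + z.1)) by mfun.
have mf : measurable_fun setT (fun z : (R * R) * (R * R) => (phi (z.2 + z.1) ^+ 2 * k z.2)%:E) by mfun.
have f0 (z : (R * R) * (R * R)) : (0 <= (phi (z.2 + z.1) ^+ 2 * k z.2)%:E)%E.
  by rewrite lee_fin mulr_ge0// sqr_ge0.
apply: (@le_trans _ _ (\int[lam]_x \int[lam]_w (phi (w + x) ^+ 2 * k w)%:E)%E).
  apply: ge0_le_integral => //.
  - by move=> x _; rewrite lee_fin sqr_ge0.
  - by mfun.
  - exact: (@measurable_fun_fubini_tonelli_F _ _ _ _ _ lam _ mf f0).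
  move=> x _; apply: (@jensen_sqr (fun w => phi (w + x)) M) => //.
  exact: (measurable_shift mphi x).
rewrite -(lam2_tonelli mf f0) (lam2_tonelliC mf f0) /=.
have e w : (\int[lam]_x (phi (w + x) ^+ 2 * k w)%:E = (k w)%:E * \int[lam]_x (phi x ^+ 2)%:E)%E.
  have m1 : measurable_fun setT (fun x => phi (x + w) ^+ 2) := measurable_shift mphi2 w.
  have m2 : measurable_fun setT (fun x => (phi x ^+ 2)%:E) by apply/measurable_EFinP.
  have p2 x : (0 <= (phi x ^+ 2)%:E)%E by rewrite lee_fin sqr_ge0.
  rewrite -(lam_shift w m2 p2) -(ge0_intZ lam m1 (k0 w) (fun x => sqr_ge0 _)).
  by apply: eq_integral => x _; rewrite addrC mulrC.
under eq_integral do rewrite e.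
rewrite (@ge0_integralZr _ _ R lam _ measurableT (EFin \o k)) ?k1 ?mul1e//.
- by apply/measurable_EFinP.
- by move=> x _; rewrite lee_fin.
by apply: int_ge0 => x; exact: sqr_ge0.
Qed.

End kernel.

Lemma unif_cont g (r : R) : (forall x, cont2 g x) -> (forall x, r <= norm2 x -> g x = 0) ->
  forall e, 0 < e -> exists2 d, 0 < d & forall x w, norm2 w < d -> `|g (w + x) - g x| <= e.
Proof.
move=> cg gr e e0; apply: contrapT => H.
have {}H n : exists p : (R * R) * (R * R), norm2 p.2 < n.+1%:R^-1 /\ e < `|g (p.2 + p.1) - g p.1|.
  apply: contrapT => H'; apply: H; exists n.+1%:R^-1; first by rewrite invr_gt0.
  by move=> x w hw; rewrite leNgt; apply/negP => h; apply: H'; exists (x, w).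
pose p n := projT1 (cid (H n)).
have p1 n : norm2 (p n).2 < n.+1%:R^-1 by rewrite /p; case: cid => q [].
have p2 n : e < `|g ((p n).2 + (p n).1) - g (p n).1| by rewrite /p; case: cid => q [].
have n1 n : n.+1%:R^-1 <= 1 :> R by rewrite invf_le1// ler1n.
have pb n : norm2 ((p n).1 - 0) <= r + 1.
  rewrite leNgt subr0; apply/negP => h; have := p2 n.
  have h1 : norm2 (p n).1 <= norm2 ((p n).2 + (p n).1) + norm2 (p n).2.
    by have := le_norm2D ((p n).2 + (p n).1) (- (p n).2); rewrite addrC addKr norm2N.
  have h2 := lt_le_trans (p1 n) (n1 n).
  rewrite (gr (p n).1); last by lra.
  have -> : g ((p n).2 + (p n).1) = 0 by apply: gr; lra.
  by rewrite subrr normr0 => h4; lra.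
have [q [_ qcl]] : [set y : R * R | norm2 (y - 0) <= r + 1] `&` cluster ((fun n => (p n).1) @ \oo) !=set0.
  by apply: closed_ball2_compact; exists 0%N => // n _ /=; exact: pb.
have [d d0 hd] := cg q (e / 2) ltac:(by rewrite divr_gt0).
have [N hN] : exists N, forall n, (N <= n)%N -> n.+1%:R^-1 < d / 4 :> R.
  have := @cvg_harmonic R; move=> /cvgrPdist_lt/(_ (d / 4) ltac:(by rewrite divr_gt0))[N _ hN].
  exists N => n /hN /=; rewrite sub0r normrN ger0_norm// invr_ge0 ler0n//.
have d4 : 0 < d / 4 by rewrite divr_gt0.
have [_ [/= [n Nn <-] h]] := qcl [set (p j).1 | j in [set j | (N <= j)%N]] (ball q (d / 4))
   ltac:(by exists N => // j /= kj; exists j) (nbhsx_ballx _ _ d4).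
have h1 : norm2 ((p n).1 - q) < d / 2 by have := ball_norm2_le h; lra.
have h2 : norm2 ((p n).2 + (p n).1 - q) < d.
  rewrite -addrA; apply: (le_lt_trans (le_norm2D _ _)).
  by have := lt_trans (p1 n) (hN n Nn); lra.
have h3 := hd _ h2; have h4 := hd (p n).1 ltac:(lra).
have := p2 n; have := ler_normB (g ((p n).2 + (p n).1) - g q) (g (p n).1 - g q).
by rewrite opprB addrA subrK; lra.
Qed.

End averaging.

(** * Smooth approximation in the fractional seminorm *)

Section approximation.
Context {R : realType} (s : R) (s01 : 0 < s < 1).
Let s0 : 0 < s. Proof. by case/andP : s01. Qed.
Let s1 : s < 1. Proof. by case/andP : s01. Qed.
Notation ker := (ker s).
Implicit Types (x y w v : R * R) (z : (R * R) * (R * R)) (psi : R * R -> R).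

Definition shiftsq psi v : \bar R := (\int[lam]_x ((psi (v + x) - psi x) ^+ 2)%:E)%E.

Let mdiff psi : measurable_fun setT psi ->
  measurable_fun setT (fun z => (psi (z.2 + z.1) - psi z.1) ^+ 2).
Proof.
move=> mp; have ma : measurable_fun setT (fun z : (R * R) * (R * R) => psi (z.2 + z.1)) by mfun.
mfun.
Qed.

Lemma shiftsq_ge0 psi v : (0 <= shiftsq psi v)%E.
Proof. by apply: int_ge0 => x; exact: sqr_ge0. Qed.

Lemma measurable_shiftsq psi : measurable_fun setT psi -> measurable_fun setT (shiftsq psi).
Proof.
move=> mp; have md := mdiff mp.
have mE : measurable_fun setT (fun z => ((psi (z.2 + z.1) - psi z.1) ^+ 2)%:E) by apply/measurable_EFinP.
have p0 z : (0 <= ((psi (z.2 + z.1) - psi z.1) ^+ 2)%:E)%E by rewrite lee_fin sqr_ge0.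
exact: (@measurable_fun_fubini_tonelli_G _ _ _ _ _ lam _ mE p0).
Qed.

(** With the seminorm written as an integral over shifts [v], convergence can be obtained for each
    [v] separately and then by domination in [v]. *)
Lemma dens_shiftsq psi : measurable_fun setT psi ->
  (\int[lam2]_z (dens s psi z)%:E = \int[lam]_v ((ker v)%:E * shiftsq psi v))%E.
Proof.
move=> mp; have md := measurable_dens s mp; have mk := measurable_ker1 s.
have mdE : measurable_fun setT (fun z => (dens s psi z)%:E) by apply/measurable_EFinP.
rewrite (lam2_iter mdE) => [|z]; last by rewrite lee_fin dens_ge0.
have mm := mdiff mp.
have mf : measurable_fun setT (fun z => ((psi (z.2 + z.1) - psi z.1) ^+ 2 * ker z.2)%:E) by mfun.
have f0 z : (0 <= ((psi (z.2 + z.1) - psi z.1) ^+ 2 * ker z.2)%:E)%E.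
  by rewrite lee_fin mulr_ge0 ?sqr_ge0// ker_ge0.
transitivity (\int[lam]_x \int[lam]_w ((psi (w + x) - psi x) ^+ 2 * ker w)%:E)%E.
  apply: eq_integral => x _; apply: eq_integral => w _.
  by rewrite /dens /= addrAC subrr add0r (addrC x) -(sqrrN (psi x - _)) opprB.
rewrite -(lam2_tonelli mf f0) (lam2_tonelliC mf f0) /=.
apply: eq_integral => v _; rewrite /shiftsq.
have mv : measurable_fun setT (fun x => (psi (v + x) - psi x) ^+ 2).
  exact: (measurable_sliceC (T1 := (measurableTypeR R * measurableTypeR R)%type) (T2 := (measurableTypeR R * measurableTypeR R)%type) v mm).
rewrite -(ge0_intZ lam mv (ker_ge0 s v) (fun x => sqr_ge0 _)).
by apply: eq_integral => x _; rewrite mulrC.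
Qed.

Lemma shiftsq_supp psi (m r : R) v : 0 <= m -> 0 <= r -> measurable_fun setT psi ->
  (forall x, `|psi x| <= m) -> (forall x, r <= norm2 x -> psi x = 0) ->
  (shiftsq psi v <= (16 * m ^+ 2 * (r + norm2 v) ^+ 2)%:E)%E.
Proof.
move=> m0 r0 mp hm hr.
have rv : 0 <= r + norm2 v by rewrite addr_ge0// norm2_ge0.
have mb : measurable_fun setT (fun x : R * R => chi (norm2 x <= r + norm2 v) : R) by mfun.
have c0 : 0 <= (2 * m) ^+ 2 by exact: sqr_ge0.
have msh : measurable_fun setT (fun x => psi (v + x)).
  by have := measurable_shift mp v; under eq_fun do rewrite addrC.
apply: (@le_trans _ _ (\int[lam]_x ((2 * m) ^+ 2 * chi (norm2 x <= r + norm2 v)%R)%:E)%E).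
  apply: (ge0_le_int lam); [by mfun|by mfun|by move=> x; exact: sqr_ge0|].
  move=> x; case: (leP (norm2 x) (r + norm2 v)) => h.
    rewrite mulr1 -(real_normK (num_real (_ - _))) ler_sqr ?nnegrE ?mulr_ge0//.
    by apply: (le_trans (ler_normB _ _)); have := hm (v + x); have := hm x; lra.
  have n1 : norm2 x <= norm2 (v + x) + norm2 v.
    by have := le_norm2D (v + x) (- v); rewrite addrC addKr norm2N.
  have v0 := norm2_ge0 v.
  have -> : psi x = 0 by apply: hr; lra.
  have -> : psi (v + x) = 0 by apply: hr; lra.
  by rewrite subrr expr0n/= mulr0.
rewrite (ge0_intZ lam mb c0 (fun x => ler0n _ _)).
apply: (@le_trans _ _ (((2 * m) ^+ 2)%:E * (4 * (r + norm2 v) ^+ 2)%:E)%E).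
  by rewrite lee_wpmul2l ?lee_fin// lam_ball_le.
by rewrite -EFinM lee_fin le_eqVlt; apply/orP; left; apply/eqP; ring.
Qed.

Variables (g : R * R -> R) (M r : R).
Hypotheses (M0 : 0 <= M) (r0 : 0 <= r) (cg : forall x, cont2 g x) (gM : forall x, `|g x| <= M)
  (gr : forall x, r <= norm2 x -> g x = 0).

Let mg : measurable_fun setT g. Proof. exact: cont2_measurable. Qed.

Let gball y : `|g y| <= M * chi (norm2 y <= r).
Proof.
by case: (leP (norm2 y) r) => [_|/ltW/gr ->]; [rewrite mulr1|rewrite normr0 mulr0].
Qed.

Let lr n : R := 2 * n.+1%:R.
Let lr0 n : 0 < lr n. Proof. by rewrite mulr_gt0. Qed.
Let mo n : R * R -> R := projT1 (cid (mollifier (lr0 n))).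
Let moP n : [/\ bumps (lr n) (mo n), forall x, 0 <= mo n x,
  forall x, 2 / lr n <= norm2 x -> mo n x = 0 & (\int[lam]_x (mo n x)%:E = 1)%E].
Proof. by rewrite /mo; case: cid. Qed.

Definition smoothed n x := convol g (mo n) x.

Let b_mo n : bumps (lr n) (mo n). Proof. by case: (moP n). Qed.
Let mo0 n x : 0 <= mo n x. Proof. by case: (moP n). Qed.
Let mo1 n : (\int[lam]_x (mo n x)%:E = 1)%E. Proof. by case: (moP n). Qed.
Let m_mo n : measurable_fun setT (mo n). Proof. exact: bumps_meas (b_mo n). Qed.

Let mos n x : n.+1%:R^-1 <= norm2 x -> mo n x = 0.
Proof.
move=> h; case: (moP n) => _ _ hs _; apply: hs; rewrite /lr invfM mulrA divff// mul1r//.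
Qed.

Lemma smoothedE n x : smoothed n x = Rintegral lam setT (fun w => g (w + x) * mo n w).
Proof.
rewrite /smoothed /convol.
have mf : measurable_fun setT (fun y => g y * mo n (y - x)).
  by have := m_mo n => mm; mfun.
rewrite -(Rint_shift x mf); apply: eq_Rintegral => w _.
by rewrite addrK.
Qed.

Lemma smoothed_smooth n : smooth (smoothed n).
Proof. exact: (convol_smooth M0 r0 mg gball (b_mo n)). Qed.

Lemma smoothed_cont n x : cont2 (smoothed n) x.
Proof.
have [C C0 hC] := convol_lip M0 r0 mg gball (b_mo n).
by apply: (@cont2_lip _ C) => y; exact: hC.
Qed.

Lemma smoothed_close (e : R) n : (forall x w, norm2 w < n.+1%:R^-1 -> `|g (w + x) - g x| <= e) ->
  forall x, `|smoothed n x - g x| <= e.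
Proof.
move=> he x; rewrite smoothedE.
apply: (@avg_dist _ (mo n) (m_mo n) (mo0 n) (mo1 n) (fun w => g (w + x)) M) => //.
  exact: (measurable_shift mg x).
move=> z kz; apply: he; rewrite ltNge; apply/negP => /mos h.
by rewrite h eqxx in kz.
Qed.

Lemma smoothed_supp n x : r + n.+1%:R^-1 <= norm2 x -> smoothed n x = 0.
Proof.
move=> h; rewrite smoothedE (_ : (fun w => _) = (fun=> 0)); first by rewrite /Rintegral integral0.
apply/funext => w; have [/mos ->|hw] := leP n.+1%:R^-1 (norm2 w); first by rewrite mulr0.
rewrite gr ?mul0r//.
have := le_norm2D (w + x) (- w); rewrite addrC addKr norm2N => h1.
by move: (n.+1%:R^-1) h hw => c h hw; lra.
Qed.

(* Young's inequality: averaging contracts the [L^2] norm of the increments. *)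
Lemma smoothed_shiftsq n v : (shiftsq (smoothed n) v <= shiftsq g v)%E.
Proof.
pose phi x := g (v + x) - g x.
have mphi : measurable_fun setT phi.
  have : measurable_fun setT (fun x => g (v + x)).
    by have := measurable_shift mg v; under eq_fun do rewrite addrC.
  by move=> mgv; rewrite /phi; mfun.
have phiM x : `|phi x| <= 2 * M.
  by apply: (le_trans (ler_normB _ _)); have := gM (v + x); have := gM x; lra.
have M20 : 0 <= 2 * M by rewrite mulr_ge0.
have bi x : lam.-integrable setT (EFin \o (fun w => g (w + x) * mo n w)).
  by apply: (bounded_integrable (m_mo n) (mo0 n) (mo1 n) (measurable_shift mg x) M0).
have e x : smoothed n (v + x) - smoothed n x = Rintegral lam setT (fun w => phi (w + x) * mo n w).
  rewrite !smoothedE -RintegralB//; apply: eq_Rintegral => w _.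
  by rewrite /phi mulrBl addrCA.
have ms : measurable_fun setT (smoothed n) by apply: cont2_measurable; exact: smoothed_cont.
have mF : measurable_fun setT (fun x => Rintegral lam setT (fun w => phi (w + x) * mo n w)).
  have : measurable_fun setT (fun x => smoothed n (v + x) - smoothed n x).
    have : measurable_fun setT (fun x => smoothed n (v + x)).
      by have := measurable_shift ms v; under eq_fun do rewrite addrC.
    by move=> mgv; mfun.
  by under eq_fun do rewrite e.
rewrite /shiftsq; under eq_integral do rewrite e.
exact: (convol_L2 (m_mo n) (mo0 n) (mo1 n) mphi M20 phiM mF).
Qed.

Hypothesis (gE : (\int[lam2]_z (dens s g z)%:E < +oo)%E).

(** For a fixed shift the error tends to [0], because [smoothed n] converges uniformly to [g] with
    supports in a common ball. It is dominated by four times the squared shift norm of [g], thanks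
    to [smoothed_shiftsq], and the kernel integrates this by [gE]. *)
Lemma smooth_approx (e : R) : 0 < e -> exists G : R * R -> R, [/\ smooth G,
  forall x, r + e <= norm2 x -> G x = 0, forall x, `|G x - g x| <= e &
  (\int[lam2]_z (dens s (fun x => G x - g x) z)%:E <= e%:E)%E].
Proof.
move=> e0; have uc := unif_cont cg gr.
have close (c : R) : 0 < c -> exists N, forall n, (N <= n)%N -> forall x, `|smoothed n x - g x| <= c.
  move=> c0; have [d d0 hd] := uc _ c0.
  have := @cvg_harmonic R; move=> /cvgrPdist_lt/(_ d d0)[N _ hN].
  exists N => n /hN /=; rewrite sub0r normrN ger0_norm ?invr_ge0// => h.
  by apply: smoothed_close => x w hw; apply: hd; exact: lt_trans h.
have [N1 hN1] := close e e0.
have [N2 hN2] : exists N, forall n, (N <= n)%N -> n.+1%:R^-1 < e.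
  have := @cvg_harmonic R; move=> /cvgrPdist_lt/(_ e e0)[N _ hN].
  by exists N => n /hN /=; rewrite sub0r normrN ger0_norm ?invr_ge0.
pose N := maxn N1 N2.
pose dg n x := smoothed n x - g x.
have ms n : measurable_fun setT (smoothed n) by apply: cont2_measurable; exact: smoothed_cont.
have mdg n : measurable_fun setT (dg n) by have := ms n => msn; rewrite /dg; mfun.
have n1 n : n.+1%:R^-1 <= 1 :> R by rewrite invf_le1// ler1n.
have dgr n x : r + 1 <= norm2 x -> dg n x = 0.
  move=> h; have := n1 n => h1; rewrite /dg smoothed_supp ?gr ?subrr//.
    by apply: le_trans h; rewrite lerDl.
  by apply: le_trans h; rewrite lerD2l.
have r10 : 0 <= r + 1 by rewrite addr_ge0.
have gfin v : (shiftsq g v < +oo)%E.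
  by apply: (le_lt_trans (shiftsq_supp v M0 r0 mg gM gr)); rewrite ltry.
have dg4 n v : (shiftsq (dg n) v <= 4%:E * shiftsq g v)%E.
  have msv : measurable_fun setT (fun x => (smoothed n (v + x) - smoothed n x) ^+ 2).
    have : measurable_fun setT (fun x => smoothed n (v + x)).
      by have := measurable_shift (ms n) v; under eq_fun do rewrite addrC.
    by move=> h; have := ms n => msn; mfun.
  have mgv0 : measurable_fun setT (fun x => g (v + x)).
    by have := measurable_shift mg v; under eq_fun do rewrite addrC.
  have mgv : measurable_fun setT (fun x => (g (v + x) - g x) ^+ 2) by mfun.
  have mdv : measurable_fun setT (fun x => (dg n (v + x) - dg n x) ^+ 2).
    have : measurable_fun setT (fun x => dg n (v + x)).
      by have := measurable_shift (mdg n) v; under eq_fun do rewrite addrC.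
    by move=> h; have := mdg n => mdn; mfun.
  have p1 x : 0 <= (smoothed n (v + x) - smoothed n x) ^+ 2 by exact: sqr_ge0.
  have p2 x : 0 <= (g (v + x) - g x) ^+ 2 by exact: sqr_ge0.
  have m1 : measurable_fun setT (fun x => 2 * (smoothed n (v + x) - smoothed n x) ^+ 2) by exact: measurable_funM.
  have m2 : measurable_fun setT (fun x => 2 * (g (v + x) - g x) ^+ 2) by exact: measurable_funM.
  apply: (@le_trans _ _ (\int[lam]_x (2 * (smoothed n (v + x) - smoothed n x) ^+ 2 + 2 * (g (v + x) - g x) ^+ 2)%:E)%E).
    apply: (ge0_le_int lam mdv); [exact: measurable_funD|by move=> x; exact: sqr_ge0|].
    move=> x; rewrite /dg.
    have := sqr_ge0 ((smoothed n (v + x) - smoothed n x) + (g (v + x) - g x)); nra.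
  rewrite (ge0_intD lam m1 m2 (fun x => mulr_ge0 (ler0n _ 2) (p1 x)) (fun x => mulr_ge0 (ler0n _ 2) (p2 x))).
  rewrite (ge0_intZ lam msv (ler0n _ 2) p1) (ge0_intZ lam mgv (ler0n _ 2) p2).
  rewrite -/(shiftsq (smoothed n) v) -/(shiftsq g v).
  apply: (@le_trans _ _ (2%:E * shiftsq g v + 2%:E * shiftsq g v)%E).
    by rewrite leeD2r// lee_wpmul2l ?lee_fin// smoothed_shiftsq.
  by rewrite -ge0_muleDl ?lee_fin// -EFinD -natrD.
have dgfin n v : (shiftsq (dg n) v \is a fin_num)%E.
  rewrite ge0_fin_numE ?shiftsq_ge0//; apply: (le_lt_trans (dg4 n v)).
  have : (shiftsq g v \is a fin_num)%E by rewrite ge0_fin_numE ?shiftsq_ge0.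
  by move=> /fineK <-; rewrite -EFinM ltry.
have gfin' v : (shiftsq g v \is a fin_num)%E by rewrite ge0_fin_numE ?shiftsq_ge0.
have mk := measurable_ker1 s.
pose h n v := ker v * fine (shiftsq (dg (n + N)%N) v).
pose G v := ker v * (4 * fine (shiftsq g v)).
have mfine psi : measurable_fun setT psi -> measurable_fun setT (fun v => fine (shiftsq psi v)).
  by move=> mp; exact: (measurableT_comp (fine_measurable measurableT) (measurable_shiftsq mp)).
have mh n : measurable_fun setT (h n) by have := mfine _ (mdg (n + N)%N) => mf; rewrite /h; mfun.
have mfg := mfine _ mg.
have mG : measurable_fun setT G by rewrite /G; mfun.
have hG n v : 0 <= h n v <= G v.
  have f0 : 0 <= fine (shiftsq (dg (n + N)%N) v) by rewrite fine_ge0// shiftsq_ge0.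
  rewrite /h mulr_ge0 ?ker_ge0//= ler_wpM2l ?ker_ge0//.
  by rewrite -lee_fin EFinM !fineK// dg4.
have GE : (\int[lam]_v (G v)%:E < +oo)%E.
  have p v : 0 <= ker v * fine (shiftsq g v) by rewrite mulr_ge0 ?ker_ge0// fine_ge0// shiftsq_ge0.
  have mp : measurable_fun setT (fun v => ker v * fine (shiftsq g v)) by mfun.
  have -> : (\int[lam]_v (G v)%:E = 4%:E * \int[lam2]_z (dens s g z)%:E)%E.
    rewrite (dens_shiftsq mg).
    have -> : (\int[lam]_v ((ker v)%:E * shiftsq g v) = \int[lam]_v (ker v * fine (shiftsq g v))%:E)%E.
      by apply: eq_integral => v _; rewrite EFinM fineK.
    rewrite -(ge0_intZ lam mp (ler0n _ 4) p); apply: eq_integral => v _.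
    by rewrite /G mulrCA.
  have d0 : (0 <= \int[lam2]_z (dens s g z)%:E)%E by apply: int_ge0 => z; exact: dens_ge0.
  have : (\int[lam2]_z (dens s g z)%:E \is a fin_num)%E by rewrite ge0_fin_numE.
  by move=> /fineK <-; rewrite -EFinM ltry.
have hcvg v : (fun n => h n v) @ \oo --> (0 : R).
  apply/cvgrPdist_le => c c0.
  pose A := ker v * (16 * (r + 1 + norm2 v) ^+ 2).
  have A0 : 0 <= A by rewrite /A mulr_ge0 ?ker_ge0// mulr_ge0// sqr_ge0.
  pose c' := Num.min 1 (c / (A + 1)).
  have c'0 : 0 < c' by rewrite lt_min ltr01 divr_gt0// ltr_wpDl.
  have [K hK] := close c' c'0.
  exists K => // n /= Kn; rewrite sub0r normrN ger0_norm; last by have /andP[] := hG n v.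
  have hs := @shiftsq_supp (dg (n + N)%N) c' (r + 1) v (ltW c'0) r10 (mdg _)
     (hK _ (leq_trans Kn (leq_addr _ _))) (dgr _).
  have c'1 : c' <= 1 by rewrite ge_min lexx.
  have c'2 : c' <= c / (A + 1) by rewrite ge_min lexx orbT.
  apply: (@le_trans _ _ (A * c' ^+ 2)).
    have -> : A * c' ^+ 2 = ker v * (16 * c' ^+ 2 * (r + 1 + norm2 v) ^+ 2) by rewrite /A; ring.
    by rewrite /h ler_wpM2l ?ker_ge0// -lee_fin fineK.
  apply: (@le_trans _ _ (A * c')).
    by rewrite ler_wpM2l// expr2 ler_piMr// ltW.
  move: c'2; rewrite ler_pdivlMr ?ltr_wpDl//; lra.
have [n hn] := @dominated_small _ _ R lam h G mh mG hG GE hcvg e e0.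
exists (smoothed (n + N)%N); split.
- exact: smoothed_smooth.
- move=> x hx; apply: smoothed_supp; apply: le_trans hx.
  by rewrite lerD2l ltW// hN2// (leq_trans (leq_maxr N1 N2))// leq_addl.
- by apply: hN1; rewrite (leq_trans (leq_maxl N1 N2))// leq_addl.
rewrite (dens_shiftsq (mdg (n + N)%N)); apply: le_trans hn.
by rewrite le_eqVlt; apply/orP; left; apply/eqP; apply: eq_integral => v _; rewrite /h EFinM fineK.
Qed.

End approximation.

Section minimality.
Context {R : realType} (s : R) (s01 : 0 < s < 1).
Let s0 : 0 < s. Proof. by case/andP : s01. Qed.
Let s1 : s < 1. Proof. by case/andP : s01. Qed.
Implicit Types (x y w v : R * R) (z : (R * R) * (R * R)).

Lemma dens_add_le (a b : R * R -> R) (q : R) z : 0 < q ->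
  dens s (fun x => a x + b x) z <= (1 + q) * dens s a z + (1 + q^-1) * dens s b z.
Proof.
move=> q0; rewrite /dens; set A := a z.1 - a z.2; set B := b z.1 - b z.2; set K := ker s _.
have -> : a z.1 + b z.1 - (a z.2 + b z.2) = A + B by rewrite /A /B; ring.
have -> : (1 + q) * (A ^+ 2 * K) + (1 + q^-1) * (B ^+ 2 * K) =
  ((1 + q) * A ^+ 2 + (1 + q^-1) * B ^+ 2) * K by ring.
rewrite ler_wpM2r ?ker_ge0//.
rewrite -subr_ge0.
have -> : (1 + q) * A ^+ 2 + (1 + q^-1) * B ^+ 2 - (A + B) ^+ 2 = q^-1 * (q * A - B) ^+ 2.
  by field; rewrite gt_eqF.
by rewrite mulr_ge0 ?sqr_ge0// invr_ge0 ltW.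
Qed.

Lemma well_close (a b e : R) : `|a| <= 1 -> `|b - a| <= e -> e <= 1 ->
  (1 - b ^+ 2) ^+ 2 <= (1 - a ^+ 2) ^+ 2 + 9 * e.
Proof.
move=> a1 bae e1; set c := b - a; have -> : b = a + c by rewrite /c; ring.
move: bae; rewrite -/c => ce.
have -> : (1 - (a + c) ^+ 2) ^+ 2 = (1 - a ^+ 2) ^+ 2 + c * (- (2 * a + c) * (2 - a ^+ 2 - (a + c) ^+ 2)) by ring.
rewrite lerD2l; apply: (le_trans (ler_norm _)); rewrite normrM.
have e0 := le_trans (normr_ge0 _) ce.
have h1 : `|- (2 * a + c)| <= 3.
  by rewrite normrN; apply: (le_trans (ler_normD _ _)); rewrite normrM ger0_norm//; lra.
have h2 : `|2 - a ^+ 2 - (a + c) ^+ 2| <= 3.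
  move: a1 ce; rewrite !ler_norml => /andP[] a1 a2 /andP[] c1 c2.
  have q1 : a ^+ 2 <= 1 by nra.
  have q2 : (a + c) ^+ 2 <= 4 by nra.
  have := sqr_ge0 a; have := sqr_ge0 (a + c); move=> *; apply/andP; split; lra.
have -> : 9 * e = e * (3 * 3) by ring.
by rewrite ler_pM// normrM ler_pM.
Qed.

(** Extends minimality from smooth perturbations to continuous ones of finite energy that vanish
    outside a strictly smaller ball. The room between [r1] and [r] holds the support of the smooth
    approximation of [w - u]. *)
Lemma min_ext (u w : R * R -> R) (r1 r : R) : is_minimizer s u -> 0 <= r1 -> r1 < r ->
  (forall x, cont2 u x) -> (forall x, cont2 w x) -> (forall x, `|u x| <= 1) -> (forall x, `|w x| <= 1) ->
  (forall x, r1 <= norm2 x -> w x = u x) ->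
  (Dr s r u < +oo)%E -> (Dr s r w < +oo)%E ->
  (Dr s r u + Wr r u <= Dr s r w + Wr r w)%E.
Proof.
move=> hmin r10 r1r cu cw u1 w1 wu Du Dw.
have mu := cont2_measurable cu; have mw := cont2_measurable cw.
have r0 : 0 < r by exact: le_lt_trans r1r.
have mi := measurable_inr r; have i0 := inr_ge0 r.
pose g x := w x - u x.
have cg x : cont2 g x by exact: cont2B.
have mg := cont2_measurable cg.
have gM x : `|g x| <= 2 by apply: (le_trans (ler_normB _ _)); have := u1 x; have := w1 x; lra.
have gr x : r1 <= norm2 x -> g x = 0 by move=> h; rewrite /g wu// subrr.
have mdu := measurable_dens s mu; have mdw := measurable_dens s mw; have mdg := measurable_dens s mg.
have Dw0 : (0 <= Dr s r w)%E by apply: int_ge0 => z; rewrite mulr_ge0 ?dens_ge0.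
have Du0 : (0 <= Dr s r u)%E by apply: int_ge0 => z; rewrite mulr_ge0 ?dens_ge0.
have Dwf : (Dr s r w \is a fin_num)%E by rewrite ge0_fin_numE.
have Duf : (Dr s r u \is a fin_num)%E by rewrite ge0_fin_numE.
have gE : (\int[lam2]_z (dens s g z)%:E < +oo)%E.
  have m1 : measurable_fun setT (fun z => inr r z * dens s w z) by mfun.
  have m2 : measurable_fun setT (fun z => inr r z * dens s u z) by mfun.
  have p1 z : 0 <= inr r z * dens s w z by rewrite mulr_ge0 ?dens_ge0.
  have p2 z : 0 <= inr r z * dens s u z by rewrite mulr_ge0 ?dens_ge0.
  have m1' : measurable_fun setT (fun z => 2 * (inr r z * dens s w z)) by exact: measurable_funM.
  have m2' : measurable_fun setT (fun z => 2 * (inr r z * dens s u z)) by exact: measurable_funM.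
  apply: (@le_lt_trans _ _ (\int[lam2]_z (2 * (inr r z * dens s w z) + 2 * (inr r z * dens s u z))%:E)%E).
    apply: (ge0_le_int lam2 mdg); [exact: (measurable_funD m1' m2')|by move=> z; exact: dens_ge0|].
    move=> z; have hh : dens s g z <= 2 * dens s w z + 2 * dens s u z.
      have : dens s g z <= _ := @dens_add_le w (fun x => - u x) 1 z ltr01.
      have -> : dens s (fun x => - u x) z = dens s u z.
        rewrite /dens; have -> : - u z.1 - - u z.2 = - (u z.1 - u z.2) by ring.
        by rewrite sqrrN.
      by rewrite invr1; lra.
    rewrite /= inrE; case: (ltP (norm2 z.1) r) => h1 /=; last case: (ltP (norm2 z.2) r) => h2 /=.
    - by rewrite !mul1r; exact: hh.
    - by rewrite !mul1r; exact: hh.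
    have k1 : r1 <= norm2 z.1 by lra.
    have k2 : r1 <= norm2 z.2 by lra.
    by rewrite !mul0r !mulr0 addr0 /dens (gr _ k1) (gr _ k2) subrr expr0n/= mul0r.
  rewrite (ge0_intD lam2 m1' m2' (fun z => mulr_ge0 (ler0n _ 2) (p1 z)) (fun z => mulr_ge0 (ler0n _ 2) (p2 z))).
  rewrite (ge0_intZ lam2 m1 (ler0n _ 2) p1) (ge0_intZ lam2 m2 (ler0n _ 2) p2).
  by rewrite -/(Dr s r w) -/(Dr s r u) -(fineK Dwf) -(fineK Duf) -!EFinM -EFinD ltry.
pose D := fine (Dr s r w); have D0 : 0 <= D by rewrite fine_ge0.
apply/lee_addgt0Pr => eps eps0.
(* Order of choices: [q] makes the relative error [q * D] of the Dirichlet part at most [eps / 2];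
   then [e] makes the remaining errors, gathered in [B], at most [eps / 2]. Here [36 * r ^+ 2] is
   [9], from [well_close], times the area bound [4 * r ^+ 2]. *)
pose q := eps / (2 * (D + 1)).
have D1 : 0 < D + 1 by rewrite ltr_wpDl.
have q0 : 0 < q by rewrite divr_gt0// mulr_gt0.
have qD : q * D <= eps / 2.
  rewrite /q -subr_ge0; have -> : eps / 2 - eps / (2 * (D + 1)) * D = eps / (2 * (D + 1)) by field; rewrite gt_eqF.
  exact: ltW.
pose B := 1 + q^-1 + 36 * r ^+ 2.
have B0 : 0 < B.
  have h1 : 0 < 1 + q^-1 by rewrite addr_gt0// invr_gt0.
  have h2 : 0 <= 36 * r ^+ 2 by rewrite mulr_ge0// sqr_ge0.
  by rewrite /B; lra.
pose e := Num.min 1 (Num.min (r - r1) (eps / 2 / B) / 2).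
have e0 : 0 < e by rewrite lt_min ltr01 divr_gt0// lt_min subr_gt0 r1r !divr_gt0.
have e1 : e <= 1 by rewrite ge_min lexx.
have [e2 e3] : 2 * e <= r - r1 /\ e * B <= eps / 2.
  have h : 2 * e <= Num.min (r - r1) (eps / 2 / B).
    by rewrite mulrC -ler_pdivlMr// ge_min lexx orbT.
  split; first by apply: (le_trans h); rewrite ge_min lexx.
  have : 2 * e <= eps / 2 / B by apply: (le_trans h); rewrite ge_min lexx orbT.
  by rewrite ler_pdivlMr//; have := mulr_ge0 (ltW e0) (ltW B0); lra.
have [G [sG Gs Gc Ge]] := smooth_approx (ler0n _ 2) r10 cg gM gr gE e0.
have r1e : r1 + e < r by lra.
have cG : Cinf_c (eball 0 r) G.
  have cb := @closed_ball2_compact R 0 (r1 + e).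
  have sub : closure [set x | G x != 0] `<=` [set y | norm2 (y - 0) <= r1 + e].
    have cl := compact_closed (@norm_hausdorff _ _) cb.
    rewrite [X in _ `<=` X](closure_id _).1//; apply: closure_subset => x /= Gx.
    by rewrite subr0 leNgt; apply/negP => h; move: Gx; rewrite Gs ?eqxx// ltW.
  split=> //; split; first exact: (subclosed_compact (@closed_closure _ _) cb sub).
  by move=> x /sub /= h; rewrite /eball /=; exact: le_lt_trans r1e.
have := hmin 0 r r0 G cG; rewrite !EnergyE => /le_trans; apply.
(* The admissible competitor [u + G] is seen as a small perturbation [G - g] of [w], so its energy
   is close to that of [w]. *)
have -> : (fun x => u x + G x) = (fun x => w x + (G x - g x)).
  by apply/funext => x; rewrite /g; ring.
pose dG x := G x - g x.
have cdG : measurable_fun setT dG.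
  have mG : measurable_fun setT G.
    apply: continuous_measurable2 => x.
    by apply: differentiable_continuous; exact: (sG [::] x).
  by rewrite /dG; mfun.
have mdd := measurable_dens s cdG.
have mwd : measurable_fun setT (fun x => w x + dG x) by mfun.
have mdwd := measurable_dens s mwd.
have dE : (Dr s r (fun x => (w x + dG x)%R) <= (1 + q)%:E * Dr s r w + (1 + q^-1)%:E * e%:E)%E.
  have q1 : 0 <= 1 + q by rewrite addr_ge0// ltW.
  have q2 : 0 <= 1 + q^-1 by rewrite addr_ge0// invr_ge0 ltW.
  have m1 : measurable_fun setT (fun z => inr r z * dens s w z) by mfun.
  have p1 z : 0 <= inr r z * dens s w z by rewrite mulr_ge0 ?dens_ge0.
  have m1' : measurable_fun setT (fun z => (1 + q) * (inr r z * dens s w z)) by exact: measurable_funM.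
  have m2' : measurable_fun setT (fun z => (1 + q^-1) * dens s dG z) by exact: measurable_funM.
  apply: (@le_trans _ _ (\int[lam2]_z ((1 + q) * (inr r z * dens s w z) + (1 + q^-1) * dens s dG z)%:E)%E).
    apply: (ge0_le_int lam2); [by mfun|exact: (measurable_funD m1' m2')|by move=> z; rewrite mulr_ge0 ?dens_ge0|].
    move=> z /=; have h := @dens_add_le w dG q z q0.
    have i1 : inr r z <= 1 by rewrite inrE; case: (_ || _); rewrite /= ?lexx ?ler01.
    apply: (le_trans (ler_wpM2l (i0 z) h)); rewrite mulrDr mulrCA lerD2l.
    by rewrite ler_piMl// mulr_ge0// dens_ge0.
  rewrite (ge0_intD lam2 m1' m2' (fun z => mulr_ge0 q1 (p1 z)) (fun z => mulr_ge0 q2 (dens_ge0 s dG z))).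
  rewrite (ge0_intZ lam2 m1 q1 p1) (ge0_intZ lam2 mdd q2 (dens_ge0 s dG)).
  by rewrite leeD2l// lee_wpmul2l// lee_fin.
have wE : (Wr r (fun x => (w x + dG x)%R) <= Wr r w + (36 * r ^+ 2 * e)%:E)%E.
  have mb : measurable_fun setT (fun x : R * R => chi (norm2 x <= r) : R) by mfun.
  have m1 : measurable_fun setT (fun x => chi (norm2 x < r) * (1 - w x ^+ 2) ^+ 2 : R) by mfun.
  have p1 x : 0 <= chi (norm2 x < r) * (1 - w x ^+ 2) ^+ 2 :> R by rewrite mulr_ge0 ?sqr_ge0.
  have e9 : 0 <= 9 * e by rewrite mulr_ge0// ltW.
  have m2 : measurable_fun setT (fun x : R * R => 9 * e * chi (norm2 x <= r) : R) by mfun.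
  apply: (@le_trans _ _ (\int[lam]_x (chi (norm2 x < r)%R * (1 - w x ^+ 2) ^+ 2 + 9 * e * chi (norm2 x <= r)%R)%:E)%E).
    apply: (ge0_le_int lam); [by mfun|exact: (measurable_funD m1 m2)|by move=> x; rewrite mulr_ge0 ?sqr_ge0|].
    move=> x /=; case: (ltP (norm2 x) r) => h; last by rewrite !mul0r add0r mulr_ge0.
    rewrite (ltW h) !mul1r mulr1; apply: well_close => //.
    by rewrite addrAC subrr add0r; exact: Gc.
  rewrite (ge0_intD lam m1 m2 p1 (fun x => mulr_ge0 e9 (ler0n _ _))) leeD2l//.
  rewrite (ge0_intZ lam mb e9 (fun x => ler0n _ _)).
  apply: (@le_trans _ _ ((9 * e)%:E * (4 * r ^+ 2)%:E)%E).
    by rewrite lee_wpmul2l ?lee_fin// lam_ball_le// ltW.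
  by rewrite -EFinM lee_fin le_eqVlt; apply/orP; left; apply/eqP; ring.
apply: (le_trans (leeD dE wE)).
rewrite -(fineK Dwf) -/D -!EFinM -EFinD.
have W0 : (0 <= Wr r w)%E by apply: int_ge0 => x; rewrite mulr_ge0 ?sqr_ge0.
rewrite [leRHS]addeAC addeCA [leRHS]addeC.
rewrite addeA -EFinD addeC.
rewrite addeCA -EFinD leeD2l// lee_fin.
have -> : 36 * r ^+ 2 * e + ((1 + q) * D + (1 + q^-1) * e) = D + (q * D + e * B) by rewrite /B; ring.
lra.
Qed.

End minimality.

(** * Energy of deformed functions *)

Section kernel_perturbation.
Context {R : realType} (s : R) (s01 : 0 < s < 1).
Let s0 : 0 < s. Proof. by case/andP : s01. Qed.
Let s1 : s < 1. Proof. by case/andP : s01. Qed.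
Notation ker := (ker s).
Implicit Types (x y z : R * R).

(** One-sided, and obtained without differentiation from [x / (1 + x) <= ln (1 + x)] and
    [1 + y <= expR y]. *)
Lemma powR_taylor (a x : R) : 1 <= a <= 3 / 2 -> `|x| <= 4^-1 ->
  ((1 + x) `^ a)^-1 <= 1 - a * x + 10 * x ^+ 2.
Proof.
move=> /andP[a1 a2]; rewrite ler_norml => /andP[x1 x2].
have p1 : 0 < 1 + x by lra.
have p2 : 0 < 1 + (1 + a) * x by nra.
have l : x / (1 + x) <= ln (1 + x).
  have pv : 0 < (1 + x)^-1 by rewrite invr_gt0.
  have := ln_le_subr1 pv; rewrite lnV ?posrE// => h.
  have -> : x / (1 + x) = 1 - (1 + x)^-1 by field; rewrite gt_eqF.
  lra.
have h : (1 + (1 + a) * x) / (1 + x) <= (1 + x) `^ a.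
  rewrite powR_expR//; apply: le_trans (expR_ge1Dx _).
  have -> : (1 + (1 + a) * x) / (1 + x) = 1 + a * (x / (1 + x)) by field; rewrite gt_eqF.
  by rewrite lerD2l ler_wpM2l//; lra.
apply: (@le_trans _ _ ((1 + x) / (1 + (1 + a) * x))).
  by rewrite -[leRHS]invf_div lef_pV2 ?posrE ?powR_gt0 ?divr_gt0.
rewrite ler_pdivrMr//.
have -> : (1 - a * x + 10 * x ^+ 2) * (1 + (1 + a) * x) =
  1 + x + x ^+ 2 * (10 - a * (1 + a) + 10 * ((1 + a) * x)) by ring.
rewrite lerDl mulr_ge0 ?sqr_ge0//; nra.
Qed.

Lemma kerE2 z : ker z = ((norm2 z ^+ 2) `^ (1 + s / 2))^-1.
Proof.
rewrite /ker; congr (_^-1); rewrite -powR_mulrn ?norm2_ge0// -powRrM; congr (_ `^ _); by field.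
Qed.

Lemma ker_perturb z w : norm2 w <= 8^-1 * norm2 z ->
  let th := dot2 z w / norm2 z ^+ 2 in
  [/\ ker (z + w) <= ker z * (1 - (2 + s) * th + 40 * th ^+ 2), `|th| <= 8^-1 &
      th ^+ 2 * norm2 z ^+ 2 <= norm2 w ^+ 2].
Proof.
move=> hw th; have z0 := norm2_ge0 z; have w0 := norm2_ge0 w.
have cs : dot2 z w ^+ 2 <= norm2 z ^+ 2 * norm2 w ^+ 2.
  by rewrite !sqr_norm2 /dot2; have := sqr_ge0 (z.1 * w.2 - z.2 * w.1); nra.
have [zE|zn] := eqVneq z 0.
  have w00 : w = 0.
    by apply/eqP; rewrite -norm2_eq0 eq_le w0 andbT; move: hw; rewrite zE norm2_0 mulr0.
  have thE : th = 0 by rewrite /th zE norm2_0 expr0n/= invr0 mulr0.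
  split.
  - have -> : ker (z + w) = 0 by rewrite zE w00 addr0 ker0.
    by rewrite thE mulr0 subr0 expr0n/= mulr0 addr0 mulr1 ker_ge0.
  - by rewrite thE normr0.
  - by rewrite thE expr0n/= mul0r sqr_ge0.
have zp : 0 < norm2 z by rewrite norm2_gt0.
have zp2 : 0 < norm2 z ^+ 2 by rewrite exprn_gt0.
have th2 : th ^+ 2 * norm2 z ^+ 2 <= norm2 w ^+ 2.
  have -> : th ^+ 2 * norm2 z ^+ 2 = dot2 z w ^+ 2 / norm2 z ^+ 2 by rewrite /th; field; rewrite gt_eqF.
  by rewrite ler_pdivrMr// mulrC.
have thb : `|th| <= 8^-1.
  rewrite -ler_sqr ?nnegrE// real_normK ?num_real// -(ler_pM2r zp2).
  apply: (le_trans th2); rewrite -exprMn ler_sqr ?nnegrE// mulr_ge0//.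
split => //.
have e : norm2 (z + w) ^+ 2 = norm2 z ^+ 2 * (1 + 2 * th) + norm2 w ^+ 2.
  have -> : norm2 z ^+ 2 * (1 + 2 * th) = norm2 z ^+ 2 + 2 * dot2 z w by rewrite /th; field; rewrite gt_eqF.
  by rewrite !sqr_norm2 /dot2 /=; ring.
have hth : `|2 * th| <= 4^-1 by rewrite normrM ger0_norm//; lra.
have t1 : 0 < 1 + 2 * th by move: thb; rewrite ler_norml => /andP[]; lra.
have pt := @powR_taylor (1 + s / 2) (2 * th) ltac:(have := s0; have := s1; move=> *; apply/andP; split; lra) hth.
rewrite !kerE2.
apply: (@le_trans _ _ ((norm2 z ^+ 2 * (1 + 2 * th)) `^ (1 + s / 2))^-1).
  have n2 : 0 < norm2 z ^+ 2 * (1 + 2 * th) by rewrite mulr_gt0.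
  have n1 : 0 < norm2 (z + w) ^+ 2 by rewrite e ltr_wpDr ?sqr_ge0.
  rewrite lef_pV2 ?posrE ?powR_gt0//.
  apply: ge0_ler_powR; rewrite ?nnegrE ?(ltW n1) ?(ltW n2)//.
    by have := s0; lra.
  by rewrite e lerDl sqr_ge0.
rewrite powRM ?(ltW zp2) ?(ltW t1)// invfM ler_wpM2l ?invr_ge0 ?powR_ge0//.
by apply: (le_trans pt); rewrite le_eqVlt; apply/orP; left; apply/eqP; field.
Qed.

(* The terms of first order in [th], [A], [B] cancel between the two opposite slides. *)
Lemma bracket_bound (K K1 K2 p th A B : R) : 0 <= K -> 2 <= p <= 3 ->
  0 <= K1 -> K1 <= K * (1 - p * th + 40 * th ^+ 2) ->
  0 <= K2 -> K2 <= K * (1 + p * th + 40 * th ^+ 2) ->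
  `|A| <= 8^-1 -> `|B| <= 8^-1 ->
  K1 * ((1 + A) * (1 + B)) + K2 * ((1 - A) * (1 - B)) <= K * (2 + 170 * (th ^+ 2 + A ^+ 2 + B ^+ 2)).
Proof.
move=> K0 /andP[p2 p3] K10 h1 K20 h2.
rewrite !ler_norml => /andP[A1 A2] /andP[B1 B2].
have q1 : 0 <= (1 + A) * (1 + B) by rewrite mulr_ge0//; lra.
have q2 : 0 <= (1 - A) * (1 - B) by rewrite mulr_ge0//; lra.
apply: (le_trans (lerD (ler_wpM2r q1 h1) (ler_wpM2r q2 h2))).
rewrite -!mulrA -mulrDr ler_wpM2l//.
have -> : (1 - p * th + 40 * th ^+ 2) * ((1 + A) * (1 + B)) + (1 + p * th + 40 * th ^+ 2) * ((1 - A) * (1 - B))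
  = 2 + 80 * (th ^+ 2 * (1 + A * B)) + 2 * (A * B) - 2 * (p * (th * (A + B))) by ring.
have ab : A * B <= 1 by nra.
have e1 : th ^+ 2 * (1 + A * B) <= th ^+ 2 * 2 by rewrite ler_wpM2l ?sqr_ge0//; lra.
have e2 : 2 * (A * B) <= A ^+ 2 + B ^+ 2 by have := sqr_ge0 (A - B); nra.
have e3 : `|th * (A + B)| <= th ^+ 2 + A ^+ 2 + B ^+ 2.
  rewrite ler_norml; apply/andP; split.
    by have := sqr_ge0 (th + (A + B)); have := sqr_ge0 (A - B); nra.
  by have := sqr_ge0 (th - (A + B)); have := sqr_ge0 (A - B); nra.
have e4 : - (p * (th * (A + B))) <= 3 * (th ^+ 2 + A ^+ 2 + B ^+ 2).
  apply: (le_trans (ler_norm _)); rewrite normrN normrM ger0_norm; last by lra.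
  by apply: ler_pM => //; lra.
have := sqr_ge0 th; have := sqr_ge0 A; have := sqr_ge0 B; lra.
Qed.

End kernel_perturbation.

Section deformed_energy.
Context {R : realType} (s : R) (s01 : 0 < s < 1).
Let s0 : 0 < s. Proof. by case/andP : s01. Qed.
Let s1 : s < 1. Proof. by case/andP : s01. Qed.
Notation ker := (ker s).
Variables (k d rho : R).
Hypotheses (d0 : 0 < d) (rho0 : 0 < rho) (hrho : 2 <= d * ln (1 + rho ^+ 2)).
Implicit Types (x y : R * R) (z : (R * R) * (R * R)).
Let E := norm2 (1, k : R).

Section change.
Variables (t : R).
Hypothesis (ht : 8 * d * E * `|t| <= 4^-1).
Notation defo := (deform k d t).
Notation jac := (deformJ k d t).

Let jac0 x : 0 <= jac x. Proof. exact: (jac_ge0 d0 rho0 hrho ht). Qed.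

Let mdefo : measurable_fun setT defo.
Proof. by have me := measurable_logcut d0; rewrite /deform; mfun. Qed.

Let mjac : measurable_fun setT jac.
Proof. by have me := measurable_dlogcut k d; rewrite /deformJ; mfun. Qed.

Lemma defo_change2 (G : (R * R) * (R * R) -> \bar R) : measurable_fun setT G -> (forall z, (0 <= G z)%E) ->
  (\int[lam2]_z G z = \int[lam2]_z (G (defo z.1, defo z.2) * (jac z.1 * jac z.2)%:E))%E.
Proof.
move=> mG G0.
have md2 : measurable_fun setT (fun z => (defo z.1, defo z.2)).
  by apply: measurable_fun_pair; apply: (measurableT_comp mdefo).
have mG2 : measurable_fun setT (fun z => G (defo z.1, defo z.2)) := measurableT_comp mG md2.
have mj2 : measurable_fun setT (fun z => jac z.1 * jac z.2) by mfun.
have mH : measurable_fun setT (fun z => (G (defo z.1, defo z.2) * (jac z.1 * jac z.2)%:E)%E).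
  by apply: emeasurable_funM => //; apply/measurable_EFinP.
have H0 z : (0 <= G (defo z.1, defo z.2) * (jac z.1 * jac z.2)%:E)%E by rewrite mule_ge0// lee_fin mulr_ge0.
rewrite (lam2_tonelli mG G0) (lam2_tonelli mH H0).
have mF := @measurable_fun_fubini_tonelli_F _ _ _ _ _ lam _ mG G0.
have F0 x : (0 <= \int[lam]_y G (x, y))%E by apply: integral_ge0.
rewrite (defo_change d0 rho0 hrho ht mF F0); apply: eq_integral => x _ /=.
have mGx : measurable_fun setT (fun y => G (defo x, y)).
  exact: (measurable_slice (T1 := (measurableTypeR R * measurableTypeR R)%type) (T2 := (measurableTypeR R * measurableTypeR R)%type)).
rewrite /fubini_F.
have -> : (\int[lam]_y G (defo x, y) = \int[lam]_y (G (defo x, defo y) * (jac y)%:E))%E.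
  exact: (defo_change d0 rho0 hrho ht mGx (fun y => G0 _)).
have mGy : measurable_fun setT (fun y => (G (defo x, defo y) * (jac y)%:E)%E).
  apply: emeasurable_funM; last by apply/measurable_EFinP.
  exact: (measurableT_comp mGx mdefo).
rewrite -(@ge0_integralZr _ _ R lam _ measurableT (fun y => (G (defo x, defo y) * (jac y)%:E)%E)) ?lee_fin//;
  last by move=> y _; rewrite mule_ge0// lee_fin.
by apply: eq_integral => y _; rewrite -muleA -EFinM (mulrC (jac y)).
Qed.

(** The map is injective and fixes every point outside the ball, so it preserves the ball; hence
    [inr] is unchanged by the substitution. *)
Lemma norm2_defo (r : R) x : rho <= r -> (norm2 (defo x) < r) = (norm2 x < r).
Proof.
move=> hr; have fix_ y : r <= norm2 y -> defo y = y.
  move=> ry; rewrite /deform (logcut_eq0 d0 rho0 hrho (le_trans hr ry)) !mulr0 !addr0.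
  by case: y {ry}.
apply/idP/idP; rewrite !ltNge; apply: contra => h; first by rewrite fix_.
by have := defo_inj d0 ht (fix_ _ h); move=> <-.
Qed.

Definition defo_inv x : R * R := projT1 (cid (defo_surj k d t x)).

Lemma defo_invK x : defo (defo_inv x) = x.
Proof. by rewrite /defo_inv; case: cid. Qed.

Lemma defoK x : defo_inv (defo x) = x.
Proof. by apply: (defo_inj d0 ht); rewrite defo_invK. Qed.

Lemma defo_inv_lip x y : norm2 (defo_inv y - defo_inv x) <= 2 * norm2 (y - x).
Proof. by have := defo_expand d0 ht (defo_inv x) (defo_inv y); rewrite !defo_invK. Qed.

Lemma defo_inv_far x : rho <= norm2 x -> defo_inv x = x.
Proof.
move=> h; apply: (defo_inj d0 ht); rewrite defo_invK.
rewrite /deform (logcut_eq0 d0 rho0 hrho h) !mulr0 !addr0; by case: x {h}.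
Qed.

Lemma defo_inv_near x : d * ln (nsq (x - (t, t * k))) <= 1 -> defo_inv x = x - (t, t * k).
Proof.
move=> h; apply: (defo_inj d0 ht); rewrite defo_invK /deform (logcut_eq1 h) !mulr1.
rewrite [LHS]surjective_pairing /=; congr pair; [ring|ring].
Qed.

Variable (u : R * R -> R).
Hypothesis cu : forall x, cont2 u x.

(** Composition with the inverse map: after the change of variables the values of [u] are taken at
    the original points, and the deformation is felt only by the kernel and the Jacobians. *)
Definition udef x := u (defo_inv x).

Lemma cont2_udef x : cont2 udef x.
Proof.
move=> e e0; have [c c0 hc] := cu (defo_inv x) e0.
exists (c / 2); first by rewrite divr_gt0.
move=> y hy; apply: hc; have := defo_inv_lip x y; lra.
Qed.

Lemma Dr_udef (r : R) : rho <= r -> Dr s r udef =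
  (\int[lam2]_z (inr r z * ((u z.1 - u z.2) ^+ 2 * (ker (defo z.2 - defo z.1) * (jac z.1 * jac z.2))))%:E)%E.
Proof.
move=> hr; have mu := cont2_measurable cont2_udef.
have md := measurable_dens s mu; have mi := measurable_inr r.
have mG : measurable_fun setT (fun z => (inr r z * dens s udef z)%:E) by mfun.
have G0 z : (0 <= (inr r z * dens s udef z)%:E)%E by rewrite lee_fin mulr_ge0 ?inr_ge0 ?dens_ge0.
rewrite /Dr (defo_change2 mG G0); apply: eq_integral => z _.
by rewrite -EFinM /inr /dens /udef /= !norm2_defo// !defoK; congr (_%:E); ring.
Qed.

Lemma Wr_udef (r : R) : rho <= r -> Wr r udef =
  (\int[lam]_x (chi (norm2 x < r)%R * (1 - u x ^+ 2) ^+ 2 * jac x)%:E)%E.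
Proof.
move=> hr; have mu := cont2_measurable cont2_udef.
have mG : measurable_fun setT (fun x => (chi (norm2 x < r)%R * (1 - udef x ^+ 2) ^+ 2 : R)%:E) by mfun.
have G0 x : (0 <= (chi (norm2 x < r)%R * (1 - udef x ^+ 2) ^+ 2 : R)%:E)%E by rewrite lee_fin mulr_ge0 ?sqr_ge0.
rewrite /Wr (defo_change d0 rho0 hrho ht mG G0); apply: eq_integral => x _.
by rewrite -EFinM /udef norm2_defo// defoK.
Qed.

End change.

(** The slides by [t] and [- t] change [z.2 - z.1] by opposite vectors and the Jacobians by opposite
    amounts, so [bracket_bound] applies. The squares of [th], [A] and [B] together are at most twice
    the sum of the weights, hence [340 = 2 * 170]. *)
Lemma pair_bound (t : R) z : 8 * d * E * `|t| <= 8^-1 ->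
  ker (deform k d t z.2 - deform k d t z.1) * (deformJ k d t z.1 * deformJ k d t z.2)
  + ker (deform k d (- t) z.2 - deform k d (- t) z.1) * (deformJ k d (- t) z.1 * deformJ k d (- t) z.2)
  <= ker (z.2 - z.1) * (2 + 340 * (8 * d * E * t) ^+ 2 * (logweight rho z.1 + logweight rho z.2)).
Proof.
move=> ht; set x := z.1; set y := z.2.
pose c := t * (logcut d y - logcut d x); pose w : R * R := (c * 1, c * k).
have E0 : 0 <= E := norm2_ge0 _.
have nw : norm2 w = `|c| * E by rewrite /w (norm2_scale c (1, k)).
have n0 := norm2_ge0 (y - x).
have wz : norm2 w <= 8^-1 * norm2 (y - x).
  rewrite nw /c normrM; have h := logcut_lip d0 x y.
  apply: (@le_trans _ _ (8 * d * E * `|t| * norm2 (y - x))); last by rewrite ler_wpM2r.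
  have -> : 8 * d * E * `|t| * norm2 (y - x) = `|t| * (8 * d * norm2 (y - x)) * E by ring.
  by rewrite ler_wpM2r// ler_wpM2l.
have d1 : deform k d t y - deform k d t x = (y - x) + w.
  by rewrite /deform /w /c; congr pair; rewrite /=; ring.
have d2 : deform k d (- t) y - deform k d (- t) x = (y - x) + - w.
  by rewrite /deform /w /c; congr pair; rewrite /=; ring.
have [k1 thb th2] := ker_perturb s01 wz.
have wzN : norm2 (- w) <= 8^-1 * norm2 (y - x) by rewrite norm2N.
have [k2 _ _] := ker_perturb s01 wzN.
have dN : dot2 (y - x) (- w) / norm2 (y - x) ^+ 2 = - (dot2 (y - x) w / norm2 (y - x) ^+ 2).
  by rewrite -mulNr; congr (_ / _); rewrite /dot2 /=; ring.
move: k1 k2 thb th2; rewrite /= dN; set th := dot2 _ _ / _ => k1 k2 thb th2.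
have AB v : `|t * dlogcut k d v| <= 8^-1.
  by rewrite normrM mulrC; apply: le_trans ht; rewrite ler_wpM2r//; exact: (dlogcut_bound k d0 rho0 hrho).
rewrite d1 d2; have K0 := ker_ge0 s (y - x).
have := @bracket_bound R (ker (y - x)) (ker (y - x + w)) (ker (y - x + - w)) (2 + s) th (t * dlogcut k d x) (t * dlogcut k d y)
  K0 ltac:(have := s0; have := s1; move=> *; apply/andP; split; lra) (ker_ge0 s _) k1 (ker_ge0 s _)
  ltac:(by move: k2; rewrite mulrN opprK sqrrN) (AB x) (AB y).
rewrite /deformJ !mulNr => h; apply: (le_trans h).
have [e|ne] := eqVneq (y - x) 0.
  have K00 : ker (y - x) = 0 by rewrite e ker0.
  by rewrite K00; lra.
rewrite ler_wpM2l// lerD2l.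
have zp2 : 0 < norm2 (y - x) ^+ 2 by rewrite exprn_gt0// norm2_gt0.
have c2 : (8 * d * E * t) ^+ 2 = (8 * d * E) ^+ 2 * t ^+ 2 by rewrite exprMn.
have b1 : th ^+ 2 <= (8 * d * E * t) ^+ 2 * (logweight rho x + logweight rho y).
  rewrite -(ler_pM2r zp2); apply: (le_trans th2).
  rewrite nw exprMn real_normK ?num_real// /c exprMn.
  have h2 := logcut_diff_sqr d0 rho0 hrho x y.
  apply: (@le_trans _ _ (t ^+ 2 * ((8 * d) ^+ 2 * norm2 (y - x) ^+ 2 * (logweight rho x + logweight rho y)) * E ^+ 2)).
    by rewrite ler_wpM2r ?sqr_ge0// ler_wpM2l// sqr_ge0.
  by rewrite le_eqVlt; apply/orP; left; apply/eqP; ring.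
have b2 v : (t * dlogcut k d v) ^+ 2 <= (8 * d * E * t) ^+ 2 * logweight rho v.
  rewrite [leLHS]exprMn c2.
  have -> : (8 * d * E) ^+ 2 * t ^+ 2 * logweight rho v = t ^+ 2 * ((8 * d * E) ^+ 2 * logweight rho v) by ring.
  rewrite ler_wpM2l ?sqr_ge0//.
  exact: (dlogcut_sqr k d0 rho0 hrho v).
have := b2 x; have := b2 y; rewrite mulrDr in b1 *; rewrite !mulrDr -!mulrA; lra.
Qed.

Variable (u : R * R -> R).
Hypotheses (cu : forall x, cont2 u x).

(** Integrates [pair_bound]; exchanging the two points merges the two weights, hence
    [680 = 2 * 340]. The potential involves no kernel, and the Jacobians of the opposite slides add
    up to [2], which gives an equality. *)
Lemma energy_second_diff (t r : R) (h1 : 8 * d * E * `|t| <= 4^-1) (h2 : 8 * d * E * `|- t| <= 4^-1) :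
  8 * d * E * `|t| <= 8^-1 -> rho <= r ->
  (Dr s r (udef t u) + Dr s r (udef (- t) u) <=
    2%:E * Dr s r u + (680 * (8 * d * E * t) ^+ 2)%:E * \int[lam2]_z (logweight rho z.1 * dens s u z)%:E)%E
  /\ (Wr r (udef t u) + Wr r (udef (- t) u) = 2%:E * Wr r u)%E.
Proof.
move=> ht hr; have mu := cont2_measurable cu.
have md := measurable_dens s mu; have mi := measurable_inr r; have mk := measurable_ker1 s.
have me := measurable_logcut d0; have mde := measurable_dlogcut k d; have mo := measurable_logweight rho.
have o0 := logweight_ge0 rho; have D0 := dens_ge0 s u; have I0 := inr_ge0 r.
have mdf t' : measurable_fun setT (deform k d t') by rewrite /deform; mfun.
have mj t' : measurable_fun setT (deformJ k d t') by rewrite /deformJ; mfun.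
have j0 t' : 8 * d * E * `|t'| <= 4^-1 -> forall x, 0 <= deformJ k d t' x by move=> h x; exact: (jac_ge0 d0 rho0 hrho h).
split; last first.
  rewrite (Wr_udef h1 cu hr) (Wr_udef h2 cu hr).
  have mw : measurable_fun setT (fun x : R * R => chi (norm2 x < r) * (1 - u x ^+ 2) ^+ 2 : R) by mfun.
  have w0 x : 0 <= chi (norm2 x < r) * (1 - u x ^+ 2) ^+ 2 :> R by rewrite mulr_ge0 ?sqr_ge0.
  have m1 : measurable_fun setT (fun x => chi (norm2 x < r) * (1 - u x ^+ 2) ^+ 2 * deformJ k d t x).
    by have := mj t => mjt; apply: measurable_funM.
  have m2 : measurable_fun setT (fun x => chi (norm2 x < r) * (1 - u x ^+ 2) ^+ 2 * deformJ k d (- t) x).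
    by have := mj (- t) => mjt; apply: measurable_funM.
  rewrite -(ge0_intD lam m1 m2 (fun x => mulr_ge0 (w0 x) (j0 _ h1 x)) (fun x => mulr_ge0 (w0 x) (j0 _ h2 x))).
  rewrite /Wr -(ge0_intZ lam mw (ler0n _ 2) w0); apply: eq_integral => x _.
  by rewrite /deformJ; congr (_%:E); ring.
rewrite (Dr_udef h1 cu hr) (Dr_udef h2 cu hr).
pose F t' z := inr r z * ((u z.1 - u z.2) ^+ 2 * (ker (deform k d t' z.2 - deform k d t' z.1) * (deformJ k d t' z.1 * deformJ k d t' z.2))).
have mF t' : measurable_fun setT (F t').
  by have := mj t'; have := mdf t' => mdt mjt; rewrite /F; mfun.
have F0 t' : 8 * d * E * `|t'| <= 4^-1 -> forall z, 0 <= F t' z.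
  by move=> h z; rewrite mulr_ge0// mulr_ge0 ?sqr_ge0// mulr_ge0 ?ker_ge0// mulr_ge0// j0.
rewrite -(ge0_intD lam2 (mF t) (mF (- t)) (F0 _ h1) (F0 _ h2)).
pose C := 340 * (8 * d * E * t) ^+ 2.
have C0 : 0 <= C by rewrite /C; apply: mulr_ge0; [exact: ler0n|exact: sqr_ge0].
have mid : measurable_fun setT (fun z => inr r z * dens s u z) by mfun.
have id0 z : 0 <= inr r z * dens s u z by rewrite mulr_ge0.
have mo1 : measurable_fun setT (fun z => logweight rho z.1 * dens s u z).
  by apply: measurable_funM => //; exact: (measurableT_comp mo measurable_fst).
have mo2 : measurable_fun setT (fun z => logweight rho z.2 * dens s u z).
  by apply: measurable_funM => //; exact: (measurableT_comp mo measurable_snd).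
have oo1 z : 0 <= logweight rho z.1 * dens s u z by rewrite mulr_ge0.
have oo2 z : 0 <= logweight rho z.2 * dens s u z by rewrite mulr_ge0.
have m2i : measurable_fun setT (fun z => 2 * (inr r z * dens s u z)) by mfun.
have mco : measurable_fun setT (fun z => C * (logweight rho z.1 * dens s u z + logweight rho z.2 * dens s u z)).
  by apply: measurable_funM => //; exact: measurable_funD.
apply: (@le_trans _ _ (\int[lam2]_z (2 * (inr r z * dens s u z) + C * (logweight rho z.1 * dens s u z + logweight rho z.2 * dens s u z))%:E)%E).
  apply: (ge0_le_int lam2).
  - exact: (measurable_funD (mF t) (mF (- t))).
  - exact: (measurable_funD m2i mco).
  - by move=> z; rewrite addr_ge0// F0.
  move=> z; rewrite /F -!mulrDr.
  have pb := pair_bound z ht.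
  have i1 : inr r z <= 1 by rewrite /inr ge_max; case: (_ < _); case: (_ < _); rewrite /= ?lexx ?ler01.
  have sq0 := sqr_ge0 (u z.1 - u z.2).
  apply: (@le_trans _ _ (inr r z * ((u z.1 - u z.2) ^+ 2 * (ker (z.2 - z.1) * (2 + C * (logweight rho z.1 + logweight rho z.2)))))).
    by rewrite ler_wpM2l// ler_wpM2l.
  have -> : inr r z * ((u z.1 - u z.2) ^+ 2 * (ker (z.2 - z.1) * (2 + C * (logweight rho z.1 + logweight rho z.2)))) =
    2 * (inr r z * dens s u z) + inr r z * (C * ((logweight rho z.1 + logweight rho z.2) * dens s u z)) by rewrite /dens; ring.
  rewrite lerD2l -mulrDl ler_piMl// mulr_ge0// mulr_ge0// addr_ge0//.
have sw : (\int[lam2]_z (logweight rho z.2 * dens s u z)%:E = \int[lam2]_z (logweight rho z.1 * dens s u z)%:E)%E.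
  have mo1E : measurable_fun setT (fun z => (logweight rho z.1 * dens s u z)%:E) by apply/measurable_EFinP.
  rewrite -(lam2_swap mo1E) => [|z]; last by rewrite lee_fin.
  by apply: eq_integral => z _; rewrite densC.
rewrite (ge0_intD lam2 m2i mco (fun z => mulr_ge0 (ler0n _ 2) (id0 z)) (fun z => mulr_ge0 C0 (addr_ge0 (oo1 z) (oo2 z)))).
rewrite (ge0_intZ lam2 mid (ler0n _ 2) id0) leeD2l//.
rewrite (ge0_intZ lam2 (measurable_funD mo1 mo2) C0 (fun z => addr_ge0 (oo1 z) (oo2 z))).
rewrite (ge0_intD lam2 mo1 mo2 oo1 oo2) sw -mule2n.
rewrite (_ : 680 * (8 * d * E * t) ^+ 2 = C * 2); last by rewrite /C; ring.
by rewrite [in leRHS]EFinM -muleA; rewrite mule_natl.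
Qed.

End deformed_energy.

Section logweight_integral.
Context {R : realType} (s : R) (s01 : 0 < s < 1).
Variables (u : R * R -> R) (mu : measurable_fun setT u) (hu : sol s u).

(** The quadratic growth in [gamma_bound] is balanced by the weight: each dyadic annulus contributes
    at most [16 * gamma_cst s], so the total grows like the logarithm of the radius. *)
Lemma logweight_int n :
  (\int[lam2]_z (logweight (2 ^+ n) z.1 * dens s u z)%:E <= (16 * gamma_cst s * n.+1%:R)%:E)%E.
Proof.
have g0 := gamma_cst_ge0 s01; have md := measurable_dens s mu; have D0 := dens_ge0 s u.
have mc (r : R) : measurable_fun setT (cutoff r) by apply: (measurable_cutoff r (f := id)); mfun.
have mo (r : R) := measurable_logweight r.
have moz (r : R) : measurable_fun setT (fun z => logweight r z.1 * dens s u z).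
  by apply: measurable_funM => //; exact: (measurableT_comp (mo r) measurable_fst).
have mcz (r : R) : measurable_fun setT (fun z => cutoff r z.1 * dens s u z).
  by apply: measurable_funM => //; exact: (measurableT_comp (mc r) measurable_fst).
have oz (r : R) z : 0 <= logweight r z.1 * dens s u z by rewrite mulr_ge0 ?logweight_ge0.
have cz (r : R) z : 0 <= cutoff r z.1 * dens s u z by rewrite mulr_ge0 ?cutoff_ge0.
elim: n => [|n ih].
  apply: (@le_trans _ _ (\int[lam2]_z (cutoff 1 z.1 * dens s u z)%:E)%E).
    apply: (ge0_le_int lam2 (moz _) (mcz _) (oz _)) => z.
    rewrite ler_wpM2r// /logweight expr0; case: (ltP (norm2 z.1) 1) => h; last by rewrite mul0r cutoff_ge0.
    by rewrite cutoff_eq1 ?(ltW h)// mul1r invf_le1 ?nsq_gt0// nsq_ge1.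
  apply: (le_trans (gamma_bound s01 mu hu (@ler01 R))); rewrite lee_fin; lra.
have p0 m : 0 < 2 ^+ m :> R by rewrite exprn_gt0.
pose c : R := 4 * (2 ^+ n.+1 ^+ 2)^-1.
have c0 : 0 <= c by rewrite mulr_ge0// invr_ge0 sqr_ge0.
have mccz : measurable_fun setT (fun z => c * (cutoff (2 ^+ n.+1) z.1 * dens s u z)) by exact: measurable_funM.
apply: (@le_trans _ _ (\int[lam2]_z (logweight (2 ^+ n) z.1 * dens s u z
    + c * (cutoff (2 ^+ n.+1) z.1 * dens s u z))%:E)%E).
  suff pw z : logweight (2 ^+ n.+1) z.1 * dens s u z <= logweight (2 ^+ n) z.1 * dens s u z
      + c * (cutoff (2 ^+ n.+1) z.1 * dens s u z).
    exact: (ge0_le_int lam2 (moz _) (measurable_funD (moz _) mccz) (oz _) pw).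
  have -> : logweight (2 ^+ n) z.1 * dens s u z + c * (cutoff (2 ^+ n.+1) z.1 * dens s u z) =
    (logweight (2 ^+ n) z.1 + c * cutoff (2 ^+ n.+1) z.1) * dens s u z by ring.
  rewrite ler_wpM2r//.
  have n1 := nsq_gt0 z.1.
  rewrite /logweight; case: (ltP (norm2 z.1) (2 ^+ n.+1)) => h; last first.
    by rewrite mul0r addr_ge0// ?mulr_ge0 ?cutoff_ge0 ?invr_ge0// ltW.
  rewrite (cutoff_eq1 (ltW h)) mulr1; case: (ltP (norm2 z.1) (2 ^+ n)) => h'; first by rewrite lerDl.
  rewrite mul0r add0r mul1r /c (exprS (2 : R) n) exprMn.
  have -> : 4 * (2 ^+ 2 * (2 ^+ n) ^+ 2)^-1 = ((2 ^+ n) ^+ 2)^-1 :> R by field; rewrite gt_eqF.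
  rewrite lef_pV2 ?posrE ?exprn_gt0// nsqE.
  have : (2 ^+ n) ^+ 2 <= norm2 z.1 ^+ 2 by rewrite ler_sqr ?nnegrE ?(ltW (p0 _)) ?norm2_ge0.
  lra.
rewrite (ge0_intD lam2 (moz _) mccz (oz _) (fun z => mulr_ge0 c0 (cz _ z))).
rewrite (ge0_intZ lam2 (mcz _) c0 (cz _)).
have gb := gamma_bound s01 mu hu (ltW (p0 n.+1)).
apply: (le_trans (leeD ih (lee_wpmul2l _ gb))); first by rewrite lee_fin.
rewrite -EFinM -EFinD lee_fin.
have -> : n.+2%:R = n.+1%:R + 1 :> R by rewrite natr1.
rewrite (mulrDr (16 * gamma_cst s)) mulr1 lerD2l.
have h1 : (1 : R) <= 2 ^+ n.+1 by rewrite exprn_ege1// ler1n.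
have h2 : (2 ^+ n.+1 + 1) ^+ 2 <= 4 * 2 ^+ n.+1 ^+ 2 :> R.
  have -> : 4 * 2 ^+ n.+1 ^+ 2 = (2 * 2 ^+ n.+1) ^+ 2 :> R by ring.
  by rewrite ler_sqr ?nnegrE; lra.
rewrite /c.
have -> : 4 * (2 ^+ n.+1 ^+ 2)^-1 * (gamma_cst s * (2 ^+ n.+1 + 1) ^+ 2) =
  4 * gamma_cst s * ((2 ^+ n.+1 + 1) ^+ 2 / 2 ^+ n.+1 ^+ 2) by ring.
have -> : 16 * gamma_cst s = 4 * gamma_cst s * 4 by ring.
by rewrite ler_wpM2l ?mulr_ge0// ler_pdivrMr// exprn_gt0.
Qed.

End logweight_integral.

(** * Comparison with deformed functions *)

Section lattice_energies.
Context {R : realType} (s : R).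
Notation pos x := (Num.max x 0).
Implicit Types (x : R * R) (z : (R * R) * (R * R)) (u v : R * R -> R).

Lemma cont2_max u v x : cont2 u x -> cont2 v x -> cont2 (fun y => Num.max (u y) (v y)) x.
Proof.
move=> cu cv; rewrite (_ : (fun y => _) = (fun y => u y + pos (v y - u y))).
  by apply: cont2D => //; apply: cont2_max0; exact: cont2B.
by apply/funext => y; case: (leP (u y) (v y)) => h;
  [rewrite max_l ?subr_ge0// addrC subrK|rewrite max_r ?addr0// subr_le0 ltW].
Qed.

Lemma cont2_min u v x : cont2 u x -> cont2 v x -> cont2 (fun y => Num.min (u y) (v y)) x.
Proof.
move=> cu cv; rewrite (_ : (fun y => _) = (fun y => u y - pos (u y - v y))).
  by apply: cont2B => //; apply: cont2_max0; exact: cont2B.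
by apply/funext => y; case: (leP (u y) (v y)) => h;
  [rewrite max_r ?subr0// subr_le0|rewrite max_l ?subr_ge0 ?(ltW h)// opprB addrC subrK].
Qed.

(** Only the first of the two cross products in [submodular] is kept: one crossing of [u] and [v] is
    enough to make it positive. *)
Definition gain (r : R) u v : \bar R :=
  (\int[lam2]_z (inr r z * (pos (u z.1 - v z.1) * pos (v z.2 - u z.2) * ker s (z.2 - z.1)))%:E)%E.

Lemma gain_ge0 r u v : (0 <= gain r u v)%E.
Proof.
apply: int_ge0 => z; rewrite mulr_ge0 ?inr_ge0// mulr_ge0 ?ker_ge0//.
by rewrite mulr_ge0// le_max lexx orbT.
Qed.

Lemma Dr_ge0 r u : (0 <= Dr s r u)%E.
Proof. by apply: int_ge0 => z; rewrite mulr_ge0 ?inr_ge0 ?dens_ge0. Qed.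

Lemma Wr_ge0 r u : (0 <= Wr r u)%E.
Proof. by apply: int_ge0 => x; rewrite mulr_ge0 ?sqr_ge0. Qed.

Lemma Dr_maxmin r u v : measurable_fun setT u -> measurable_fun setT v ->
  (Dr s r (fun x => Num.max (u x) (v x)) + Dr s r (fun x => Num.min (u x) (v x)) + 2%:E * gain r u v
    <= Dr s r u + Dr s r v)%E.
Proof.
move=> mu mv; have mi := measurable_inr r; have mk := measurable_ker1 s.
have mM : measurable_fun setT (fun x => Num.max (u x) (v x)) by mfun.
have mm : measurable_fun setT (fun x => Num.min (u x) (v x)) by mfun.
have md (f : R * R -> R) : measurable_fun setT f -> measurable_fun setT (fun z => inr r z * dens s f z).
  by move=> /(measurable_dens s) mf; mfun.
have d0 (f : R * R -> R) z : 0 <= inr r z * dens s f z by rewrite mulr_ge0 ?inr_ge0 ?dens_ge0.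
pose q z := inr r z * (pos (u z.1 - v z.1) * pos (v z.2 - u z.2) * ker s (z.2 - z.1)).
have mq : measurable_fun setT q by rewrite /q; mfun.
have p0 (a : R) : 0 <= pos a by rewrite le_max lexx orbT.
have q0 z : 0 <= q z by rewrite /q mulr_ge0 ?inr_ge0// mulr_ge0 ?ker_ge0// mulr_ge0.
have m2q : measurable_fun setT (fun z => 2 * q z) by exact: measurable_funM.
rewrite /gain -(ge0_intZ lam2 mq (ler0n _ 2) q0) /Dr.
rewrite -(ge0_intD lam2 (md _ mM) (md _ mm) (d0 _) (d0 _)).
rewrite -(ge0_intD lam2 (measurable_funD (md _ mM) (md _ mm)) m2q (fun z => addr_ge0 (d0 _ z) (d0 _ z)) (fun z => mulr_ge0 (ler0n _ 2) (q0 z))).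
rewrite -(ge0_intD lam2 (md _ mu) (md _ mv) (d0 _) (d0 _)).
suff h z : inr r z * dens s (fun x => Num.max (u x) (v x)) z + inr r z * dens s (fun x => Num.min (u x) (v x)) z
    + 2 * q z <= inr r z * dens s u z + inr r z * dens s v z.
  apply: (ge0_le_int lam2 _ _ _ h).
  - exact: (measurable_funD (measurable_funD (md _ mM) (md _ mm)) m2q).
  - exact: (measurable_funD (md _ mu) (md _ mv)).
  - by move=> z; rewrite !addr_ge0// mulr_ge0.
rewrite /q /dens.
have := submodular (u z.1) (u z.2) (v z.1) (v z.2).
set A := (Num.max _ _ - _) ^+ 2; set B := (Num.min _ _ - _) ^+ 2.
set C := (u z.1 - u z.2) ^+ 2; set D := (v z.1 - v z.2) ^+ 2.
set P := pos _ * pos _; set Q := pos _ * pos _ => e.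
have Q0 : 0 <= Q by rewrite /Q mulr_ge0.
have i0 := inr_ge0 r z; have K0 := ker_ge0 s (z.2 - z.1).
have ik : 0 <= inr r z * ker s (z.2 - z.1) by rewrite mulr_ge0.
have := mulr_ge0 ik Q0.
move: (inr r z) (ker s _) => I K iQ.
have -> : I * (C * K) + I * (D * K) = I * K * (C + D) by ring.
by rewrite -e; lra.
Qed.

Lemma Wr_maxmin r u v : measurable_fun setT u -> measurable_fun setT v ->
  (Wr r (fun x => Num.max (u x) (v x)) + Wr r (fun x => Num.min (u x) (v x)) = Wr r u + Wr r v)%E.
Proof.
move=> mu mv.
have mM : measurable_fun setT (fun x => Num.max (u x) (v x)) by mfun.
have mm : measurable_fun setT (fun x => Num.min (u x) (v x)) by mfun.
have mw (f : R * R -> R) : measurable_fun setT f ->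
    measurable_fun setT (fun x => chi (norm2 x < r) * (1 - f x ^+ 2) ^+ 2 : R) by move=> mf; mfun.
have w0 (f : R * R -> R) x : 0 <= chi (norm2 x < r) * (1 - f x ^+ 2) ^+ 2 :> R by rewrite mulr_ge0 ?sqr_ge0.
rewrite /Wr -(ge0_intD lam (mw _ mM) (mw _ mm) (w0 _) (w0 _)) -(ge0_intD lam (mw _ mu) (mw _ mv) (w0 _) (w0 _)).
apply: eq_integral => x _; congr (_%:E).
by case: (leP (u x) (v x)) => _ //; rewrite addrC.
Qed.

Lemma Wr_fin r u : 0 <= r -> measurable_fun setT u -> (forall x, `|u x| <= 1) -> (Wr r u < +oo)%E.
Proof.
move=> r0 mu u1; apply: (@le_lt_trans _ _ (\int[lam]_x (chi (norm2 x <= r)%R : R)%:E)%E).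
  apply: (ge0_le_int lam); [by mfun|by mfun|by move=> x; rewrite mulr_ge0 ?sqr_ge0|].
  move=> x; case: (ltP (norm2 x) r) => h; last by rewrite mul0r.
  rewrite (ltW h) mul1r; have := u1 x; rewrite ler_norml => /andP[h1 h2].
  have h3 : 0 <= u x ^+ 2 <= 1 by rewrite sqr_ge0/=; nra.
  by move: (u x ^+ 2) h3 => y /andP[y0 y1] /=; nra.
by apply: (le_lt_trans (lam_ball_le r0)); rewrite ltry.
Qed.

End lattice_energies.

Section comparison.
Context {R : realType} (s : R) (s01 : 0 < s < 1).
Variables (u : R * R -> R).
Hypotheses (mu : measurable_fun setT u) (hu : sol s u) (hmin : is_minimizer s u).
Implicit Types (x : R * R).

Let cu := sol_continuous s01 mu hu.
Let u1 := sol_bounded s01 mu hu.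

Let real_of (X : \bar R) : (0 <= X)%E -> (X < +oo)%E -> exists2 a : R, 0 <= a & X = a%:E.
Proof.
move=> X0 Xoo; exists (fine X); first exact: fine_ge0.
by rewrite fineK// ge0_fin_numE.
Qed.

(** The deformed functions, the maximum and the minimum all coincide with [u] beyond radius
    [rho < r], so [min_ext] applies to each of them in the ball of radius [r]. *)
Lemma gain_bound (k d rho t r : R) (d0 : 0 < d) (rho0 : 0 < rho) (I : R) :
  2 <= d * ln (1 + rho ^+ 2) -> 8 * d * norm2 (1, k) * `|t| <= 8^-1 -> rho < r -> 0 <= I ->
  (\int[lam2]_z (logweight rho z.1 * dens s u z)%:E <= I%:E)%E ->
  (2%:E * gain s r u (udef k d t u) <= (680 * (8 * d * norm2 (1, k) * t) ^+ 2 * I)%:E)%E.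
Proof.
move=> hrho ht hr I0 hI; have r0 : 0 <= r by exact: ltW (lt_trans rho0 hr).
have h1 : 8 * d * norm2 (1, k) * `|t| <= 4^-1 by apply: (le_trans ht); lra.
have h2 : 8 * d * norm2 (1, k) * `|- t| <= 4^-1 by rewrite normrN.
pose v := udef k d t u; pose v' := udef k d (- t) u.
have cv : forall x, cont2 v x := cont2_udef d0 h1 cu.
have cv' : forall x, cont2 v' x := cont2_udef d0 h2 cu.
have v1 x : `|v x| <= 1 by exact: u1.
have v1' x : `|v' x| <= 1 by exact: u1.
have vf x : rho <= norm2 x -> v x = u x by move=> h; rewrite /v /udef (defo_inv_far d0 rho0 hrho h1 h).
have vf' x : rho <= norm2 x -> v' x = u x by move=> h; rewrite /v' /udef (defo_inv_far d0 rho0 hrho h2 h).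
have [hD hW] := energy_second_diff s01 d0 rho0 hrho cu h1 h2 ht (ltW hr).
pose C : R := 680 * (8 * d * norm2 (1, k) * t) ^+ 2.
have C0 : 0 <= C by rewrite /C; apply: mulr_ge0; [exact: ler0n|exact: sqr_ge0].
have {}hD : (Dr s r v + Dr s r v' <= 2%:E * Dr s r u + (C * I)%:E)%E.
  apply: (le_trans hD); rewrite leeD2l// [leRHS]EFinM lee_wpmul2l// lee_fin//.
have mv := cont2_measurable cv; have mv' := cont2_measurable cv'.
have cM x : cont2 (fun y => Num.max (u y) (v y)) x by exact: cont2_max.
have cm x : cont2 (fun y => Num.min (u y) (v y)) x by exact: cont2_min.
have M1 x : `|Num.max (u x) (v x)| <= 1 by case: (leP (u x) (v x)) => _; [exact: v1|exact: u1].
have m1 x : `|Num.min (u x) (v x)| <= 1 by case: (leP (u x) (v x)) => _; [exact: u1|exact: v1].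
have [du du0 duE] := real_of (Dr_ge0 s r u) (Dr_fin s01 mu hu r0).
have [wu wu0 wuE] := real_of (Wr_ge0 r u) (Wr_fin r0 mu u1).
have [wv wv0 wvE] := real_of (Wr_ge0 r v) (Wr_fin r0 mv v1).
have [wv' wv0' wvE'] := real_of (Wr_ge0 r v') (Wr_fin r0 mv' v1').
have [wM wM0 wME] := real_of (Wr_ge0 r _) (Wr_fin r0 (cont2_measurable cM) M1).
have [wm wm0 wmE] := real_of (Wr_ge0 r _) (Wr_fin r0 (cont2_measurable cm) m1).
(* Finiteness has to precede any subtraction of energies: [energy_second_diff] gives it for the two
   slides, then [Dr_maxmin] for the maximum, the minimum and the gain. *)
have Sfin : (2%:E * Dr s r u + (C * I)%:E < +oo)%E by rewrite duE -EFinM -EFinD ltry.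
have Dvoo : (Dr s r v < +oo)%E.
  by apply: le_lt_trans Sfin; apply: le_trans hD; rewrite leeDl// Dr_ge0.
have Dvoo' : (Dr s r v' < +oo)%E.
  by apply: le_lt_trans Sfin; apply: le_trans hD; rewrite leeDr// Dr_ge0.
have [dv dv0 dvE] := real_of (Dr_ge0 s r v) Dvoo.
have [dv' dv0' dvE'] := real_of (Dr_ge0 s r v') Dvoo'.
have hMm := Dr_maxmin s r mu mv.
have G0 := gain_ge0 s r u v.
have G20 : (0 <= 2%:E * gain s r u v)%E by rewrite mule_ge0// lee_fin.
have Toz : (Dr s r u + Dr s r v < +oo)%E by rewrite duE dvE -EFinD ltry.
have T2 : (Dr s r (fun x => Num.max (u x) (v x)) + Dr s r (fun x => Num.min (u x) (v x)) <= Dr s r u + Dr s r v)%E.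
  by apply: le_trans hMm; rewrite leeDl.
have DMoo : (Dr s r (fun x => Num.max (u x) (v x)) < +oo)%E.
  by apply: le_lt_trans Toz; apply: le_trans T2; rewrite leeDl// Dr_ge0.
have Dmoo : (Dr s r (fun x => Num.min (u x) (v x)) < +oo)%E.
  by apply: le_lt_trans Toz; apply: le_trans T2; rewrite leeDr// Dr_ge0.
have Goo : (2%:E * gain s r u v < +oo)%E.
  by apply: le_lt_trans Toz; apply: le_trans hMm; rewrite leeDr// adde_ge0// Dr_ge0.
have [dM dM0 dME] := real_of (Dr_ge0 s r _) DMoo.
have [dm dm0 dmE] := real_of (Dr_ge0 s r _) Dmoo.
have [g g0 gE] := real_of G20 Goo.
have fM x : rho <= norm2 x -> Num.max (u x) (v x) = u x by move=> h; rewrite (vf _ h) maxxx.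
have fm x : rho <= norm2 x -> Num.min (u x) (v x) = u x by move=> h; rewrite (vf _ h) minxx.
have eM := @min_ext _ s u _ rho r hmin (ltW rho0) hr cu cM u1 M1
  fM (Dr_fin s01 mu hu r0) DMoo.
have em := @min_ext _ s u _ rho r hmin (ltW rho0) hr cu cm u1 m1
  fm (Dr_fin s01 mu hu r0) Dmoo.
have ev := @min_ext _ s u _ rho r hmin (ltW rho0) hr cu cv' u1 v1' vf' (Dr_fin s01 mu hu r0) Dvoo'.
have hWM := Wr_maxmin r mu mv.
move: hD hW eM em ev hWM hMm; rewrite -/v -/v'.
rewrite duE wuE dvE dvE' wvE wvE' dME dmE wME wmE gE.
rewrite -!EFinM -!EFinD !lee_fin => hD [hW] eM em ev [hWM] hMm.
(* With [E] for the total energy: [2 G <= E u + E v - E max - E min <= E v - E u <= E u - E v' + C I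
   <= C I], using minimality against the maximum, the minimum and [v']. *)
by rewrite -/C; lra.
Qed.

Lemma translate_comparable (t k : R) :
  (forall x, u x <= u (x + (t, t * k))) \/ (forall x, u (x + (t, t * k)) <= u x).
Proof.
have [h|/existsNP[x0 hx]] := pselect (forall x, u x <= u (x + (t, t * k))); first by left.
have [h|/existsNP[y0 hy]] := pselect (forall x, u (x + (t, t * k)) <= u x); first by right.
exfalso; move/negP : hx; move/negP : hy; rewrite -!ltNge => hy hx.
pose v0 x := u (x + (t, t * k)).
have cv0 x : cont2 v0 x.
  move=> e e0; have [c c0 hc] := cu (x + (t, t * k)) e0.
  by exists c => // y hxy; apply: hc; rewrite opprD addrACA subrr addr0.
have [c [rho1 [c0 rho10 hgain]]] := gain_pos s01 cu cv0 hx hy.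
pose E := norm2 (1, k); have E0 : 0 <= E by exact: norm2_ge0.
have l2 : 0 < ln 2 :> R by rewrite ln_gt0// ltr1n.
pose b := 8 * E * `|t| / ln 2.
have b0 : 0 <= b by rewrite divr_ge0 ?(ltW l2)// mulr_ge0// mulr_ge0.
pose Q := 1 + (rho1 + norm2 (t, t * k)) ^+ 2.
have Q0 : 0 <= Q by rewrite addr_ge0// sqr_ge0.
pose A := 680 * b ^+ 2 * (16 * gamma_cst s).
have A0 : 0 <= A.
  apply: mulr_ge0; first by apply: mulr_ge0; [exact: ler0n|exact: sqr_ge0].
  by apply: mulr_ge0; [exact: ler0n|exact: gamma_cst_ge0].
have Ac : 0 <= A / c by rewrite divr_ge0// ltW.
(* One summand for each requirement on [n]: [8 * b] makes the deformation small enough for [ht], [Q]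
   makes the slide an exact translation on the ball of radius [rho1], [rho1] puts that ball inside
   the domain, and [A / c] gives the final contradiction. *)
pose X := 8 * b + Q + rho1 + A / c.
have X0 : 0 <= X by rewrite /X; lra.
pose n := (Num.truncn X).+1.
have Xn : X < n%:R by have /andP[] := truncn_itv X0.
have n0 : 0 < n%:R :> R by rewrite ltr0n.
have n1 : 1 <= n%:R :> R by rewrite ler1n.
have [nb nQ nr nA] : [/\ 8 * b < n%:R, Q < n%:R, rho1 < n%:R & A / c < n%:R].
  by move: Xn; rewrite /X => Xn; split; lra.
(* With [rho = 2 ^+ n] this makes [d * ln (rho ^+ 2)] exactly [2]. The error is then of order
   [d ^+ 2 * n], that is [1 / n]. *)
pose d : R := (n%:R * ln 2)^-1.
have d0 : 0 < d by rewrite invr_gt0 mulr_gt0.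
have ln0 : ln 2 != 0 :> R by rewrite gt_eqF.
have nn0 : n%:R != 0 :> R by rewrite gt_eqF.
have db : 8 * d * E * `|t| = b / n%:R by rewrite /d /b; field; rewrite ln0 nn0.
pose rho : R := 2 ^+ n.
have rho0 : 0 < rho by rewrite exprn_gt0.
have nrho : n%:R <= rho by rewrite /rho -natrX ler_nat ltnW// ltn_expl.
have hrho : 2 <= d * ln (1 + rho ^+ 2).
  have h : 2 * n%:R * ln 2 <= ln (1 + rho ^+ 2).
    have -> : 2 * n%:R * ln 2 = ln (rho ^+ 2) by rewrite (lnXR 2 rho0) (lnXR n (ltr0n _ 2)); ring.
    rewrite ler_ln ?posrE ?exprn_gt0 ?ltr_pwDl ?sqr_ge0//.
    by rewrite lerDr.
  rewrite /d mulrC ler_pdivlMr ?mulr_gt0// mulrA//.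
have ht : 8 * d * norm2 (1, k) * `|- t| <= 8^-1.
  rewrite normrN -/E db ler_pdivrMr//; lra.
pose r := rho + 1.
have hr : rho < r by rewrite ltrDl.
have gc0 := gamma_cst_ge0 s01.
have I0 : 0 <= 16 * gamma_cst s * n.+1%:R by rewrite !mulr_ge0.
have gb := gain_bound d0 rho0 hrho ht hr I0 (logweight_int s01 mu hu n).
have h4 : 8 * d * norm2 (1, k) * `|- t| <= 4^-1 by apply: (le_trans ht); lra.
(* Composing with the inverse map reverses the sign, so parameter [- t] produces the translate
   [u (x + (t, t * k))]. The cutoff equals [1] at the translated point because [nsq] is there at
   most [Q], hence below [n] and [2 ^+ n]. *)
have vE x : norm2 x <= rho1 -> udef k d (- t) u x = v0 x.
  move=> hxr; rewrite /udef /v0 (defo_inv_near d0 h4).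
    by congr u; congr pair; rewrite /=; ring.
  have e : x - (- t, - t * k) = x + (t, t * k) by congr pair; rewrite /=; ring.
  rewrite e /d ler_pdivrMl ?mulr_gt0// mulr1 -lnXR//.
  rewrite ler_ln ?posrE ?nsq_gt0 ?exprn_gt0// nsqE.
  apply: (@le_trans _ _ Q); last by apply: le_trans nrho; exact: ltW.
  rewrite lerD2l ler_sqr ?nnegrE ?norm2_ge0 ?addr_ge0 ?norm2_ge0 ?(ltW rho10)//.
  by apply: (le_trans (le_norm2D _ _)); rewrite lerD2r.
have mv := cont2_measurable (cont2_udef d0 h4 cu).
have hc : (c%:E <= gain s r u (udef k d (- t) u))%E.
  apply: hgain => //.
  - exact: measurable_inr.
  - exact: inr_ge0.
  move=> z z1 z2; rewrite inrE (_ : norm2 z.1 < r) //.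
  by apply: (le_lt_trans z1); apply: (lt_trans nr); exact: le_lt_trans nrho hr.
have : ((2 * c)%:E <= (680 * (8 * d * norm2 (1, k) * - t) ^+ 2 * (16 * gamma_cst s * n.+1%:R))%:E)%E.
  by apply: le_trans gb; rewrite EFinM lee_wpmul2l ?lee_fin.
rewrite lee_fin leNgt => /negP; apply.
have -> : (8 * d * norm2 (1, k) * - t) ^+ 2 = (b / n%:R) ^+ 2.
  by rewrite mulrN sqrrN -db -/E !exprMn real_normK ?num_real.
have -> : 680 * (b / n%:R) ^+ 2 * (16 * gamma_cst s * n.+1%:R) = A * (n.+1%:R / n%:R ^+ 2).
  by rewrite /A expr_div_n; field.
have h5 : n.+1%:R / n%:R ^+ 2 <= 2 / n%:R :> R.
  rewrite ler_pdivrMr ?exprn_gt0// -mulrA (mulrC _^-1) expr2 mulfK//.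
  by rewrite -natr1; lra.
apply: (le_lt_trans (ler_wpM2l A0 h5)).
rewrite mulrCA ltr_pM2l// ltr_pdivrMr//.
by move: nA; rewrite ltr_pdivrMr// mulrC.
Qed.

End comparison.

Theorem theorem1p3 (R : realType) (s : R) (u : R * R -> R) :
  0 < s < 1 ->
  measurable_fun setT u ->
  solves_eq s u ->
  is_minimizer s u ->
  exists (ubar : R -> R) (w : R * R),
    norm2 w = 1 /\ forall x : R * R, u x = ubar (dot2 w x).
Proof.
move=> s01 mu hsol hmin; have hu := sol_of_solves_eq hsol.
apply: monotone_one_dim; first exact: (sol_continuous s01 mu hu).
exact: (translate_comparable s01 mu hu hmin).
Qed.
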